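(* Let $C\subseteq\mathbb{R}^n$ be an integral polyhedral cone with $\dim(C)=n$, let $\ell:\mathbb{R}^n\to\mathbb{R}$ be an integral linear function which is positive on the interior $\mathrm{Int}(C)$ of $C$, let $d_0>0$ be a real number, and let $v\in\mathrm{Int}(C)$. Let $U\subseteq\mathbb{C}^n$ be an open set with $U\supseteq\mathcal{T}\bigl(C\langle v\rangle^{\ell>d_0}\bigr)$, and let $\theta:U\to\mathbb{C}$ be a holomorphic, $\mathbb{Z}^n$-periodic function which is bounded on $\mathcal{T}\bigl(C\langle v\rangle^{\ell>d_0}\bigr)$. Then for every real $d>d_0$, every $u\in C$ with $u<v$, and every real $R>0$, the restriction of $\theta$ to the closed set $\mathcal{T}_{\leq R}\bigl(C\langle u\rangle^{\ell\geq d}\bigr)$ is definable in the structure $\mathbb{R}_{an,exp}$. Moreover, there is a definable open set $V\subseteq\mathbb{C}^n$ with $V\supseteq\mathcal{T}_{\leq R}\bigl(C\langle u\rangle^{\ell\geq d}\bigr)$ such that $\theta\restriction V$ is definable in $\mathbb{R}_{an,exp}$.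
   Context: $\mathbb{R}_{an,exp}$ is the expansion of the ordered field of real numbers by the real exponential function $\exp:\mathbb{R}\to\mathbb{R}$ and by all restricted analytic functions, i.e. all functions $f\restriction B$ where $B\subseteq\mathbb{R}^k$ is a compact box and $f$ is real analytic on an open neighbourhood of $B$ (extended by $0$ outside $B$). Subsets of $\mathbb{C}^k$ and functions between such sets are called definable if they are definable after identifying $\mathbb{C}$ with $\mathbb{R}^2$ via real and imaginary parts. A polyhedral cone is a nonempty set $C=\{x\in\mathbb{R}^n: Ax\geq 0\}$ for some real $m\times n$ matrix $A$ (inequalities componentwise); it is integral if $A$ can be taken with integer entries; $\dim(C)$ is the dimension of its linear span. A linear map is integral if its standard matrix has integer entries. For $u,v\in\mathbb{R}^n$, $u<v$ means $u_i<v_i$ for all $i$. For $C\subseteq\mathbb{R}^n$ and $v\in\mathbb{R}^n$, $C\langle v\rangle=\{x\in\mathbb{R}^n: x+v\in C\}$; for a function $f:\mathbb{R}^n\to\mathbb{R}$ and $d\in\mathbb{R}$, $C\langle v\rangle^{f>d}=\{x\in\mathbb{R}^n: x+v\in C,\ f(x)>d\}$ and $C\langle v\rangle^{f\geq d}=\{x\in\mathbb{R}^n: x+v\in C,\ f(x)\geq d\}$. For $S\subseteq\mathbb{R}^n$, the tube domain is $\mathcal{T}(S)=\{x+iy\in\mathbb{C}^n: x\in\mathbb{R}^n, y\in S\}$, and for $R>0$, $\mathcal{T}_{\leq R}(S)=\{x+iy\in\mathcal{T}(S): |x_i|\leq R \text{ for } i=1,\dots,n\}$. $\theta$ is $\mathbb{Z}^n$-periodic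 means $\theta(w+k)=\theta(w)$ for $k\in\mathbb{Z}^n$ (whenever $w,w+k\in U$).
   Formalization: Added hypothesis: C⟨u⟩^{ℓ≥d} lies in the interior of C⟨v⟩^{ℓ>d0} (automatic if v−u is interior to C); for a general cone, componentwise u<v does not give this, and θ may then be undefined on the set or no definable open V inside U need exist. *)

(* Defs.v *)
From HB Require Import structures.
From mathcomp Require Import all_boot all_order all_algebra.
From mathcomp Require Import finmap.
From mathcomp Require Import all_classical all_reals all_analysis.
From mathcomp Require Import complex.

Set Implicit Arguments.
Unset Strict Implicit.
Unset Printing Implicit Defensive.

Import Order.TTheory GRing.Theory Num.Theory.
Import numFieldNormedType.Exports.

Local Open Scope classical_set_scope.
Local Open Scope ring_scope.

(* Unconditional (equivalently, absolute) convergence of a real family. *)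
Definition has_sum (R : realType) (I : choiceType) (F : I -> R) (s : R) : Prop :=
  forall e : R, 0 < e ->
    exists A : {fset I}, forall B : {fset I}, (A `<=` B)%fset ->
      `|\sum_(i <- B) F i - s| < e.

Definition real_analytic_on (R : realType) (k : nat)
    (W : set 'rV[R]_k) (f : 'rV[R]_k -> R) : Prop :=
  forall a, W a ->
    exists c : {ffun 'I_k -> nat} -> R,
      nbhs a (fun x : 'rV[R]_k =>
        has_sum (fun m => c m * \prod_(i < k) (x 0 i - a 0 i) ^+ m i) (f x)).

Definition box (R : realType) (k : nat) (lo hi : 'rV[R]_k) : set 'rV[R]_k :=
  [set x | forall i, lo 0 i <= x 0 i <= hi 0 i].

Record restricted_analytic (R : realType) (k : nat) := RestrictedAnalytic {
  ra_lo : 'rV[R]_k;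
  ra_hi : 'rV[R]_k;
  ra_fun : 'rV[R]_k -> R;
  ra_dom : set 'rV[R]_k;
  ra_dom_open : open ra_dom;
  ra_box_sub : box ra_lo ra_hi `<=` ra_dom;
  ra_fun_analytic : real_analytic_on ra_dom ra_fun }.

Definition ra_val (R : realType) (k : nat) (g : restricted_analytic R k)
    (x : 'rV[R]_k) : R :=
  if `[< box (ra_lo g) (ra_hi g) x >] then ra_fun g x else 0.

(* First-order language of R_an,exp, with variables indexed by 'I_n.  Every
   real number is named by a (constant) restricted analytic function, so that
   definability with or without parameters coincide. *)
Inductive term (R : realType) (n : nat) : Type :=
| TVar of 'I_n
| TZero
| TOne
| TOpp of term R n
| TAdd of term R n & term R n
| TMul of term R n & term R n
| TExp of term R n
| TRan k of restricted_analytic R k & ('I_k -> term R n).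

Inductive formula (R : realType) : nat -> Type :=
| FEq n of term R n & term R n : formula R n
| FLt n of term R n & term R n : formula R n
| FNot n of formula R n : formula R n
| FAnd n of formula R n & formula R n : formula R n
| FEx n of formula R n.+1 : formula R n.

Fixpoint eval (R : realType) (n : nat) (v : 'I_n -> R) (t : term R n) : R :=
  match t with
  | TVar i => v i
  | TZero => 0
  | TOne => 1
  | TOpp s => - eval v s
  | TAdd s1 s2 => eval v s1 + eval v s2
  | TMul s1 s2 => eval v s1 * eval v s2
  | TExp s => expR (eval v s)
  | TRan k g s => ra_val g (\row_(i < k) eval v (s i))
  end.

(* The variable bound by FEx is the last one, ord_max. *)
Definition extend (R : realType) (n : nat) (v : 'I_n -> R) (y : R) :
    'I_n.+1 -> R :=
  fun i => if unlift ord_max i is Some j then v j else y.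

Fixpoint sat (R : realType) (n : nat) (p : formula R n) : ('I_n -> R) -> Prop :=
  match p in formula _ n return ('I_n -> R) -> Prop with
  | FEq _ s t => fun v => eval v s = eval v t
  | FLt _ s t => fun v => eval v s < eval v t
  | FNot _ q => fun v => ~ sat q v
  | FAnd _ q1 q2 => fun v => sat q1 v /\ sat q2 v
  | FEx _ q => fun v => exists y : R, sat q (extend v y)
  end.

Definition definable (R : realType) (n : nat) (A : set 'rV[R]_n) : Prop :=
  exists p : formula R n, A = [set x | sat p (x 0)].

Definition realify (R : realType) (n : nat) (w : 'rV[R[i]^o]_n) : 'rV[R]_(n + n) :=
  row_mx (map_mx (@complex.Re R) w) (map_mx (@complex.Im R) w).

Definition definableC (R : realType) (n : nat) (A : set 'rV[R[i]^o]_n) : Prop :=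
  definable ((@realify R n) @` A).

(* Definability of the restriction of f to S, through its graph in C^n x C. *)
Definition definable_restriction (R : realType) (n : nat)
    (f : 'rV[R[i]^o]_n -> R[i]^o) (S : set 'rV[R[i]^o]_n) : Prop :=
  definableC ((fun w => row_mx w (const_mx (f w) : 'rV[R[i]^o]_1)) @` S).

Definition halfspaces (R : realType) (m n : nat) (A : 'M[R]_(m, n)) :
    set 'rV[R]_n :=
  [set x | forall i, 0 <= (A *m x^T) i 0].

Definition integral_polyhedral_cone (R : realType) (n : nat)
    (C : set 'rV[R]_n) : Prop :=
  exists (m : nat) (A : 'M[int]_(m, n)), C = halfspaces (map_mx intr A).

Definition is_linear_span (R : realType) (n : nat) (C : set 'rV[R]_n)
    (W : {vspace 'rV[R]_n}) : Prop :=
  (forall x, C x -> x \in W) /\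
  (forall W' : {vspace 'rV[R]_n}, (forall x, C x -> x \in W') -> (W <= W')%VS).

Definition span_dim (R : realType) (n : nat) (C : set 'rV[R]_n) (m : nat) : Prop :=
  exists W : {vspace 'rV[R]_n}, is_linear_span C W /\ \dim W = m.

Definition integral_linear (R : realType) (n : nat)
    (l : {linear 'rV[R]_n -> R^o}) : Prop :=
  forall j : 'I_n, (l (delta_mx 0 j) : R) \is a Num.int.

Definition vlt (R : realType) (n : nat) (u v : 'rV[R]_n) : Prop :=
  forall i, u 0 i < v 0 i.

Definition shift_gt (R : realType) (n : nat) (C : set 'rV[R]_n) (v : 'rV[R]_n)
    (f : 'rV[R]_n -> R) (d : R) : set 'rV[R]_n :=
  [set x | C (x + v) /\ d < f x].

Definition shift_ge (R : realType) (n : nat) (C : set 'rV[R]_n) (v : 'rV[R]_n)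
    (f : 'rV[R]_n -> R) (d : R) : set 'rV[R]_n :=
  [set x | C (x + v) /\ d <= f x].

Definition tube (R : realType) (n : nat) (S : set 'rV[R]_n) : set 'rV[R[i]^o]_n :=
  [set w | S (map_mx (@complex.Im R) w)].

Definition tube_le (R : realType) (n : nat) (r : R) (S : set 'rV[R]_n) :
    set 'rV[R[i]^o]_n :=
  [set w | tube S w /\ forall j, `|complex.Re (w 0 j)| <= r].

(* A function on an open set U is represented by a total function of which
   only the values on U matter; complex Frechet differentiability at a point
   of the open set U depends only on these values. *)
Definition holomorphic_on (R : realType) (n : nat) (U : set 'rV[R[i]^o]_n)
    (f : 'rV[R[i]^o]_n -> R[i]^o) : Prop :=
  forall w, U w -> differentiable f w.

Definition periodic_on (R : realType) (n : nat) (U : set 'rV[R[i]^o]_n)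
    (f : 'rV[R[i]^o]_n -> R[i]^o) : Prop :=
  forall (w : 'rV[R[i]^o]_n) (k : 'rV[int]_n),
    U w -> U (w + map_mx intr k) -> f (w + map_mx intr k) = f w.

(* Main.v *)
Require Import Defs.
From HB Require Import structures.
From mathcomp Require Import all_boot all_order all_algebra.
From mathcomp Require Import finmap.
From mathcomp Require Import all_classical all_reals all_analysis.
From mathcomp Require Import complex.
From mathcomp Require Import ring lra zify.
Import Order.TTheory GRing.Theory Num.Theory.
Import numFieldNormedType.Exports.

Set Implicit Arguments.
Unset Strict Implicit.
Unset Printing Implicit Defensive.

Local Open Scope classical_set_scope.
Local Open Scope ring_scope.

(** The function [theta] expands on the tube in a Fourier series
    [sum_k c_k exp (2 pi i <k, w>)].  One variable at a time this is the Laurent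
    expansion of a periodic holomorphic function, obtained from Goursat's theorem
    with averages over [N] equidistant points in place of integrals.  Since
    [theta] is bounded on all rays [y + t x] with [x] in [C], only frequencies in
    the dual cone of [C] occur, and by Gordan's lemma these are natural
    combinations of finitely many dual vectors [h_1, ..., h_N].  Hence [theta] is
    a convergent power series in the [exp (- 2 pi <h_j, Im w>)] whose coefficients
    are exponentials in [Re w]: on [{w | Im w - p in C}] with [Re w] bounded it is
    a restricted analytic function of these arguments.  Farkas' lemma turns the
    domain condition into a uniform gap, after which Dickson's lemma yields
    finitely many apexes [p] whose translated cones cover the given set. *)

(** Holomorphy means differentiability at each point; nothing is known about continuity of the
    derivative, which is why Goursat's bisection has to enter. Averages are passed to the limit
    along an ultrafilter: this limit is linear and exists for every bounded sequence, so convergence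
    of averages is never proved; the price is a harmless factor 2. In several variables an iterated
    expansion would require regularity of the coefficients in the remaining variables. A finite
    Fourier transform on a grid avoids this: it is an exact eigenvector of grid translations and has
    an exact inversion formula, so the one-variable estimates apply to each coordinate and the limit
    is taken only once. The geometric obstacle is that a restricted analytic function must be
    analytic beyond its compact box. The moduli of the monomials fill boxes with corner at 0, and
    the radii of convergence have to exceed the sides strictly. Each apex [p] is therefore chosen so
    that even [p - tau *: v] lies in the base of the tube. That one [tau] serves all apexes is not a
    matter of compactness, as the polyhedron is unbounded, but of linear duality. *)

Local Notation Re := complex.Re.
Local Notation Im := complex.Im.

(** The norm of [R[i]] takes its values in [R[i]]; a modulus with values in [R] gives access to the
    total order and to [lra]. *)
Definition cmod (R : realType) (z : R[i]) : R := Normc.normc z.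
Arguments cmod : simpl never.

(** * The real-valued modulus on complex numbers *)

Section Modulus.
Variable R : realType.
Implicit Types (x y z w : R[i]) (a b : R).
Local Open Scope complex_scope.

Lemma normrE z : `|z| = (cmod z)%:C. Proof. by []. Qed.

Lemma cmod_ge0 z : 0 <= cmod z.
Proof. by case: z => a b; exact: sqrtr_ge0. Qed.

Lemma cmod0 : cmod (0 : R[i]) = 0. Proof. exact: Normc.normc0. Qed.

Lemma cmod1 : cmod (1 : R[i]) = 1. Proof. exact: Normc.normc1. Qed.

Lemma cmodM z w : cmod (z * w) = cmod z * cmod w.
Proof. exact: Normc.normcM. Qed.

Lemma cmodV z : cmod z^-1 = (cmod z)^-1. Proof. exact: Normc.normcV. Qed.

Lemma cmodD z w : cmod (z + w) <= cmod z + cmod w.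
Proof. exact: (@le_normcD R). Qed.

Lemma cmodN z : cmod (- z) = cmod z. Proof. exact: (@normcN R). Qed.

Lemma cmodB z w : cmod (z - w) <= cmod z + cmod w.
Proof. by rewrite (le_trans (cmodD _ _)) // cmodN. Qed.

Lemma cmodBC z w : cmod (z - w) = cmod (w - z).
Proof. by rewrite -cmodN opprB. Qed.

Lemma cmod_eq0 z : cmod z = 0 -> z = 0. Proof. exact: Normc.eq0_normc. Qed.

Lemma cmod_gt0 z : z != 0 -> 0 < cmod z.
Proof.
move=> z0; rewrite lt_neqAle cmod_ge0 andbT eq_sym.
by apply: contra z0 => /eqP /cmod_eq0 ->.
Qed.

Lemma cmodR a : cmod a%:C = `|a|.
Proof. by rewrite /cmod /= expr0n addr0 sqrtr_sqr. Qed.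

Lemma cmodi : cmod ('i : R[i]) = 1.
Proof. by rewrite /cmod /= expr0n add0r expr1n sqrtr1. Qed.

Lemma cmodX z m : cmod (z ^+ m) = cmod z ^+ m.
Proof. by elim: m => [|m IH]; rewrite ?expr0 ?cmod1 // !exprS cmodM IH. Qed.

Lemma cmod_nat m : cmod (m%:R : R[i]) = m%:R.
Proof. by rewrite -(rmorph_nat (real_complex R)) cmodR normr_nat. Qed.

Lemma cmod_int (k : int) : cmod (k%:~R : R[i]) = `|k|%:~R.
Proof. by rewrite -(rmorph_int (real_complex R)) cmodR intr_norm. Qed.

Lemma cmod_sqr z : cmod z ^+ 2 = Re z ^+ 2 + Im z ^+ 2.
Proof. by case: z => a b; rewrite /cmod /= sqr_sqrtr // addr_ge0 ?sqr_ge0. Qed.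

Lemma Re_le_cmod z : `|Re z| <= cmod z.
Proof.
rewrite -(@ler_pXn2r _ 2) ?nnegrE ?cmod_ge0 //.
by rewrite cmod_sqr real_normK ?num_real // lerDl sqr_ge0.
Qed.

Lemma Im_le_cmod z : `|Im z| <= cmod z.
Proof.
rewrite -(@ler_pXn2r _ 2) ?nnegrE ?cmod_ge0 //.
by rewrite cmod_sqr real_normK ?num_real // lerDr sqr_ge0.
Qed.

Lemma cmod_le_ReIm z : cmod z <= `|Re z| + `|Im z|.
Proof.
case: z => a b; rewrite [X in cmod X](_ : _ = a%:C + 'i * b%:C) /=; last by simpc.
by rewrite (le_trans (cmodD _ _)) // cmodM cmodi mul1r !cmodR.
Qed.

Lemma cmod_sum (I : Type) (r : seq I) (P : pred I) (F : I -> R[i]) :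
  cmod (\sum_(i <- r | P i) F i) <= \sum_(i <- r | P i) cmod (F i).
Proof.
elim/big_ind2: _ => [|z1 a1 z2 a2 h1 h2|//]; first by rewrite cmod0.
by rewrite (le_trans (cmodD _ _)) // lerD.
Qed.

Lemma cmod_prod (I : Type) (r : seq I) (P : pred I) (F : I -> R[i]) :
  cmod (\prod_(i <- r | P i) F i) = \prod_(i <- r | P i) cmod (F i).
Proof. by apply: (big_morph (@cmod R) cmodM cmod1). Qed.

Lemma ReD z w : Re (z + w) = Re z + Re w. Proof. by case: z w => ? ? []. Qed.
Lemma ImD z w : Im (z + w) = Im z + Im w. Proof. by case: z w => ? ? []. Qed.
Lemma ReN z : Re (- z) = - Re z. Proof. by case: z. Qed.
Lemma ImN z : Im (- z) = - Im z. Proof. by case: z. Qed.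

Lemma Re_sum (I : Type) (r : seq I) (P : pred I) (F : I -> R[i]) :
  Re (\sum_(i <- r | P i) F i) = \sum_(i <- r | P i) Re (F i).
Proof. by apply: (big_morph (@complex.Re R) ReD). Qed.

Lemma Im_sum (I : Type) (r : seq I) (P : pred I) (F : I -> R[i]) :
  Im (\sum_(i <- r | P i) F i) = \sum_(i <- r | P i) Im (F i).
Proof. by apply: (big_morph (@complex.Im R) ImD). Qed.

Lemma ReRM a z : Re (a%:C * z) = a * Re z.
Proof. by case: z => b c /=; rewrite mul0r subr0. Qed.

Lemma ImRM a z : Im (a%:C * z) = a * Im z.
Proof. by case: z => b c /=; rewrite mul0r addr0. Qed.

Lemma RC_inv a : (a^-1)%:C = (a%:C)^-1 :> R[i].
Proof. exact: fmorphV. Qed.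

Lemma RC_nat m : (m%:R)%:C = m%:R :> R[i].
Proof. exact: rmorph_nat. Qed.

End Modulus.

(* This is exp (2 pi i z). *)
Definition ce (R : realType) (z : R[i]) : R[i] :=
  (expR (- (2 * pi * Im z)))%:C%C *
  (cos (2 * pi * Re z) +i* sin (2 * pi * Re z))%C.
Arguments ce : simpl never.

(** * The normalized exponential as a character of period 1 *)

Section Exponential.
Variable R : realType.
Implicit Types (z w : R[i]) (x y : R).
Local Open Scope complex_scope.

Lemma ceD z w : ce (z + w) = ce z * ce w.
Proof.
rewrite /ce ReD ImD !mulrDr opprD expRD cosD sinD rmorphM /=.
by simpc; congr (_ +i* _); ring.
Qed.

Lemma cmod_ce z : cmod (ce z) = expR (- (2 * pi * Im z)).
Proof.
rewrite /ce cmodM cmodR ger0_norm ?expR_ge0 // /cmod /= cos2Dsin2.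
by rewrite sqrtr1 mulr1.
Qed.

Lemma ce0 : ce 0 = 1 :> R[i].
Proof. by rewrite /ce /= !mulr0 oppr0 expR0 cos0 sin0 mul1r. Qed.

Lemma ce_neq0 z : ce z != 0.
Proof.
apply/eqP => h; have := cmod_ce z; rewrite h cmod0 => /eqP.
by rewrite lt_eqF // expR_gt0.
Qed.

Lemma ceN z : ce (- z) = (ce z)^-1.
Proof.
have := ceD z (- z); rewrite subrr ce0 => h.
by apply: (mulfI (ce_neq0 z)); rewrite -h mulfV ?ce_neq0.
Qed.

Lemma ce1 : ce 1 = 1 :> R[i].
Proof.
rewrite /ce /= mulr0 oppr0 expR0 mulr1 mul1r.
by rewrite mulr_natl cos2pi sin2pi.
Qed.

Lemma ceMn z m : ce (z *+ m) = ce z ^+ m.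
Proof. by elim: m => [|m IH]; rewrite ?ce0 // mulrS ceD IH exprS. Qed.

Lemma ceMz z (k : int) : ce (z *~ k) = ce z ^ k.
Proof.
case: k => m; first by rewrite -pmulrn ceMn -exprnP.
by rewrite NegzE mulrNz ceN -pmulrn ceMn -exprnN.
Qed.

Lemma ce_int (k : int) : ce k%:~R = 1 :> R[i].
Proof. by rewrite ceMz ce1 exp1rz. Qed.

Lemma ceDint z (k : int) : ce (z + k%:~R) = ce z.
Proof. by rewrite ceD ce_int mulr1. Qed.

Lemma ce_sum (I : Type) (r : seq I) (P : pred I) (F : I -> R[i]) :
  ce (\sum_(i <- r | P i) F i) = \prod_(i <- r | P i) ce (F i).
Proof. exact: (big_morph (@ce R) ceD ce0). Qed.

Lemma cmod_ceR x : cmod (ce x%:C) = 1.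
Proof. by rewrite cmod_ce /= mulr0 oppr0 expR0. Qed.

End Exponential.

(** * Complex derivatives in one variable *)

Section Differentiability.
Variable R : realType.
Implicit Types (z w h : R[i]) (x y : R) (f g : R[i] -> R[i]).
Local Open Scope complex_scope.

(** The remainder form of the derivative involves no division, so [h = 0] needs no exception. *)
Definition has_cderiv f z a := forall e : R, 0 < e -> exists2 d : R, 0 < d &
  forall h, cmod h < d -> cmod (f (z + h) - f z - a * h) <= e * cmod h.

Definition cdiff f z := exists a, has_cderiv f z a.

Lemma is_derive_expand (f : R -> R) (x df : R) : is_derive x 1 f df ->
  forall e : R, 0 < e -> exists2 d : R, 0 < d &
  forall h : R, `|h| < d -> `|f (x + h) - f x - df * h| <= e * `|h|.
Proof.
move=> [fd fdE] e e0; move: fd fdE; rewrite /derivable /derive => fd fdE.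
move/cvgrPdist_le: fd => /(_ e e0).
rewrite fdE => /nbhs_ballP[d /= d0 H]; exists d => // h hd.
have [->|h0] := eqVneq h 0; first by rewrite addr0 subrr mulr0 subr0 !normr0 mulr0.
have := H h; rewrite /ball /= sub0r normrN => /(_ hd h0).
rewrite [h *: 1]mulr1 distrC => H'.
have -> : f (x + h) - f x - df * h = h * (h^-1 *: (f (h + x) - f x) - df).
  by rewrite /GRing.scale /= [h + x]addrC; field.
by rewrite normrM mulrC ler_wpM2r.
Qed.

Lemma has_cderiv_lipschitz f z a : has_cderiv f z a ->
  exists2 d : R, 0 < d &
  forall h, cmod h < d -> cmod (f (z + h) - f z) <= (cmod a + 1) * cmod h.
Proof.
move=> /(_ 1 ltr01)[d d0 H]; exists d => // h /H {}H.
have -> : f (z + h) - f z = (f (z + h) - f z - a * h) + a * h by ring.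
by rewrite (le_trans (cmodD _ _)) // cmodM mulrDl addrC lerD.
Qed.

Lemma has_cderivM f g z a b : has_cderiv f z a -> has_cderiv g z b ->
  has_cderiv (fun t => f t * g t) z (a * g z + f z * b).
Proof.
move=> fa gb e e0.
have [d1 d10 L] := has_cderiv_lipschitz gb.
(* [K] exceeds the sum of the factors of [e'] in the bounds [T1], [T2] and [T3] below. *)
pose K := cmod (f z) + cmod (g z) + cmod a * (cmod b + 1) + cmod b + 3.
have K0 : 0 < K by rewrite /K ltr_wpDl // !addr_ge0 ?mulr_ge0 ?addr_ge0 ?cmod_ge0.
pose e' := e / K; have e'0 : 0 < e' by rewrite divr_gt0.
have [d2 d20 F] := fa _ e'0; have [d3 d30 G] := gb _ e'0.
exists (Num.min (Num.min d1 d2) (Num.min d3 (Num.min 1 e'))).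
  by rewrite !lt_min d10 d20 d30 ltr01 e'0.
move=> h; rewrite !lt_min => /andP[/andP[h1 h2] /andP[h3 /andP[h4 h5]]].
have -> : f (z + h) * g (z + h) - f z * g z - (a * g z + f z * b) * h =
  (f (z + h) - f z - a * h) * g (z + h) + a * h * (g (z + h) - g z) +
  f z * (g (z + h) - g z - b * h) by ring.
have Lh := L h h1; have {}F := F h h2; have {}G := G h h3.
have h0 := cmod_ge0 h.
have gh : cmod (g (z + h)) <= cmod (g z) + cmod b + 1.
  have -> : g (z + h) = (g (z + h) - g z) + g z by ring.
  apply: (le_trans (cmodD _ _)); rewrite addrC -addrA lerD2l (le_trans Lh) //.
  by rewrite -[leRHS]mulr1 ler_wpM2l ?addr_ge0 ?cmod_ge0 // ltW.
have T1 : cmod ((f (z + h) - f z - a * h) * g (z + h)) <=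
    (e' * (cmod (g z) + cmod b + 1)) * cmod h.
  by rewrite cmodM mulrAC ler_pM ?cmod_ge0.
have T2 : cmod (a * h * (g (z + h) - g z)) <= e' * (cmod a * (cmod b + 1)) * cmod h.
  rewrite !cmodM; apply: (@le_trans _ _ (cmod a * cmod h * ((cmod b + 1) * cmod h))).
    by rewrite ler_wpM2l ?mulr_ge0 ?cmod_ge0.
  rewrite [leLHS](_ : _ = cmod h * (cmod a * (cmod b + 1)) * cmod h); last by ring.
  by rewrite !ler_wpM2r ?mulr_ge0 ?addr_ge0 ?cmod_ge0 // ltW.
have T3 : cmod (f z * (g (z + h) - g z - b * h)) <= e' * cmod (f z) * cmod h.
  by rewrite cmodM [leRHS](_ : _ = cmod (f z) * (e' * cmod h)); [rewrite ler_wpM2l ?cmod_ge0|ring].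
apply: (le_trans (cmodD _ _)); apply: (le_trans (lerD (cmodD _ _) T3)).
rewrite (le_trans (lerD (lerD T1 T2) (lexx _))) // -!mulrDl ler_wpM2r //.
rewrite -!mulrDr /e' -mulrA ler_piMr ?(ltW e0) //.
rewrite mulrC ler_pdivrMr // mul1r /K.
by have := cmod_ge0 (f z); lra.
Qed.

Lemma ce_expand0 (e : R) : 0 < e -> exists2 d : R, 0 < d &
  forall z, cmod z < d -> cmod (ce z - 1 - (2 * pi)%:C * 'i * z) <= e * cmod z.
Proof.
move=> e0; have p0 := @pi_gt0 R.
(* The errors below add up to at most [6 * e1 * (2 * pi * cmod z)], whence [12 * pi]. *)
pose e1 := Num.min (e / (12 * pi)) 1.
have e10 : 0 < e1 by rewrite lt_min ltr01 divr_gt0 // mulr_gt0.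
have e1e : 12 * pi * e1 <= e.
  by rewrite mulrC -ler_pdivlMr ?mulr_gt0 // ge_min lexx.
have e11 : e1 <= 1 by rewrite ge_min lexx orbT.
have [d1 d10 E] := is_derive_expand (is_derive_expR (0 : R)) e10.
have [d2 d20 Cs] := is_derive_expand (is_derive_cos (0 : R)) e10.
have [d3 d30 Sn] := is_derive_expand (is_derive_sin (0 : R)) e10.
pose d := Num.min (Num.min d1 d2) (Num.min d3 (e1 / 4)).
have d0 : 0 < d by rewrite !lt_min d10 d20 d30 divr_gt0.
exists (d / (2 * pi)); first by rewrite divr_gt0 // mulr_gt0.
move=> z; rewrite ltr_pdivlMr ?mulr_gt0 // => zd.
set X := - (2 * pi * Im z); set Y := 2 * pi * Re z.
have X1 : `|X| <= 2 * pi * cmod z.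
  by rewrite normrN normrM ger0_norm ?mulr_ge0 ?(ltW p0) // ler_wpM2l ?Im_le_cmod ?mulr_ge0 ?(ltW p0).
have Y1 : `|Y| <= 2 * pi * cmod z.
  by rewrite normrM ger0_norm ?mulr_ge0 ?(ltW p0) // ler_wpM2l ?Re_le_cmod ?mulr_ge0 ?(ltW p0).
have Xd : `|X| < d by rewrite (le_lt_trans X1) // mulrC.
have Yd : `|Y| < d by rewrite (le_lt_trans Y1) // mulrC.
move: Xd Yd; rewrite !lt_min => /andP[/andP[x1 _] /andP[_ x4]] /andP[/andP[_ y2] /andP[y3 y4]].
have {}E := E _ x1; have {}Cs := Cs _ y2; have {}Sn := Sn _ y3.
rewrite add0r expR0 mul1r in E.
rewrite add0r cos0 sin0 oppr0 mul0r subr0 in Cs.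
rewrite add0r cos0 sin0 subr0 mul1r in Sn.
have EX : `|expR X - 1| <= 2 * `|X|.
  have -> : expR X - 1 = (expR X - 1 - X) + X by ring.
  rewrite (le_trans (ler_normD _ _)) // mulrDl mul1r lerD2r (le_trans E) //.
  by rewrite ler_piMl.
have EX2 : `|expR X| <= 2.
  have -> : expR X = (expR X - 1) + 1 by ring.
  rewrite (le_trans (ler_normD _ _)) // normr1; lra.
(* With exponent [X + iY], the remainder splits into the real remainders of [expR], [cos] and [sin]
   and a mixed term [Y * (expR X - 1)] of second order. *)
have -> : ce z - 1 - (2 * pi)%:C * 'i * z =
  (expR X - 1 - X)%:C + (expR X)%:C * ((cos Y - 1)%:C + 'i * (sin Y - Y)%:C)
   + 'i * (Y * (expR X - 1))%:C.
  rewrite /ce -/X -/Y; case: z @X @Y {zd X1 Y1 x1 x4 y2 y3 y4 E Cs Sn EX EX2} => a b X Y.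
  by rewrite /X /Y /=; simpc; congr (_ +i* _); ring.
apply: (le_trans (cmodD _ _)); apply: (le_trans (lerD (cmodD _ _) (lexx _))).
rewrite !cmodM !cmodR cmodi mul1r.
have T2 : cmod ((cos Y - 1)%:C + 'i * (sin Y - Y)%:C) <= 2 * e1 * `|Y|.
  apply: (le_trans (cmodD _ _)); rewrite cmodM cmodi mul1r !cmodR.
  rewrite (le_trans (lerD Cs Sn)) //; lra.
have T3 : `|Y * (expR X - 1)| <= e1 * `|Y|.
  rewrite normrM mulrC ler_wpM2r // (le_trans EX) //; lra.
have T4 : `|expR X| * cmod ((cos Y - 1)%:C + 'i * (sin Y - Y)%:C) <= 2 * (2 * e1 * `|Y|).
  by rewrite ler_pM ?cmod_ge0.
rewrite (le_trans (lerD (lerD E T4) T3)) //.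
apply: (@le_trans _ _ (6 * e1 * (2 * pi * cmod z))).
  have : e1 * `|X| <= e1 * (2 * pi * cmod z) by rewrite ler_pM2l.
  have : e1 * `|Y| <= e1 * (2 * pi * cmod z) by rewrite ler_pM2l.
  lra.
rewrite [leLHS](_ : _ = 12 * pi * e1 * cmod z); last by ring.
by rewrite ler_wpM2r ?cmod_ge0.
Qed.

Lemma has_cderiv_ce (k : int) z :
  has_cderiv (fun t => ce (t *~ k)) z (ce (z *~ k) * ((2 * pi)%:C * 'i * k%:~R)).
Proof.
move=> e e0; pose A := cmod (ce (z *~ k)); pose K := `|k%:~R| : R.
have A0 : 0 < A by rewrite cmod_gt0 // ce_neq0.
have K0 : 0 <= K by rewrite normr_ge0.
have eAK : 0 < e / (A * (K + 1)) by rewrite divr_gt0 // mulr_gt0 // ltr_wpDl.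
have [d d0 H] := ce_expand0 eAK.
exists (d / (K + 1)); first by rewrite divr_gt0 // ltr_wpDl.
move=> h; rewrite ltr_pdivlMr ?ltr_wpDl // => hd.
have cm : cmod (h *~ k) = cmod h * K.
  by rewrite -mulrzr cmodM cmod_int /K intr_norm.
have := H (h *~ k); rewrite cm => H'.
have {}H' := H' (le_lt_trans (ler_wpM2l (cmod_ge0 h) (ler_wpDr ler01 (lexx _))) hd).
rewrite mulrzDl ceD.
have -> : ce (z *~ k) * ce (h *~ k) - ce (z *~ k) -
   ce (z *~ k) * ((2 * pi)%:C * 'i * k%:~R) * h =
   ce (z *~ k) * (ce (h *~ k) - 1 - (2 * pi)%:C * 'i * (h *~ k)).
  by rewrite -[h *~ k]mulrzr; ring.
rewrite cmodM -/A (le_trans (ler_wpM2l (ltW A0) H')) //.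
have -> : A * (e / (A * (K + 1)) * (cmod h * K)) = e * cmod h * (K / (K + 1)).
  by field; rewrite (gt_eqF A0) gt_eqF // ltr_wpDl.
rewrite ler_piMr ?mulr_ge0 ?cmod_ge0 ?(ltW e0) //.
by rewrite ler_pdivrMr ?ltr_wpDl // mul1r lerDl.
Qed.

End Differentiability.

(** * A linear limit defined on all bounded sequences *)

Section GeneralizedLimit.
Variable R : realType.
Implicit Types (u v : nat -> R[i]) (B : R).
Local Open Scope complex_scope.

Definition bdd_seq u := exists B, forall s, cmod (u s) <= B.

(** The limit along an ultrafilter containing all cofinite sets of indices: a bounded real sequence
    has one because [[- B, B]] is compact. Real and imaginary parts are bounded separately, hence
    the factor 2 in the norm estimate. *)
Lemma glim_exists : exists L : (nat -> R[i]) -> R[i], [/\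
  forall u v, bdd_seq u -> bdd_seq v -> L (fun s => u s + v s) = L u + L v,
  forall c u, bdd_seq u -> L (fun s => c * u s) = c * L u,
  forall c, L (fun=> c) = c &
  forall u B s0, bdd_seq u -> (forall s, (s0 <= s)%N -> cmod (u s) <= B) ->
    cmod (L u) <= 2 * B].
Proof.
have [G [GU Goo]] := @ultraFilterLemma nat \oo _.
have GP : ProperFilter G by exact: ultra_proper.
have cvgG (x : nat -> R) B : (forall s, `|x s| <= B) -> cvg (x @ G).
  move=> xB; have := @segment_compact R (- B) B.
  move=> /(_ (x @ G) _) [] => [|p [_ cl]].
    suff : G [set s | `[- B, B]%classic (x s)] by [].
    by apply: filterS filterT => s _ /=; rewrite in_itv /= -ler_norml.
  (* An ultrafilter converges to each of its cluster points. *)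
  apply/cvg_ex; exists p => A /= pA.
  have [//|GC] := in_ultra_setVsetC (x @^-1` A) GU.
  by have [t []] := cl (~` A) A GC pA.
pose Lr (x : nat -> R) : R := lim (x @ G).
have LrD x y B B' : (forall s, `|x s| <= B) -> (forall s, `|y s| <= B') ->
    Lr (fun s => x s + y s) = Lr x + Lr y.
  by move=> /cvgG cx /cvgG cy; rewrite /Lr limD.
have LrZ a x B : (forall s, `|x s| <= B) -> Lr (fun s => a * x s) = a * Lr x.
  by move=> /cvgG cx; apply/cvg_lim => //; apply: cvgMr.
have LrC a : Lr (fun=> a) = a by rewrite /Lr lim_cst.
have LrB x B B' s0 : (forall s, `|x s| <= B') ->
    (forall s, (s0 <= s)%N -> `|x s| <= B) -> `|Lr x| <= B.
  move=> /cvgG cx h; have ev : \forall s \near G, (s0 <= s)%N.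
    by apply: Goo; exists s0.
  rewrite ler_norml; apply/andP; split.
    apply: limr_ge => //; apply: filterS ev => s /h.
    by rewrite ler_norml => /andP[].
  apply: limr_le => //; apply: filterS ev => s /h.
  by rewrite ler_norml => /andP[].
have Rb u B : (forall s, cmod (u s) <= B) -> forall s, `|Re (u s)| <= B.
  by move=> h s; rewrite (le_trans (Re_le_cmod _)).
have Ib u B : (forall s, cmod (u s) <= B) -> forall s, `|Im (u s)| <= B.
  by move=> h s; rewrite (le_trans (Im_le_cmod _)).
exists (fun u => Lr (fun s => Re (u s)) +i* Lr (fun s => Im (u s))).
split=> [u v [B uB] [B' vB]|[a b] u [B uB]|[a b]|u B s0 [B' uB'] uB].
- simpc; rewrite -(LrD _ _ _ _ (Rb _ _ uB) (Rb _ _ vB)) -(LrD _ _ _ _ (Ib _ _ uB) (Ib _ _ vB)).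
  by congr (Lr _ +i* Lr _); apply/funext => s; rewrite ?ReD ?ImD.
- have Zb (c : R) (x : nat -> R) (D : R) : (forall s, `|x s| <= D) -> forall s, `|c * x s| <= `|c| * D.
    by move=> h s; rewrite normrM ler_wpM2l.
  simpc; rewrite -(LrZ a _ _ (Rb _ _ uB)) -(LrZ a _ _ (Ib _ _ uB)).
  rewrite -(LrZ b _ _ (Rb _ _ uB)) -mulNr -(LrZ (- b) _ _ (Ib _ _ uB)).
  rewrite -(LrD _ _ _ _ (Zb a _ _ (Rb _ _ uB)) (Zb (- b) _ _ (Ib _ _ uB))).
  rewrite -(LrD _ _ _ _ (Zb a _ _ (Ib _ _ uB)) (Zb b _ _ (Rb _ _ uB))).
  congr (Lr _ +i* Lr _); apply/funext => s; case: (u s) => c d /=; ring.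
- by rewrite /= !LrC.
- rewrite (le_trans (cmod_le_ReIm _)) //= mulrDl mul1r lerD //.
    by apply: (LrB _ _ _ s0 (Rb _ _ uB')) => s /uB; apply: le_trans (Re_le_cmod _).
  by apply: (LrB _ _ _ s0 (Ib _ _ uB')) => s /uB; apply: le_trans (Im_le_cmod _).
Qed.

Definition glim := sval (cid glim_exists).

Lemma glimD u v : bdd_seq u -> bdd_seq v ->
  glim (fun s => u s + v s) = glim u + glim v.
Proof. by rewrite /glim; case: cid => L [? ? ? ?] /=; auto. Qed.

Lemma glimZ c u : bdd_seq u -> glim (fun s => c * u s) = c * glim u.
Proof. by rewrite /glim; case: cid => L [? ? ? ?] /=; auto. Qed.

Lemma glim_cst c : glim (fun=> c) = c.
Proof. by rewrite /glim; case: cid => L [? ? ? ?] /=; auto. Qed.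

Lemma glim_le u B s0 : bdd_seq u ->
  (forall s, (s0 <= s)%N -> cmod (u s) <= B) -> cmod (glim u) <= 2 * B.
Proof. by rewrite /glim; case: cid => L [? ? ? H] /=; exact: H. Qed.

Lemma bdd_seqD u v : bdd_seq u -> bdd_seq v -> bdd_seq (fun s => u s + v s).
Proof.
move=> [B uB] [B' vB]; exists (B + B') => s.
by rewrite (le_trans (cmodD _ _)) // lerD.
Qed.

Lemma bdd_seqZ c u : bdd_seq u -> bdd_seq (fun s => c * u s).
Proof. by move=> [B uB]; exists (cmod c * B) => s; rewrite cmodM ler_wpM2l ?cmod_ge0. Qed.

Lemma glimB u v : bdd_seq u -> bdd_seq v ->
  glim (fun s => u s - v s) = glim u - glim v.
Proof.
move=> bu bv; rewrite -mulN1r -glimZ // -glimD //; last exact: bdd_seqZ.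
by congr glim; apply/funext => s; rewrite mulN1r.
Qed.

Lemma bdd_seq_sum (I : Type) (r : seq I) (F : I -> nat -> R[i]) :
  (forall i, bdd_seq (F i)) -> bdd_seq (fun s => \sum_(i <- r) F i s).
Proof.
move=> bF; elim: r => [|i r IH].
  by exists 0 => s; rewrite big_nil cmod0.
have [B H] := bdd_seqD (bF i) IH; exists B => s; by rewrite big_cons.
Qed.

Lemma glim_sum (I : Type) (r : seq I) (F : I -> nat -> R[i]) :
  (forall i, bdd_seq (F i)) ->
  glim (fun s => \sum_(i <- r) F i s) = \sum_(i <- r) glim (F i).
Proof.
move=> bF; elim: r => [|i r IH].
  rewrite big_nil -[RHS](glim_cst 0); congr glim.
  by apply/funext => s; rewrite big_nil.
rewrite big_cons -IH -glimD //; last exact: bdd_seq_sum.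
by congr glim; apply/funext => s; rewrite big_cons.
Qed.

Lemma glim_eq u v : bdd_seq u -> bdd_seq v ->
  (forall e : R, 0 < e -> exists s0, forall s, (s0 <= s)%N -> cmod (u s - v s) <= e) ->
  glim u = glim v.
Proof.
move=> bu bv h; apply/eqP; rewrite -subr_eq0; apply/eqP/cmod_eq0/eqP.
rewrite eq_le cmod_ge0 andbT -glimB //; apply/ler_addgt0Pr => e e0.
have e2 : 0 < e / 2 by rewrite divr_gt0.
have [s0 {}h] := h _ e2.
rewrite add0r (le_trans (glim_le _ h)) //; last by rewrite mulrC divfK.
have [B H] := bdd_seqD bu (bdd_seqZ (-1) bv); exists B => s.
by rewrite -mulN1r.
Qed.

End GeneralizedLimit.

(** * Goursat's theorem for Riemann sums *)

Section Goursat.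
Variable R : realType.
Implicit Types (f : R[i] -> R[i]) (z a b h : R[i]).
Local Open Scope complex_scope.

(** The left-endpoint Riemann sum of [f] along the segment from [z] to [z + h]. With [2 ^ s] points,
    halving the segment lowers [s] by one and is an exact identity. *)
Definition rsum f s z h : R[i] :=
  h / (2 ^ s)%:R * \sum_(j < 2 ^ s) f (z + j%:R * (h / (2 ^ s)%:R)).

(** The boundary of the parallelogram at [z] with sides [a] and [b]. Opposite edges are sampled in
    the same direction and then subtracted, instead of running backwards along one of them. *)
Definition rcircuit f s z a b : R[i] :=
  rsum f s z a + rsum f s (z + a) b - rsum f s (z + b) a - rsum f s z b.

Let two_neq0 s : (2 ^ s)%:R != 0 :> R[i].
Proof. by rewrite pnatr_eq0 -lt0n expn_gt0. Qed.

Lemma rsum_half f s z h :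
  rsum f s.+1 z h = rsum f s z (h / 2) + rsum f s (z + h / 2) (h / 2).
Proof.
have E : h / (2 ^ s.+1)%:R = h / 2 / (2 ^ s)%:R.
  by rewrite expnS natrM invfM mulrA.
have t0 := two_neq0 s.
rewrite /rsum E -mulrDr; congr (_ * _).
rewrite (_ : 2 ^ s.+1 = 2 ^ s + 2 ^ s)%N; last by rewrite expnS mul2n addnn.
rewrite big_split_ord /=; congr (_ + _).
apply: eq_bigr => j _; congr f; rewrite natrD.
by move: (2 ^ s)%:R t0 => t t0; field.
Qed.

(** Each inner edge occurs twice with opposite signs and the same sample points, so the cancellation
    is exact at every level. *)
Lemma rcircuit_quarters f s z a b : rcircuit f s.+1 z a b =
  rcircuit f s z (a / 2) (b / 2) + rcircuit f s (z + a / 2) (a / 2) (b / 2) +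
  rcircuit f s (z + b / 2) (a / 2) (b / 2) +
  rcircuit f s (z + a / 2 + b / 2) (a / 2) (b / 2).
Proof.
rewrite /rcircuit !rsum_half.
have -> : z + a / 2 + a / 2 = z + a by field.
have -> : z + b / 2 + b / 2 = z + b by field.
have -> : z + a / 2 + b / 2 + a / 2 = z + a + b / 2 by field.
have -> : z + a / 2 + b / 2 + b / 2 = z + b + a / 2 by field.
have -> : z + b / 2 + a / 2 = z + a / 2 + b / 2 by ring.
ring.
Qed.

(** The term quadratic in [h], which contains the left-endpoint error, does not depend on the
    position of the edge; it cancels between opposite edges. *)
Lemma rcircuit_affine p q s z a b : rcircuit (fun t => p * t + q) s z a b = 0.
Proof.
have t0 := two_neq0 s.
pose J : R[i] := \sum_(j < 2 ^ s) j%:R.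
have E w h : rsum (fun t => p * t + q) s w h =
    p * h * w + p * h ^+ 2 * (J / (2 ^ s)%:R ^+ 2) + q * h.
  rewrite /rsum big_split /= -mulr_sumr big_split /= -mulr_suml -/J.
  rewrite !sumr_const card_ord -(mulr_natl w) -(mulr_natl q).
  by move: (2 ^ s)%:R t0 J => t t0 J; field.
by rewrite /rcircuit !E; ring.
Qed.

Lemma rsum_le f s z h (M : R) :
  (forall x : R, 0 <= x <= 1 -> cmod (f (z + x%:C * h)) <= M) ->
  cmod (rsum f s z h) <= cmod h * M.
Proof.
move=> H; have t0 : 0 < (2 ^ s)%:R :> R by rewrite ltr0n expn_gt0.
rewrite /rsum !cmodM cmodV cmod_nat -mulrA ler_wpM2l ?cmod_ge0 //.
rewrite mulrC ler_pdivrMr //; apply: (le_trans (cmod_sum _ _ _)).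
rewrite mulr_natr -[in leRHS](card_ord (2 ^ s)) -sumr_const ler_sum // => j _.
have -> : j%:R * (h / (2 ^ s)%:R) = (j%:R / (2 ^ s)%:R : R)%:C * h.
  by rewrite rmorphM /= RC_inv !RC_nat; ring.
apply: H; rewrite divr_ge0 ?ler0n // ler_pdivrMr // mul1r ler_nat.
by rewrite ltnW.
Qed.

Lemma rcircuitB f g s z a b :
  rcircuit (fun t => f t - g t) s z a b = rcircuit f s z a b - rcircuit g s z a b.
Proof. by rewrite /rcircuit /rsum !sumrB; ring. Qed.

Lemma rcircuit_le f s z a b (M : R) :
  (forall x y : R, 0 <= x <= 1 -> 0 <= y <= 1 ->
     cmod (f (z + x%:C * a + y%:C * b)) <= M) ->
  cmod (rcircuit f s z a b) <= 2 * (cmod a + cmod b) * M.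
Proof.
move=> H; have I0 : 0 <= (0 : R) <= 1 by rewrite lexx ler01.
have I1 : 0 <= (1 : R) <= 1 by rewrite lexx ler01.
have H1 : cmod (rsum f s z a) <= cmod a * M.
  by apply: rsum_le => x hx; have := H x 0 hx I0; rewrite mul0r addr0.
have H2 : cmod (rsum f s (z + a) b) <= cmod b * M.
  by apply: rsum_le => x hx; have := H 1 x I1 hx; rewrite mul1r.
have H3 : cmod (rsum f s (z + b) a) <= cmod a * M.
  by apply: rsum_le => x hx; have := H x 1 hx I1; rewrite mul1r addrAC.
have H4 : cmod (rsum f s z b) <= cmod b * M.
  by apply: rsum_le => x hx; have := H 0 x I0 hx; rewrite mul0r addr0.
rewrite /rcircuit; apply: (le_trans (cmodB _ _)).
apply: (le_trans (lerD (le_trans (cmodB _ _) (lerD (cmodD _ _) (lexx _))) (lexx _))).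
lra.
Qed.

(** Replaces a bound on the contour integral: it concerns all fine levels [s] and presupposes no
    limit. *)
Definition small_circuit f z a b (e : R) :=
  exists s0, forall s, (s0 <= s)%N -> cmod (rcircuit f s z a b) <= e.

Lemma small_circuit_quarters f z a b e :
  (forall p q : bool, small_circuit f (z + p%:R * (a / 2) + q%:R * (b / 2))
     (a / 2) (b / 2) (e / 4)) -> small_circuit f z a b e.
Proof.
move=> H; have [s1 H1] := H false false; have [s2 H2] := H true false.
have [s3 H3] := H false true; have [s4 H4] := H true true.
exists (maxn (maxn s1 s2) (maxn s3 s4)).+1 => -[//|s]; rewrite ltnS !geq_max.
move=> /andP[/andP[/H1 {}H1 /H2 {}H2] /andP[/H3 {}H3 /H4 {}H4]].
rewrite !(mul0r, mul1r, addr0) in H1 H2 H3 H4.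
rewrite rcircuit_quarters; apply: (le_trans (cmodD _ _)).
apply: (le_trans (lerD (cmodD _ _) (lexx _))).
apply: (le_trans (lerD (lerD (cmodD _ _) (lexx _)) (lexx _))).
lra.
Qed.

(* The four-fold bisection argument works with Riemann sums directly: they
   vanish exactly on affine functions, so the integral is never needed. *)
Lemma goursat f z a b :
  (forall x y : R, 0 <= x <= 1 -> 0 <= y <= 1 -> cdiff f (z + x%:C * a + y%:C * b)) ->
  forall e : R, 0 < e -> small_circuit f z a b e.
Proof.
move=> df e e0; apply: contrapT => bad.
pose half k : R := (2 ^+ k)^-1.
pose Z (p : R * R) := z + p.1%:C * a + p.2%:C * b.
(* The tolerance scales like the area, as each of the four quarters inherits a quarter of it. *)
pose Bad k p := ~ small_circuit f (Z p) ((half k)%:C * a) ((half k)%:C * b) (e * half k ^+ 2).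
have halfS k : half k.+1 = half k / 2.
  by rewrite /half exprS invfM mulrC.
have half0 k : 0 < half k by rewrite invr_gt0 exprn_gt0.
have step k p : Bad k p -> exists q : R * R, [/\ Bad k.+1 q,
   p.1 <= q.1, q.1 + half k.+1 <= p.1 + half k,
   p.2 <= q.2 & q.2 + half k.+1 <= p.2 + half k].
  move=> bp; apply: contrapT => nq; apply: bp; apply: small_circuit_quarters => c d.
  have -> : Z p + c%:R * ((half k)%:C * a / 2) + d%:R * ((half k)%:C * b / 2) =
     Z (p.1 + c%:R * half k.+1, p.2 + d%:R * half k.+1).
    rewrite /Z /= halfS !rmorphD !rmorphM /= !RC_nat !RC_inv !RC_nat; ring.
  have hh (w : R[i]) : (half k)%:C * w / 2 = (half k.+1)%:C * w.
    by rewrite halfS fmorph_div /= RC_nat; ring.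
  rewrite !hh.
  have -> : e * half k ^+ 2 / 4 = e * half k.+1 ^+ 2 by rewrite halfS; field.
  apply: contrapT => bq; apply: nq; exists (p.1 + c%:R * half k.+1, p.2 + d%:R * half k.+1).
  have h0 := half0 k.
  by split=> //=; rewrite halfS; case: {bq} c; case: {hh} d => /=; lra.
have /choice[nx nxP] : forall kp : nat * (R * R), exists q, Bad kp.1 kp.2 ->
   [/\ Bad kp.1.+1 q, kp.2.1 <= q.1, q.1 + half kp.1.+1 <= kp.2.1 + half kp.1,
   kp.2.2 <= q.2 & q.2 + half kp.1.+1 <= kp.2.2 + half kp.1].
  move=> [k p] /=; have [/step [q H]|nb] := pselect (Bad k p); first by exists q.
  by exists p => /nb.
pose P := fix P k := if k is k'.+1 then nx (k', P k') else (0, 0).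
have PB k : Bad k (P k).
  elim: k => [|k IH]; last by have [] := nxP (k, P k) IH.
  by rewrite /Bad /Z /half /= expr0 invr1 !mul1r !mul0r !addr0 expr1n mulr1.
have PS k : [/\ (P k).1 <= (P k.+1).1, (P k.+1).1 + half k.+1 <= (P k).1 + half k,
   (P k).2 <= (P k.+1).2 & (P k.+1).2 + half k.+1 <= (P k).2 + half k].
  by have [] := nxP (k, P k) (PB k).
have nested (g : nat -> R) : g 0%N = 0 -> (forall k, g k <= g k.+1) ->
    (forall k, g k.+1 + half k.+1 <= g k + half k) ->
    exists2 x : R, 0 <= x <= 1 & forall k, g k <= x <= g k + half k.
  move=> g0 up dn.
  have upm k m : g k <= g (k + m)%N.
    by elim: m => [|m IH]; rewrite ?addn0 // addnS (le_trans IH).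
  have dnm k m : g (k + m)%N + half (k + m)%N <= g k + half k.
    by elim: m => [|m IH]; rewrite ?addn0 // addnS (le_trans (dn _)).
  have cross k m : g m <= g k + half k.
    have [km|/ltnW mk] := leqP k m.
      rewrite (le_trans _ (dnm k (m - k)%N)) // subnKC // lerDl ltW //.
    by rewrite (le_trans (upm m (k - m)%N)) // subnKC // lerDl ltW.
  pose E := range g; have Eu k : ubound E (g k + half k) by move=> _ [m _ <-].
  have hs : has_sup E by split; [exists (g 0%N), 0%N|exists (g 0%N + half 0%N)].
  have lo k : g k <= sup E by apply: sup_upper_bound => //; exists k.
  have hi k : sup E <= g k + half k by apply: sup_le_ub => //; case: hs.
  exists (sup E); last by move=> k; rewrite lo hi.
  have := lo 0%N; have := hi 0%N; rewrite g0 /half expr0 invr1 add0r => -> ->.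
  by [].
have [x x01 xP] : exists2 x : R, 0 <= x <= 1 & forall k, (P k).1 <= x <= (P k).1 + half k.
  by apply: (nested (fun k => (P k).1)) => // k; case: (PS k).
have [y y01 yP] : exists2 x : R, 0 <= x <= 1 & forall k, (P k).2 <= x <= (P k).2 + half k.
  by apply: (nested (fun k => (P k).2)) => // k; case: (PS k).
have [c fc] := df x y x01 y01.
pose N := cmod a + cmod b + 1.
have N0 : 0 < N by rewrite ltr_wpDl // addr_ge0 ?cmod_ge0.
(* The circuit has length at most [2 * hk * N] and the remainder on it is at most [e1 * (hk * N)];
   with this [e1] the product is [e * hk ^+ 2], the tolerance of [Bad]. *)
have e1 : 0 < e / (2 * N ^+ 2) by rewrite divr_gt0 // mulr_gt0 // exprn_gt0.
have [d d0 H] := fc _ e1.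
have [k kd] : exists k, N * half k < d.
  exists (Num.bound (N / d)).
  by rewrite /half ltr_pdivrMr ?exprn_gt0 // mulrC -ltr_pdivrMr // upper_nthrootP.
have h0 := half0 k; set hk := half k in kd h0 *.
(* The estimate holds at every level [s], so badness is refuted from level 0 on. *)
apply: (PB k); exists 0%N => s _; rewrite -/hk.
set w := Z (x, y) in fc H.
(* The first-order approximation of [f] at the limit point; being affine, it can be subtracted for
   free. *)
pose g t := c * t + (f w - c * w).
have -> : rcircuit f s (Z (P k)) (hk%:C * a) (hk%:C * b) =
    rcircuit (fun t => f t - g t) s (Z (P k)) (hk%:C * a) (hk%:C * b).
  by rewrite rcircuitB rcircuit_affine subr0.
have ab0 : 0 <= cmod a + cmod b by rewrite addr_ge0 ?cmod_ge0.
have abN : cmod a + cmod b <= N by rewrite /N lerDl ler01.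
apply: (@le_trans _ _ (2 * (cmod (hk%:C * a) + cmod (hk%:C * b)) *
   (e / (2 * N ^+ 2) * (hk * N)))).
  apply: rcircuit_le => p q p01 q01.
  set t := (X in f X).
  pose t1 := (P k).1 + p * hk - x; pose t2 := (P k).2 + q * hk - y.
  have tE : t - w = t1%:C * a + t2%:C * b.
    by rewrite /t /w /Z /t1 /t2 /= !(rmorphB, rmorphD, rmorphM) /=; ring.
  have T1 : `|t1| <= hk.
    have : 0 <= p * hk <= hk.
      by case/andP: p01 => p0 p1; rewrite mulr_ge0 ?(ltW h0) // ler_piMl ?(ltW h0).
    have := xP k; rewrite -/hk /t1 ler_norml; lra.
  have T2 : `|t2| <= hk.
    have : 0 <= q * hk <= hk.
      by case/andP: q01 => p0 p1; rewrite mulr_ge0 ?(ltW h0) // ler_piMl ?(ltW h0).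
    have := yP k; rewrite -/hk /t2 ler_norml; lra.
  have tw : cmod (t - w) <= hk * N.
    rewrite tE (le_trans (cmodD _ _)) // !cmodM !cmodR.
    rewrite (le_trans _ (ler_wpM2l (ltW h0) abN)) // mulrDr lerD //.
      by rewrite ler_wpM2r ?cmod_ge0.
    by rewrite ler_wpM2r ?cmod_ge0.
  have := H (t - w); rewrite (_ : w + (t - w) = t); last by ring.
  move=> H'; have {}H' := H' (le_lt_trans tw _).
  have -> : f t - g t = f t - f w - c * (t - w) by rewrite /g; ring.
  apply: (le_trans (H' _)); first by rewrite mulrC.
  by rewrite ler_wpM2l // ltW.
rewrite !cmodM cmodR (ger0_norm (ltW h0)) -mulrDr.
rewrite [leLHS](_ : _ = e * hk ^+ 2 * ((cmod a + cmod b) / N)); last first.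
  by field; rewrite gt_eqF.
by rewrite ler_piMr ?mulr_ge0 ?exprn_ge0 ?(ltW e0) ?(ltW h0) // ler_pdivrMr // mul1r.
Qed.

End Goursat.

(** * Averages over equidistant points *)

Section Averages.
Variable R : realType.
Implicit Types (f g : R[i] -> R[i]) (z t : R[i]) (B : R).
Local Open Scope complex_scope.

Definition avg N g : R[i] := N%:R^-1 * \sum_(j < N) g (j%:R / N%:R).

(** Stands for the integral over the unit interval; the powers of two match the dyadic levels of
    [rsum]. *)
Definition mean g : R[i] := glim (fun s => avg (2 ^ s) g).

Definition bdd01 g := exists B, forall x : R, 0 <= x < 1 -> cmod (g x%:C) <= B.

Let grid01 N (j : 'I_N) : 0 <= (j%:R / N%:R : R) < 1.
Proof.
have N0 : (0 < N)%N by case: N j => [[]|].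
by rewrite divr_ge0 ?ler0n //= ltr_pdivrMr ?ltr0n // mul1r ltr_nat ltn_ord.
Qed.

Let gridE N (j : 'I_N) : j%:R / N%:R = (j%:R / N%:R : R)%:C.
Proof. by rewrite fmorph_div /= !RC_nat. Qed.

Lemma avg_le N g B : (0 < N)%N ->
  (forall x : R, 0 <= x < 1 -> cmod (g x%:C) <= B) -> cmod (avg N g) <= B.
Proof.
move=> N0 gB; rewrite /avg cmodM cmodV cmod_nat mulrC ler_pdivrMr ?ltr0n //.
rewrite (le_trans (cmod_sum _ _ _)) // mulr_natr -[in leRHS](card_ord N).
by rewrite -sumr_const ler_sum // => j _; rewrite gridE gB.
Qed.

Lemma eq_avg N f g : (forall x : R, 0 <= x < 1 -> f x%:C = g x%:C) ->
  avg N f = avg N g.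
Proof.
by move=> fg; congr (_ * _); apply: eq_bigr => j _; rewrite gridE fg.
Qed.

Lemma avgD N f g : avg N (fun x => f x + g x) = avg N f + avg N g.
Proof. by rewrite /avg big_split mulrDr. Qed.

Lemma avgZ N c g : avg N (fun x => c * g x) = c * avg N g.
Proof. by rewrite /avg -mulr_sumr mulrCA. Qed.

Lemma avg_sum N (I : Type) (r : seq I) (F : I -> R[i] -> R[i]) :
  avg N (fun x => \sum_(i <- r) F i x) = \sum_(i <- r) avg N (F i).
Proof. by rewrite /avg exchange_big /= mulr_sumr. Qed.

Lemma bdd_seq_avg g : bdd01 g -> bdd_seq (fun s => avg (2 ^ s) g).
Proof. by move=> [B gB]; exists B => s; rewrite avg_le // expn_gt0. Qed.

Lemma eq_mean f g : (forall x : R, 0 <= x < 1 -> f x%:C = g x%:C) ->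
  mean f = mean g.
Proof. by move=> fg; congr glim; apply/funext => s; exact: eq_avg. Qed.

Lemma meanD f g : bdd01 f -> bdd01 g ->
  mean (fun x => f x + g x) = mean f + mean g.
Proof.
move=> /bdd_seq_avg bf /bdd_seq_avg bg; rewrite -glimD //.
by congr glim; apply/funext => s; rewrite avgD.
Qed.

Lemma meanZ c g : bdd01 g -> mean (fun x => c * g x) = c * mean g.
Proof.
move=> /bdd_seq_avg bg; rewrite -glimZ //.
by congr glim; apply/funext => s; rewrite avgZ.
Qed.

Lemma mean_sum (I : Type) (r : seq I) (F : I -> R[i] -> R[i]) :
  (forall i, bdd01 (F i)) ->
  mean (fun x => \sum_(i <- r) F i x) = \sum_(i <- r) mean (F i).
Proof.
move=> bF; rewrite -glim_sum => [|i]; last exact: bdd_seq_avg.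
by congr glim; apply/funext => s; rewrite avg_sum.
Qed.

Lemma mean_le g B : (forall x : R, 0 <= x < 1 -> cmod (g x%:C) <= B) ->
  cmod (mean g) <= 2 * B.
Proof.
move=> gB; apply: (@glim_le _ _ _ 0%N) => [|s _].
  by apply: bdd_seq_avg; exists B.
by rewrite avg_le // expn_gt0.
Qed.

Lemma rsum_avg f s z : rsum f s z 1 = avg (2 ^ s) (fun x => f (z + x)).
Proof.
by rewrite /rsum /avg mul1r.
Qed.

(** Goursat on the parallelogram with sides 1 and [t]: the two edges parallel to [t] cancel by
    periodicity, and the other two are the averages compared here. *)
Lemma mean_translate g t :
  (forall x y : R, 0 <= x <= 1 -> 0 <= y <= 1 -> cdiff g (x%:C + y%:C * t)) ->
  (forall y : R, 0 <= y <= 1 -> g (y%:C * t + 1) = g (y%:C * t)) ->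
  bdd01 g -> bdd01 (fun x => g (t + x)) -> mean (fun x => g (t + x)) = mean g.
Proof.
move=> dg pg b0 b1; apply: glim_eq; try exact: bdd_seq_avg.
have H : forall x y : R, 0 <= x <= 1 -> 0 <= y <= 1 -> cdiff g (0 + x%:C * 1 + y%:C * t).
  by move=> x y hx hy; rewrite add0r mulr1; exact: dg.
move=> e e0; have [s0 {}H] := goursat H e0; exists s0 => s /H.
have -> : rcircuit g s 0 1 t = rsum g s 0 1 - rsum g s t 1.
  rewrite /rcircuit !add0r; have -> : rsum g s 1 t = rsum g s 0 t; last by ring.
  rewrite /rsum; congr (_ * _); apply: eq_bigr => j _; rewrite add0r addrC.
  have -> : j%:R * (t / (2 ^ s)%:R) = (j%:R / (2 ^ s)%:R : R)%:C * t.
    by rewrite -gridE; ring.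
  by apply: pg; case/andP: (grid01 j) => -> /ltW ->.
rewrite !rsum_avg cmodBC; congr (cmod (_ - _) <= _); congr avg.
by apply/funext => x; rewrite add0r.
Qed.

(** The real part of [1 - ce x] is [1 - cos (2 * pi * x)]. The cosine decreases on the first half of
    the period, and [x] may be replaced by [1 - x]. *)
Lemma ce_re_lt1 (d x : R) : 0 < d <= 1 / 2 -> d <= x <= 1 - d ->
  1 - cos (2 * pi * d) <= cmod (ce x%:C - 1).
Proof.
move=> /andP[d0 d1] /andP[x0 x1]; have p0 := @pi_gt0 R.
apply: (@le_trans _ _ (1 - cos (2 * pi * x))); last first.
  apply: le_trans (Re_le_cmod _); rewrite /ce /= mulr0 oppr0 expR0 mul1r mul0r subr0.
  by rewrite distrC ler_norm.
rewrite lerD2l lerN2.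
have key y : d <= y <= 1 / 2 -> cos (2 * pi * y) <= cos (2 * pi * d).
  move=> /andP[dy y1].
  have lp : forall u : R, 0 <= u <= 1 / 2 -> 2 * pi * u \in `[0, pi]%R.
    move=> u /andP[u0 u1]; rewrite in_itv /= !mulr_ge0 ?(ltW p0) //=.
    by rewrite [leLHS](_ : _ = pi * (2 * u)); [rewrite ler_piMr ?(ltW p0) //; lra|ring].
  move: (dy); rewrite le_eqVlt => /orP[/eqP -> //|dy'].
  rewrite ltW // ltr_cos ?lp ?(ltW d0) //; last by rewrite (le_trans (ltW d0)).
  by rewrite ltr_pM2l ?mulr_gt0.
have [xh|xh] := leP x (1 / 2); first by apply: key; rewrite x0.
have -> : cos (2 * pi * x) = cos (2 * pi * (1 - x)).
  have -> : 2 * pi * (1 - x) = - (2 * pi * x) + pi *+ 2 by ring.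
  by rewrite cosD2pi cosN.
by apply: key; apply/andP; split; lra.
Qed.

Lemma ce_neq1 (x : R) : 0 < x < 1 -> ce x%:C != 1.
Proof.
move=> /andP[x0 x1]; pose d := Num.min x (1 - x).
have d0 : 0 < d by rewrite lt_min x0 subr_gt0.
have dx : d <= x by rewrite ge_min lexx.
have dx' : d <= 1 - x by rewrite ge_min lexx orbT.
have p0 := @pi_gt0 R.
rewrite -subr_eq0; apply/eqP => E.
have := @ce_re_lt1 d x; rewrite E cmod0 d0 dx /= => /(_ _ _).
have -> : d <= 1 / 2 by lra.
have -> : x <= 1 - d by lra.
move=> /(_ isT isT); apply/negP; rewrite -ltNge subr_gt0 -[X in _ < X](@cos0 R).
rewrite ltr_cos ?mulr_gt0 // in_itv /= ?lexx ?(ltW p0) //.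
rewrite !mulr_ge0 ?(ltW p0) ?(ltW d0) //=.
by rewrite [leLHS](_ : _ = pi * (2 * d)); [rewrite ler_piMr ?(ltW p0) //; lra|ring].
Qed.

(** For [k != 0] this is a geometric sum whose ratio is an [N]-th root of unity; [|k| < N] keeps the
    ratio away from 1. *)
Lemma avg_ce N (k : int) : (`|k| < N)%N ->
  avg N (fun x => ce (x *~ k)) = (k == 0)%:R.
Proof.
move=> kN; have N0 : N%:R != 0 :> R[i].
  by rewrite pnatr_eq0 -lt0n (leq_ltn_trans _ kN).
have [->|k0] := eqVneq k 0.
  rewrite /avg (eq_bigr (fun=> 1)) => [|j _]; last by rewrite mulr0z ce0.
  by rewrite sumr_const card_ord mulVf.
have w1 : ce ((N%:R : R[i])^-1 *~ k) != 1.
  have Nn0 : 0 < N%:R :> R by rewrite ltr0n (leq_ltn_trans _ kN).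
  have pos : ce ((N%:R : R[i])^-1 *~ `|k|%N) != 1.
    have -> : (N%:R : R[i])^-1 *~ `|k|%N = ((`|k|%N)%:R / N%:R : R)%:C.
      by rewrite fmorph_div /= !RC_nat -pmulrn mulr_natl.
    apply: ce_neq1; apply/andP; split; first by rewrite divr_gt0 // ltr0n absz_gt0.
    by rewrite ltr_pdivrMr // mul1r ltr_nat.
  have [kp|kn] := leP 0 k; first by rewrite -(gez0_abs kp).
  rewrite -[k]opprK -(ltz0_abs kn) mulrNz ceN.
  by apply: contra pos => /eqP E; rewrite -[X in X == _]invrK E invr1.
rewrite /avg (eq_bigr (fun j : 'I_N => ce ((N%:R : R[i])^-1 *~ k) ^+ j)) => [|j _]; last first.
  rewrite -ceMn -(mulrzr (j%:R / N%:R)) -(mulrzr (N%:R^-1)).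
  by rewrite -(mulr_natl (N%:R^-1 * k%:~R)) mulrA.
have := subrX1 (ce ((N%:R : R[i])^-1 *~ k)) N; rewrite -ceMn.
have -> : (N%:R : R[i])^-1 *~ k *+ N = k%:~R.
  by rewrite -(mulr_natr (_ *~ k)) -(mulrzl (N%:R^-1)) -mulrA mulVf ?mulr1.
rewrite ce_int subrr => /esym/eqP; rewrite mulf_eq0 subr_eq0 (negPf w1) /= => /eqP ->.
by rewrite mulr0.
Qed.

End Averages.

(** * Laurent expansion of a periodic function on a strip *)

Section LaurentSeries.
Variable R : realType.
Implicit Types (f g h : R[i] -> R[i]) (z t : R[i]) (B : R) (k : int).
Local Open Scope complex_scope.

Lemma ReMz z k : Re (z *~ k) = k%:~R * Re z.
Proof. by rewrite -(mulrzr z) mulrC -(rmorph_int (real_complex R)) ReRM. Qed.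

Lemma ImMz z k : Im (z *~ k) = k%:~R * Im z.
Proof. by rewrite -(mulrzr z) mulrC -(rmorph_int (real_complex R)) ImRM. Qed.

Lemma conjc_ceR (x : R) : (ce x%:C)^* = ce (- x%:C).
Proof.
rewrite /ce /= oppr0 !mulr0 oppr0 expR0; simpc.
by rewrite cosN sinN.
Qed.

(* Chernoff's proof that Fourier coefficients of a bounded function decay, with
   Bessel's inequality replaced by an AM-GM estimate on blocks of [r ^ 2]
   coefficients. *)
Lemma avg_block h (H : R) (kap : nat -> int) r N : (0 < r)%N ->
  (forall x : R, 0 <= x < 1 -> cmod (h x%:C) <= H) ->
  (forall p q, (p < r ^ 2)%N -> (q < r ^ 2)%N -> (`|kap p - kap q| < N)%N) ->
  (forall p q, (p < r ^ 2)%N -> (q < r ^ 2)%N -> kap p = kap q -> p = q) ->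
  cmod (avg N (fun x => \sum_(p < r ^ 2) (h x * ce (x *~ kap p)))) <=
    r%:R * (H ^+ 2 + 1).
Proof.
move=> r0 hH kapN kapI.
have N0 : (0 < N)%N by have := kapN 0%N 0%N; rewrite expn_gt0 r0 /= => /(_ isT isT); apply: leq_ltn_trans.
pose E (x : R[i]) := \sum_(p < r ^ 2) ce (x *~ kap p).
have H0 : 0 <= H by rewrite (le_trans (cmod_ge0 _) (hH 0 _)) // lexx ltr01.
have rr : 0 < r%:R :> R by rewrite ltr0n.
rewrite (@eq_avg _ _ _ (fun x => h x * E x)); last by move=> x _; rewrite mulr_sumr.
(* Orthogonality of distinct frequencies: the mean square of [E] is the number [r ^ 2] of its terms.
   The bound [N] on frequency differences excludes aliasing. *)
have EE : N%:R^-1 * (\sum_(j < N) cmod (E (j%:R / N%:R)) ^+ 2) = r%:R ^+ 2 :> R.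
  apply: (@complexI R); rewrite rmorphM /= rmorph_sum /= RC_inv RC_nat.
  have e2 (j : 'I_N) : (cmod (E (j%:R / N%:R)) ^+ 2)%:C =
     \sum_(p < r ^ 2) \sum_(q < r ^ 2) ce ((j%:R / N%:R) *~ (kap p - kap q)).
    rewrite rmorphXn /= -normrE sqr_normc /E rmorph_sum mulr_suml.
    apply: eq_bigr => p _; rewrite mulr_sumr; apply: eq_bigr => q _.
    have rl k : (j%:R / N%:R) *~ k = (j%:R / N%:R *~ k : R)%:C.
      by rewrite rmorphMz fmorph_div /= !RC_nat.
    by rewrite mulrzBr ceD !rl -conjc_ceR.
  under eq_bigr do rewrite e2.
  rewrite exchange_big /=.
  under eq_bigr do rewrite exchange_big /=.
  rewrite mulr_sumr (eq_bigr (fun=> 1)) => [|p _].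
    by rewrite sumr_const card_ord rmorphXn /= RC_nat natrX.
  rewrite mulr_sumr (bigD1 p) //= [X in _ + X]big1 => [|q qp].
    have := @avg_ce R N (kap p - kap p); rewrite /avg subrr eqxx => -> //.
    by rewrite addr0.
  have := @avg_ce R N (kap p - kap q); rewrite /avg => -> //; last exact: kapN.
  rewrite subr_eq0; case: eqP => // e; case/eqP: qp; apply/val_inj => /=.
  by apply/esym; apply: kapI.
have Nn0 : 0 < N%:R :> R by rewrite ltr0n.
rewrite /avg cmodM cmodV cmod_nat (le_trans (ler_wpM2l _ (cmod_sum _ _ _))) ?invr_ge0 ?ler0n //.
(* The product [H * X] is split by the AM-GM inequality with weight [r], which balances [H ^+ 2]
   against the mean square [r ^ 2]. *)
apply: (@le_trans _ _ (N%:R^-1 * \sum_(j < N) (r%:R * H ^+ 2 + r%:R^-1 * cmod (E (j%:R / N%:R)) ^+ 2))).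
  rewrite ler_wpM2l ?invr_ge0 ?ler0n //; apply: ler_sum => j _; rewrite cmodM.
  have hj : cmod (h (j%:R / N%:R)) <= H.
    have -> : j%:R / N%:R = (j%:R / N%:R : R)%:C by rewrite fmorph_div /= !RC_nat.
    by rewrite hH // divr_ge0 ?ler0n //= ltr_pdivrMr // mul1r ltr_nat ltn_ord.
  set X := cmod (E _); have X0 : 0 <= X by exact: cmod_ge0.
  apply: (@le_trans _ _ (H * X)); first by rewrite ler_wpM2r.
  rewrite -(ler_pM2l rr) [leRHS](_ : _ = (r%:R * H) ^+ 2 + X ^+ 2); last first.
    by field; rewrite gt_eqF.
  rewrite [leLHS](_ : _ = (r%:R * H) * X); last by ring.
  by have := sqr_ge0 (r%:R * H - X); nra.
rewrite big_split /= sumr_const card_ord mulrDr -mulr_sumr (mulrCA _ r%:R^-1) EE.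
rewrite -(mulr_natl (r%:R * H ^+ 2)) [leLHS](_ : _ = r%:R * (H ^+ 2 + 1)) //.
by field; rewrite !gt_eqF.
Qed.

(** Geometrically small steps keep every [beta p] within [D / (1 - q)] of [beta 0], while the mean
    of the first [r ^ 2] terms is at most [A / r] and so tends to 0. *)
Lemma cauchy_mean_bound (beta : nat -> R[i]) (D q A : R) : 0 <= q < 1 -> 0 <= D -> 0 <= A ->
  (forall p, cmod (beta p - beta p.+1) <= D * q ^+ p) ->
  (forall r, (0 < r)%N -> cmod (\sum_(p < r ^ 2) beta p) <= r%:R * A) ->
  cmod (beta 0%N) <= D / (1 - q).
Proof.
move=> /andP[q0 q1] D0 A0 step blk; set T := D / (1 - q).
have q1' : 0 < 1 - q by rewrite subr_gt0.
have near0 p : cmod (beta 0%N - beta p) <= T.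
  have : cmod (beta 0%N - beta p) <= D * \sum_(i < p) q ^+ i.
    elim: p => [|p IH]; first by rewrite subrr cmod0 big_ord0 mulr0.
    rewrite big_ord_recr /= mulrDr; apply: le_trans (lerD IH (step p)).
    by rewrite (le_trans _ (cmodD _ _)) // subrKA.
  move=> h; rewrite (le_trans h) // /T ler_wpM2l // -[leRHS]mul1r ler_pdivlMr //.
  have := subrX1 q p; rewrite -opprB -[q - 1]opprB mulNr => /oppr_inj E.
  by rewrite mulrC -E lerBlDr lerDl exprn_ge0.
apply/ler_addgt0Pr => e e0.
pose r := (Num.bound (A / e)).+1.
have r0 : 0 < r%:R :> R by rewrite ltr0n.
have rA : A <= e * r%:R.
  rewrite mulrC -ler_pdivrMr // ltW // (lt_le_trans (archi_boundP _)) ?divr_ge0 ?(ltW e0) //.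
  by rewrite ler_nat.
have := blk r isT; set S := \sum_(p < _) _ => Sb.
have r20 : 0 < r%:R ^+ 2 :> R by rewrite exprn_gt0.
have E : (r ^ 2)%:R * beta 0%N = \sum_(p < r ^ 2) (beta 0%N - beta p) + S.
  by rewrite sumrB sumr_const card_ord subrK mulr_natl.
rewrite -(ler_pM2l r20) -natrX -[X in X * cmod _](cmod_nat R) -cmodM E.
apply: (le_trans (cmodD _ _)); rewrite mulrDr lerD //.
  rewrite (le_trans (cmod_sum _ _ _)) // mulr_natl -[X in _ *+ X](card_ord (r ^ 2)).
  by rewrite -sumr_const ler_sum.
rewrite (le_trans Sb) // natrX expr2 -mulrA ler_wpM2l ?(ltW r0) // mulrC //.
Qed.

Section Strip.
Variables (e : R) (f : R[i] -> R[i]) (B : R).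
Hypothesis e0 : 0 < e.
Hypothesis f_diff : forall z, `|Im z| <= e -> cdiff f z.
Hypothesis f_per : forall z, `|Im z| <= e -> f (z + 1) = f z.
Hypothesis f_bnd : forall z, `|Im z| <= e -> cmod (f z) <= B.

(** Translation to the edge of the strip gives coefficients of order [q ^ (2 |k|)]. On the half
    strip [ce (t *~ k)] is at most [q ^ (- |k|)], so terms of order [q ^ |k|] remain. *)
Let q := expR (- (pi * e)) : R.

Definition fourier k := mean (fun x => f x * ce (x *~ (- k))).

Let B0 : 0 <= B.
Proof. by rewrite (le_trans (cmod_ge0 (f 0))) // f_bnd // normr0 ltW. Qed.

Let q01 : 0 < q < 1.
Proof. by rewrite expR_gt0 -expR0 ltr_expR oppr_lt0 mulr_gt0 // pi_gt0. Qed.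

Let ce_le (x : R) k : cmod (ce (x%:C *~ k)) = 1.
Proof. by rewrite -rmorphMz /= cmod_ceR. Qed.

Let f_bdd t k : `|Im t| <= e -> bdd01 (fun x => f (t + x) * ce (x *~ k)).
Proof.
move=> te; exists B => x _; rewrite cmodM ce_le mulr1 f_bnd //.
by rewrite ImD /= addr0.
Qed.

Lemma fourier_translate t k : `|Im t| <= e ->
  mean (fun x => f (t + x) * ce (x *~ (- k))) = ce (t *~ k) * fourier k.
Proof.
move=> te; pose g z := f z * ce (z *~ (- k)).
have gE x : f (t + x) * ce (x *~ (- k)) = ce (t *~ k) * g (t + x).
  rewrite /g mulrzDl ceD [ce (t *~ - k)](_ : _ = (ce (t *~ k))^-1); last first.
    by rewrite mulrNz ceN.
  by field; exact: ce_neq0.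
have yt (y : R) : 0 <= y <= 1 -> `|Im (y%:C * t)| <= e.
  move=> /andP[y0 y1]; rewrite ImRM normrM ger0_norm // (le_trans _ te) //.
  by rewrite ler_piMl.
have bg (w : R[i]) : `|Im w| <= e -> bdd01 (fun x => g (w + x)).
  move=> we; have [C HC] := f_bdd (- k) we; exists (cmod (ce (w *~ (- k))) * C) => x x01.
  rewrite /g mulrzDl ceD mulrCA cmodM ler_wpM2l ?cmod_ge0 //; exact: HC.
rewrite (@eq_mean _ _ (fun x => ce (t *~ k) * g (t + x))); last by move=> x _; rewrite gE.
rewrite meanZ; last exact: bg.
congr (_ * _); apply: mean_translate.
- move=> x y x01 y01; have ze : `|Im (x%:C + y%:C * t)| <= e.
    by rewrite ImD /= add0r yt.
  have [a fa] := f_diff ze; exists (a * ce ((x%:C + y%:C * t) *~ (- k)) +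
     f (x%:C + y%:C * t) * (ce ((x%:C + y%:C * t) *~ (- k)) * ((2 * pi)%:C * 'i * (- k)%:~R))).
  by apply: has_cderivM => //; exact: has_cderiv_ce.
- move=> y y01; rewrite /g f_per ?yt // mulrzDl ceD.
  by rewrite -[1 *~ _]/((- k)%:~R) ce_int mulr1.
- have z0 : `|Im (0 : R[i])| <= e by rewrite normr0 ltW.
  have [C HC] := bg 0 z0.
  by exists C => x /HC; rewrite add0r.
- exact: bg.
Qed.

Lemma ce_growth t k : `|Im t| <= e / 2 -> cmod (ce (t *~ k)) <= (q ^+ `|k|%N)^-1.
Proof.
move=> te; rewrite cmod_ce ImMz.
rewrite -expRM_natl -expRN ler_expR.
have p0 := @pi_gt0 R.
have ki : (`|k|%N)%:R = `|k%:~R| :> R by rewrite -intr_norm -abszE -pmulrn.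
rewrite ki (le_trans (ler_norm _)) // normrN !normrM (ger0_norm (ltW p0)) normr_nat.
rewrite [leRHS](_ : _ = 2 * (pi * (`|k%:~R| * (e / 2)))); last by field.
by rewrite -mulrA !ler_wpM2l // ltW.
Qed.

(** The mean is translated to the edge of the strip, above or below according to the sign of [k],
    where [ce (t *~ k)] has its greatest modulus. *)
Lemma fourier_le k : cmod (fourier k) <= 2 * B * q ^+ (`|k| * 2)%N.
Proof.
pose s : R := if 0 <= k then - e else e.
have te : `|Im (s *i)| <= e by rewrite /= /s; case: ifP; rewrite ?normrN ger0_norm // ltW.
have := fourier_translate k te => E.
have le2 : cmod (ce (s *i *~ k) * fourier k) <= 2 * B.
  rewrite -E; apply: mean_le => x _; rewrite cmodM ce_le mulr1 f_bnd //.
  by rewrite ImD /= addr0.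
have cE : cmod (ce (s *i *~ k)) = (q ^+ (`|k| * 2)%N)^-1.
  rewrite cmod_ce ImMz /= -expRM_natl -expRN.
  congr expR; rewrite /s; have [k0|k0] := leP 0 k.
    by rewrite -{1}(gez0_abs k0) natrM -pmulrn; ring.
  by rewrite -{1}[k]opprK -(ltz0_abs k0) natrM rmorphN /= -pmulrn; ring.
move: le2; rewrite cmodM cE mulrC ler_pdivrMr ?exprn_gt0 //.
by case/andP: q01.
Qed.

Section Point.
Variable t : R[i].
Hypothesis te : `|Im t| <= e / 2.

Let te1 : `|Im t| <= e.
Proof. by rewrite (le_trans te) // ler_pdivrMr // ler_pMr // ler1n. Qed.

(* The value at an integer is [0], as division by zero returns [0]. *)
Let h x := (f (t + x) - f t) / (ce x - 1).

Let fh (x : R) : 0 <= x < 1 -> f (t + x%:C) = f t + h x%:C * (ce x%:C - 1).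
Proof.
move=> /andP[x0 x1]; have [->|x0'] := eqVneq x 0.
  by rewrite ce0 subrr mulr0 !addr0.
have c1 : ce x%:C - 1 != 0.
  by rewrite subr_eq0; apply: ce_neq1; rewrite lt_neqAle eq_sym x0' x0 x1.
by rewrite /h divfK //; ring.
Qed.

(** Near 0 the derivative of [f] at [t] controls the quotient, near 1 periodicity reduces to the
    same case, and in between the denominator is bounded below. *)
Let h_bnd : exists H, forall x : R, 0 <= x < 1 -> cmod (h x%:C) <= H.
Proof.
have [a fa] := f_diff te1; have p2 := @pi_ge2 R; have p0 := @pi_gt0 R.
have [d1 d10 Lf] := has_cderiv_lipschitz fa.
have [d2 d20 Lc] := @ce_expand0 R 1 ltr01.
pose d := Num.min (Num.min d1 d2) (1 / 2).
have d0 : 0 < d by rewrite !lt_min d10 d20 divr_gt0.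
have dh : d <= 1 / 2 by rewrite ge_min lexx orbT.
pose c := 1 - cos (2 * pi * d).
have near0 (y : R) : `|y| < d -> cmod ((f (t + y%:C) - f t) / (ce y%:C - 1)) <= cmod a + 1.
  rewrite !lt_min => /andP[/andP[y1 y2] _].
  have := Lf y%:C; have := Lc y%:C; rewrite !cmodR => /(_ y2) C1 /(_ y1) F1.
  have a1 : 0 <= cmod a + 1 by rewrite addr_ge0 ?cmod_ge0.
  have [->|y0] := eqVneq y 0; first by rewrite addr0 subrr mul0r cmod0.
  have yp : 0 < `|y| by rewrite normr_gt0.
  have Cl : `|y| <= cmod (ce y%:C - 1).
    have : cmod ((2 * pi)%:C * 'i * y%:C) <= cmod (ce y%:C - 1 - (2 * pi)%:C * 'i * y%:C) + cmod (ce y%:C - 1).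
      by rewrite cmodBC (le_trans _ (cmodD _ _)) // subrK.
    rewrite !cmodM cmodi !cmodR mulr1 (ger0_norm (_ : 0 <= 2 * pi)) ?mulr_ge0 ?(ltW p0) //.
    have : 4 * `|y| <= 2 * pi * `|y| by rewrite ler_wpM2r // ?(ltW yp); lra.
    lra.
  rewrite cmodM cmodV ler_pdivrMr ?(lt_le_trans yp) //.
  by rewrite (le_trans F1) // ler_wpM2l.
exists (cmod a + 1 + 2 * B / c) => x /andP[x0 x1].
have c0 : 0 < c.
  rewrite subr_gt0 -[X in _ < X](@cos0 R) ltr_cos ?mulr_gt0 // in_itv /= ?lexx ?(ltW p0) //.
  rewrite !mulr_ge0 ?(ltW p0) ?(ltW d0) //=.
  by rewrite [leLHS](_ : _ = pi * (2 * d)); [rewrite ler_piMr ?(ltW p0) //; lra|ring].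
have cB : 0 <= 2 * B / c by rewrite divr_ge0 ?mulr_ge0 ?(ltW c0).
have [xd|dx] := ltP x d.
  by rewrite ler_wpDr // near0 // ger0_norm.
have [dx1|xd1] := ltP (1 - d) x.
  rewrite ler_wpDr //; have -> : h x%:C = (f (t + (x - 1)%:C) - f t) / (ce (x - 1)%:C - 1).
    have xE : x%:C = (x - 1)%:C + 1 :> R[i] by rewrite rmorphB /= subrK.
    rewrite /h {1}xE addrA f_per; last by rewrite ImD /= addr0.
    by rewrite xE ceD ce1 mulr1.
  by apply: near0; rewrite ltr_norml; lra.
rewrite ler_wpDl ?addr_ge0 ?cmod_ge0 // /h cmodM cmodV.
have cc : c <= cmod (ce x%:C - 1) by apply: ce_re_lt1; rewrite ?d0 ?dx.
rewrite ler_pM ?cmod_ge0 ?invr_ge0 ?cmod_ge0 //.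
  rewrite (le_trans (cmodB _ _)) // mulrDl mul1r lerD // f_bnd //.
  by rewrite ImD /= addr0.
by rewrite lef_pV2 ?posrE // (lt_le_trans c0).
Qed.

Let b k := mean (fun x => h x * ce (x *~ (- k))).

Let hk_bdd k : bdd01 (fun x => h x * ce (x *~ k)).
Proof. by case: h_bnd => H hH; exists H => x /hH; rewrite cmodM ce_le mulr1. Qed.

Lemma mean_ce k : mean (fun x : R[i] => ce (x *~ k)) = (k == 0)%:R.
Proof.
rewrite -[RHS]glim_cst; apply: glim_eq.
- by apply: bdd_seq_avg; exists 1 => x _; rewrite ce_le.
- by exists (cmod ((k == 0)%:R : R[i])).
- move=> d d0; exists `|k|%N => s ks; rewrite avg_ce ?subrr ?cmod0 ?(ltW d0) //.
  by rewrite (leq_ltn_trans ks) // ltn_expl.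
Qed.

(** Multiplication by [ce x - 1] shifts frequencies by one. Since
    [f (t + x) - f t = h x * (ce x - 1)], the terms of the Laurent series are differences of
    coefficients of [h], up to the constant [f t], and their sums telescope. *)
Let Fb k : ce (t *~ k) * fourier k = b (k - 1) - b k + f t * (k == 0)%:R.
Proof.
rewrite -fourier_translate //.
rewrite (@eq_mean _ _ (fun x => (h x * ce (x *~ (- (k - 1))) + (-1) * (h x * ce (x *~ (- k)))) + f t * ce (x *~ (- k)))); last first.
  move=> x /fh ->; rewrite (_ : - (k - 1) = - k + 1); last by ring.
  by rewrite mulrzDr ceD; ring.
have b1 : bdd01 (fun x => (-1) * (h x * ce (x *~ (- k)))).
  by have [H hH] := hk_bdd (- k); exists H => x /hH; rewrite mulN1r cmodN.
have b2 : bdd01 (fun x => f t * ce (x *~ (- k))).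
  by exists (cmod (f t)) => x _; rewrite cmodM ce_le mulr1.
have b3 : bdd01 (fun x : R[i] => ce (x *~ (- k))) by exists 1 => x _; rewrite ce_le.
rewrite meanD //; last first.
  have [H hH] := hk_bdd (- (k - 1)); have [H' hH'] := b1; exists (H + H') => x x01.
  by rewrite (le_trans (cmodD _ _)) // lerD ?hH ?hH'.
rewrite meanD // meanZ // meanZ // mean_ce oppr_eq0 mulN1r //.
Qed.

Let Fk_le k : cmod (ce (t *~ k) * fourier k) <= 2 * B * q ^+ `|k|%N.
Proof.
have q0 : 0 < q by case/andP: q01.
rewrite cmodM (le_trans (ler_pM (cmod_ge0 _) (cmod_ge0 _) (ce_growth k te) (fourier_le k))) //.
rewrite mulrCA ler_wpM2l ?mulr_ge0 // muln2 -addnn exprD mulrA mulVf ?mul1r //.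
by rewrite gt_eqF // exprn_gt0.
Qed.

Let b_le (kap : nat -> int) m :
  (forall p p', kap p = kap p' -> p = p') ->
  (forall p, cmod (b (kap p) - b (kap p.+1)) <= 2 * B * q ^+ (m + p)) ->
  cmod (b (kap 0%N)) <= 2 * B * q ^+ m / (1 - q).
Proof.
move=> kapI bS; have [H hH] := h_bnd; case/andP: (q01) => q0 q1.
apply: (@cauchy_mean_bound (fun p => b (kap p)) _ _ (2 * (H ^+ 2 + 1))).
- by rewrite ltW.
- by rewrite !mulr_ge0 ?exprn_ge0 // ltW.
- by rewrite mulr_ge0 // addr_ge0 // sqr_ge0.
- by move=> p; rewrite -mulrA -exprD.
move=> r r0; rewrite -mean_sum //.
(* From this level on [2 ^ s] exceeds all differences of the frequencies in the block, as
   [avg_block] requires. *)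
rewrite mulrCA; apply: (@glim_le _ _ _ (\max_(p < r ^ 2) \max_(p' < r ^ 2) `|kap p - kap p'|)%N).
  apply: bdd_seq_avg; exists (\sum_(p < r ^ 2) H) => x x01.
  by rewrite (le_trans (cmod_sum _ _ _)) // ler_sum // => p _; rewrite cmodM ce_le mulr1 hH.
move=> s sM; apply: (@avg_block h H (fun p => - kap p)) => //.
  move=> p p' pr pr'; apply: leq_ltn_trans (ltn_expl s (isT : 1 < 2)%N).
  rewrite (leq_trans _ sM) // -opprD abszN.
  apply: leq_trans (@leq_bigmax _ (fun p : 'I_(r ^ 2) =>
    \max_(p' < r ^ 2) `|kap p - kap p'|%N)%N (Ordinal pr)).
  exact: (@leq_bigmax _ (fun p' : 'I_(r ^ 2) => `|kap p - kap p'|%N) (Ordinal pr')).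
by move=> p p' _ _ /oppr_inj /kapI.
Qed.

(** After telescoping, the error is a difference of two coefficients of [h], at [m] and at
    [- m - 1]. Each is bounded by following the indices outwards, where the steps decay
    geometrically. *)
Lemma laurent m :
  cmod (f t - \sum_(i < m.*2.+1) ce (t *~ (i%:Z - m%:Z)) * fourier (i%:Z - m%:Z)) <=
    4 * B * q ^+ m / (1 - q).
Proof.
have tele n : \sum_(i < n) (b (i%:Z - m%:Z - 1) - b (i%:Z - m%:Z)) =
    b (- m%:Z - 1) - b (n%:Z - m%:Z - 1).
  elim: n => [|n IH]; first by rewrite big_ord0 sub0r subrr.
  rewrite big_ord_recr /= IH (_ : n.+1%:Z - m%:Z - 1 = n%:Z - m%:Z); last by rewrite intS; ring.
  by ring.
have delta : \sum_(i < m.*2.+1) f t * (i%:Z - m%:Z == 0)%:R = f t.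
  have mm : (m < m.*2.+1)%N by rewrite ltnS -addnn leq_addr.
  rewrite (bigD1 (Ordinal mm)) //= subrr mulr1 big1 ?addr0 // => i im.
  rewrite subr_eq0 eqz_nat; case: eqP => [E|]; last by rewrite mulr0.
  by case/eqP: im; apply/val_inj.
under eq_bigr do rewrite Fb.
rewrite big_split /= tele delta (_ : m.*2.+1%:Z - m%:Z - 1 = m%:Z); last first.
  by rewrite intS -addnn PoszD; ring.
have -> : f t - (b (- m%:Z - 1) - b m%:Z + f t) = b m%:Z - b (- m%:Z - 1) by ring.
have FE k : k != 0 -> b (k - 1) - b k = ce (t *~ k) * fourier k.
  by rewrite Fb => /negPf ->; rewrite mulr0 addr0.
case/andP: (q01) => q0 q1.
have bm : cmod (b m%:Z) <= 2 * B * q ^+ m / (1 - q).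
  have := @b_le (fun p => (m + p)%N%:Z) m; rewrite addn0; apply.
    by move=> p p' [] /addnI.
  move=> p; rewrite (_ : (m + p)%N%:Z = (m + p).+1%:Z - 1); last by rewrite intS; ring.
  rewrite addnS FE // (le_trans (Fk_le _)) // ler_wpM2l ?mulr_ge0 //.
  by rewrite exprS ler_piMl ?exprn_ge0 // ltW.
have bm' : cmod (b (- m%:Z - 1)) <= 2 * B * q ^+ m / (1 - q).
  have := @b_le (fun p => - (m + p)%N%:Z - 1) m; rewrite addn0; apply.
    by move=> p p' /addIr/oppr_inj [] /addnI.
  move=> p; rewrite (_ : - (m + p.+1)%N%:Z - 1 = (- (m + p)%N%:Z - 1) - 1); last first.
    by rewrite addnS intS; ring.
  have kn : - (m + p)%N%:Z - 1 = - (m + p).+1%:Z by rewrite intS; ring.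
  rewrite cmodBC FE; last by rewrite kn oppr_eq0.
  rewrite (le_trans (Fk_le _)) // ler_wpM2l ?mulr_ge0 //.
  by rewrite kn abszN exprS ler_piMl ?exprn_ge0 // ltW.
by rewrite (le_trans (cmodB _ _)) //; lra.
Qed.

End Point.

(* Among the frequencies in [-m, m] only [k] is congruent to [k] modulo
   [2 m + 1]: up to the tail, a finite average computes a coefficient. *)
Lemma avg_fourier t k m : `|Im t| <= e / 2 -> (`|k| <= m)%N ->
  cmod (avg m.*2.+1 (fun x => f (t + x) * ce (x *~ (- k))) - ce (t *~ k) * fourier k)
    <= 4 * B * q ^+ m / (1 - q).
Proof.
move=> te km; pose N := m.*2.+1.
pose T (x : R[i]) := \sum_(i < N) ce ((t + x) *~ (i%:Z - m%:Z)) * fourier (i%:Z - m%:Z).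
have imk (i : 'I_N) : (absz (i%:Z - m%:Z - k)%R < N)%N.
  by have := ltn_ord i; rewrite /N; lia.
have -> : ce (t *~ k) * fourier k = avg N (fun x => T x * ce (x *~ (- k))).
  rewrite (@eq_avg _ _ _ (fun x => \sum_(i < N) (ce (t *~ (i%:Z - m%:Z)) * fourier (i%:Z - m%:Z)) *
     ce (x *~ (i%:Z - m%:Z - k)))); last first.
    move=> x _; rewrite /T mulr_suml; apply: eq_bigr => i _.
    by move: (i%:Z - m%:Z) => j; rewrite mulrzDl mulrzDr !ceD; ring.
  rewrite avg_sum.
  under eq_bigr do rewrite avgZ avg_ce //.
  have kN : (absz (k + m%:Z)%R < N)%N by rewrite /N; lia.
  have kE : (absz (k + m%:Z)%R)%:Z = k + m%:Z by rewrite gez0_abs //; lia.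
  rewrite (bigD1 (Ordinal kN)) //= kE addrK subrr eqxx mulr1 big1 ?addr0 // => i ik.
  rewrite subr_eq0; case: eqP => [E|]; last by rewrite mulr0.
  case/eqP: ik; apply/val_inj => /=; apply/eqP; rewrite -eqz_nat kE -E.
  by rewrite subrK.
rewrite -[X in _ - X]mul1r -mulNr -avgZ -avgD.
apply: avg_le => // x _.
have -> : f (t + x%:C) * ce (x%:C *~ - k) + -1 * (T x%:C * ce (x%:C *~ - k)) =
    (f (t + x%:C) - T x%:C) * ce (x%:C *~ - k) by ring.
by rewrite cmodM ce_le mulr1; apply: laurent; rewrite ImD /= addr0.
Qed.

End Strip.

Lemma avg_fourier_le (e : R) f B k m : 0 < e ->
  (forall z, `|Im z| <= e -> cdiff f z) ->
  (forall z, `|Im z| <= e -> f (z + 1) = f z) ->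
  (forall z, `|Im z| <= e -> cmod (f z) <= B) -> (`|k| <= m)%N ->
  cmod (avg m.*2.+1 (fun x => f x * ce (x *~ (- k)))) <=
    B * (6 / (1 - expR (- (pi * e)))) * expR (- (pi * e)) ^+ `|k|%N.
Proof.
move=> e0 fd fp fb km; set q := expR _.
have q0 : 0 < q by exact: expR_gt0.
have q1 : q < 1 by rewrite /q -expR0 ltr_expR oppr_lt0 mulr_gt0 // pi_gt0.
have B0 : 0 <= B by rewrite (le_trans (cmod_ge0 (f 0))) // fb // normr0 ltW.
have z2 : `|Im (0 : R[i])| <= e / 2 by rewrite normr0 divr_ge0 ?ltW.
have := avg_fourier e0 fd fp fb z2 km; rewrite mul0rz ce0 mul1r -/q.
rewrite (_ : (fun x => f (0 + x) * _) = (fun x => f x * ce (x *~ - k))); last first.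
  by apply/funext => x; rewrite add0r.
set A := avg _ _; set F := fourier _ _ => AF.
have Fl : cmod F <= 2 * B * q ^+ (`|k| * 2)%N by apply: (fourier_le e0).
rewrite -[A](subrK F) (le_trans (cmodD _ _)) //.
(* The constant [6 = 4 + 2] collects the aliasing error and the coefficient itself. *)
apply: (@le_trans _ _ (4 * B * q ^+ `|k|%N / (1 - q) + 2 * B * q ^+ `|k|%N / (1 - q))).
  have qk : q ^+ m <= q ^+ `|k|%N by rewrite ler_wiXn2l // ?ltW.
  rewrite lerD //.
    apply: (le_trans AF); rewrite ler_wpM2r ?invr_ge0 ?subr_ge0 ?(ltW q1) //.
    by rewrite ler_wpM2l // mulr_ge0.
  apply: (le_trans Fl); rewrite -[leRHS]mulrA ler_wpM2l ?mulr_ge0 //.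
  rewrite ler_pdivlMr ?subr_gt0 // -[leRHS]mulr1 ler_pM ?exprn_ge0 ?(ltW q0) ?subr_ge0 ?(ltW q1) //.
    by rewrite ler_wiXn2l ?(ltW q0) ?(ltW q1) // muln2 -addnn leq_addr.
  by rewrite lerBlDr lerDl ltW.
by rewrite le_eqVlt; apply/orP; left; apply/eqP; field; rewrite subr_eq0 gt_eqF.
Qed.

(** The exact coefficient is eliminated between two approximations. Only finite averages remain,
    which is the form usable inside a finite transform in several variables. *)
Lemma avg_translate_le (e : R) f B k m t : 0 < e ->
  (forall z, `|Im z| <= e -> cdiff f z) ->
  (forall z, `|Im z| <= e -> f (z + 1) = f z) ->
  (forall z, `|Im z| <= e -> cmod (f z) <= B) -> (`|k| <= m)%N -> `|Im t| <= e / 2 ->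
  cmod (avg m.*2.+1 (fun x => f (t + x) * ce (x *~ (- k))) -
        ce (t *~ k) * avg m.*2.+1 (fun x => f x * ce (x *~ (- k)))) <=
    (1 + cmod (ce (t *~ k))) * (4 * B * expR (- (pi * e)) ^+ m / (1 - expR (- (pi * e)))).
Proof.
move=> e0 fd fp fb km te.
have z2 : `|Im (0 : R[i])| <= e / 2 by rewrite normr0 divr_ge0 ?ltW.
have := avg_fourier e0 fd fp fb z2 km; have := avg_fourier e0 fd fp fb te km.
set E := 4 * _ * _ / _; rewrite mul0rz ce0 mul1r.
rewrite (_ : (fun x => f (0 + x) * _) = (fun x => f x * ce (x *~ - k))); last first.
  by apply/funext => x; rewrite add0r.
set A := avg _ _; set A' := avg _ _; set F := fourier _ _ => H1 H2.
have -> : A - ce (t *~ k) * A' = (A - ce (t *~ k) * F) - ce (t *~ k) * (A' - F) by ring.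
apply: (le_trans (cmodB _ _)); rewrite mulrDl mul1r lerD // cmodM.
by rewrite ler_wpM2l ?cmod_ge0.
Qed.

End LaurentSeries.

(** * Unconditional sums of complex families *)

Section UnconditionalSums.
Variable R : realType.
Local Open Scope complex_scope.

Definition hsum (I : choiceType) (F : I -> R[i]) (s : R[i]) :=
  forall e : R, 0 < e -> exists A : {fset I}, forall B : {fset I},
    (A `<=` B)%fset -> cmod (\sum_(i <- B) F i - s) < e.

Definition abs_bdd (I : choiceType) (F : I -> R[i]) (T : R) :=
  forall A : {fset I}, \sum_(i <- A) cmod (F i) <= T.

Lemma fsum_mono (I : choiceType) (G : I -> R) (A B : {fset I}) :
  (forall i, 0 <= G i) -> (A `<=` B)%fset ->
  \sum_(i <- A) G i <= \sum_(i <- B) G i.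
Proof.
move=> G0 AB; rewrite (big_fsetID _ (mem A) B) /=.
have -> : [fset x in B | (mem A) x]%fset = A.
  apply/fsetP => x; rewrite !inE /=; case xA: (x \in A); rewrite ?andbF // andbT.
  by apply: (fsubsetP AB).
by rewrite lerDl sumr_ge0.
Qed.

Lemma big_fsetM (V : nmodType) (I J : choiceType) (A : {fset I}) (B : {fset J}) (G : I * J -> V) :
  \sum_(p <- (A `*` B)%fset) G p = \sum_(i <- A) \sum_(j <- B) G (i, j).
Proof.
rewrite -big_allpairs; apply: perm_big; apply: uniq_perm.
- exact: fset_uniq.
- by apply: allpairs_uniq; rewrite ?fset_uniq // => -[a b] [c d].
move=> [i j]; rewrite in_fsetM /=; apply/andP/allpairsP => /=.
  by move=> [iA jB]; exists (i, j).
by move=> [[i' j'] /= [iA jB [-> ->]]].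
Qed.

Lemma has_sum_ge0 (I : choiceType) (G : I -> R) (T : R) : (forall i, 0 <= G i) ->
  (forall A : {fset I}, \sum_(i <- A) G i <= T) -> exists s, has_sum G s.
Proof.
move=> G0 GT; pose E := range (fun A : {fset I} => \sum_(i <- A) G i).
have hs : has_sup E by split; [exists (\sum_(i <- fset0) G i), fset0|exists T => _ [A _ <-]].
exists (sup E) => e e0; have [_ [A _ <-] hA] := sup_adherent e0 hs.
exists A => B AB; rewrite distrC ger0_norm; last first.
  by rewrite subr_ge0; apply: sup_upper_bound => //; exists B.
by rewrite ltrBlDr addrC -ltrBlDr (lt_le_trans hA) // fsum_mono.
Qed.

(** [G] is the difference of the nonnegative families [|G| + G] and [|G|]. *)
Lemma has_sum_abs (I : choiceType) (G : I -> R) (T : R) :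
  (forall A : {fset I}, \sum_(i <- A) `|G i| <= T) -> exists s, has_sum G s.
Proof.
move=> GT.
have [s1 h1] : exists s, has_sum (fun i => `|G i|) s by apply: has_sum_ge0 GT.
have [s2 h2] : exists s, has_sum (fun i => `|G i| + G i) s.
  apply: (@has_sum_ge0 _ _ (2 * T)) => [i|A].
    by have := ler_norm (- G i); rewrite normrN; lra.
  rewrite big_split /= mulrDl mul1r lerD // (le_trans _ (GT A)) //.
  by rewrite ler_sum // => i _; exact: ler_norm.
exists (s2 - s1) => e e0; have e2 : 0 < e / 2 by rewrite divr_gt0.
have [A1 H1] := h1 _ e2; have [A2 H2] := h2 _ e2.
exists (A1 `|` A2)%fset => B AB.
have {}H1 := H1 B (fsubset_trans (fsubsetUl _ _) AB).
have {}H2 := H2 B (fsubset_trans (fsubsetUr _ _) AB).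
rewrite big_split /= in H2.
set x := \sum_(i <- B) G i in H2 *; set y := \sum_(i <- B) `|G i| in H1 H2.
have -> : x - (s2 - s1) = (y + x - s2) - (y - s1) by ring.
by rewrite (le_lt_trans (ler_normB _ _)) //; lra.
Qed.

Section Basic.
Variable I : choiceType.
Implicit Types (F G : I -> R[i]).

Lemma abs_bdd_hsum F T : abs_bdd F T -> exists s, hsum F s.
Proof.
move=> FT.
have [s1 h1] : exists s, has_sum (fun i => Re (F i)) s.
  apply: (@has_sum_abs _ _ T) => A; rewrite (le_trans _ (FT A)) //.
  by rewrite ler_sum // => i _; exact: Re_le_cmod.
have [s2 h2] : exists s, has_sum (fun i => Im (F i)) s.
  apply: (@has_sum_abs _ _ T) => A; rewrite (le_trans _ (FT A)) //.
  by rewrite ler_sum // => i _; exact: Im_le_cmod.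
exists (s1 +i* s2) => e e0; have e2 : 0 < e / 2 by rewrite divr_gt0.
have [A1 H1] := h1 _ e2; have [A2 H2] := h2 _ e2.
exists (A1 `|` A2)%fset => B AB.
have {}H1 := H1 B (fsubset_trans (fsubsetUl _ _) AB).
have {}H2 := H2 B (fsubset_trans (fsubsetUr _ _) AB).
rewrite (le_lt_trans (cmod_le_ReIm _)) // ReD ImD Re_sum Im_sum ReN ImN /=.
lra.
Qed.

Lemma hsum_uniq F s s' : hsum F s -> hsum F s' -> s = s'.
Proof.
move=> h h'; apply/eqP; rewrite -subr_eq0; apply/eqP/cmod_eq0/eqP.
rewrite eq_le cmod_ge0 andbT; apply/ler_addgt0Pr => e e0.
have e2 : 0 < e / 2 by rewrite divr_gt0.
have [A1 H1] := h _ e2; have [A2 H2] := h' _ e2.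
have {}H1 := H1 _ (fsubsetUl A1 A2); have {}H2 := H2 _ (fsubsetUr A1 A2).
set x := \sum_(i <- _) _ in H1 H2.
have -> : s - s' = (x - s') - (x - s) by ring.
by rewrite add0r (le_trans (cmodB _ _)) //; lra.
Qed.

Lemma hsumZ c F s : hsum F s -> hsum (fun i => c * F i) (c * s).
Proof.
move=> h e e0; have [->|c0] := eqVneq c 0.
  exists fset0 => B _; rewrite big1 => [|i _]; last by rewrite mul0r.
  by rewrite mul0r subrr cmod0.
have cp := cmod_gt0 c0; have ec : 0 < e / cmod c by rewrite divr_gt0.
have [A HA] := h _ ec; exists A => B /HA.
by rewrite -mulr_sumr -mulrBr cmodM ltr_pdivlMr // mulrC.
Qed.

Lemma eq_hsum F G s : F =1 G -> hsum F s -> hsum G s.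
Proof. by move=> /funext ->. Qed.

Lemma hsum_Re F s : hsum F s -> has_sum (fun i => Re (F i)) (Re s).
Proof.
move=> h e /h[A HA]; exists A => B /HA; apply: le_lt_trans.
by rewrite -Re_sum -ReN -ReD Re_le_cmod.
Qed.

Lemma hsum_Im F s : hsum F s -> has_sum (fun i => Im (F i)) (Im s).
Proof.
move=> h e /h[A HA]; exists A => B /HA; apply: le_lt_trans.
by rewrite -Im_sum -ImN -ImD Im_le_cmod.
Qed.

Lemma abs_bdd_sub F G T : (forall i, cmod (F i) <= cmod (G i)) -> abs_bdd G T -> abs_bdd F T.
Proof. by move=> FG GT A; rewrite (le_trans _ (GT A)) // ler_sum. Qed.

End Basic.

Lemma hsum_reindex (I J : choiceType) (f : I -> J) (g : J -> I) (F : J -> R[i]) s :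
  cancel f g -> cancel g f -> hsum F s -> hsum (F \o f) s.
Proof.
move=> fK gK h e /h[A HA]; exists [fset g x | x in A]%fset => B AB.
have := HA [fset f x | x in B]%fset; rewrite big_imfset /=; last first.
  by move=> x y _ _; exact: (can_inj fK).
apply; apply/fsubsetP => x xA; apply/imfsetP; exists (g x); rewrite ?gK //.
by apply: (fsubsetP AB); apply/imfsetP; exists x.
Qed.

(** Fubini: a finite set of pairs is enlarged to a rectangle [B * C] with [C] large enough for all
    rows over [B] at once. *)
Lemma hsum_pair (I J : choiceType) (F : I * J -> R[i]) (s : I -> R[i]) S :
  hsum F S -> (forall i, hsum (fun j => F (i, j)) (s i)) -> hsum s S.
Proof.
move=> hF hs e e0; have e2 : 0 < e / 2 by rewrite divr_gt0.
have [A HA] := hF _ e2; exists [fset p.1 | p in A]%fset => B AB.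
(* The row errors add up to at most [e / 2]; the successor keeps the denominator nonzero when [B] is
   empty. *)
pose e3 : R := e / 2 / (#|` B|.+1)%:R.
have e30 : 0 < e3 by rewrite divr_gt0 // ltr0n.
have /choice[D HD] : forall i, exists D : {fset J}, forall D', (D `<=` D')%fset ->
    cmod (\sum_(j <- D') F (i, j) - s i) < e3 by move=> i; exact: hs.
pose C := ([fset p.2 | p in A] `|` \bigcup_(i <- B) D i)%fset.
have HC : (A `<=` B `*` C)%fset.
  apply/fsubsetP => p pA; rewrite in_fsetM; apply/andP; split.
    by apply: (fsubsetP AB); apply/imfsetP; exists p.
  by rewrite inE; apply/orP; left; apply/imfsetP; exists p.
have := HA _ HC; rewrite big_fsetM => H1.
rewrite -(subrK (\sum_(i <- B) \sum_(j <- C) F (i, j)) (\sum_(i <- B) s i)) -addrA.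
rewrite (le_lt_trans (cmodD _ _)) // [X in _ < X](splitr e) ler_ltD //.
rewrite -sumrB (le_trans (cmod_sum _ _ _)) //.
apply: (@le_trans _ _ (\sum_(i <- B) e3)).
  rewrite big_seq [leRHS]big_seq ler_sum // => i iB; rewrite cmodBC ltW // HD //.
  by rewrite (fsubset_trans _ (fsubsetUr _ _)) // bigfcup_sup.
rewrite big_const_seq count_predT iter_addr addr0 -(mulr_natr e3) /e3.
by rewrite mulrAC ler_pdivrMr ?ltr0n // ler_wpM2l ?(ltW e2) // ler_nat.
Qed.

Lemma hsum_pair2 (I J : choiceType) (F : I * J -> R[i]) (s : J -> R[i]) S :
  hsum F S -> (forall j, hsum (fun i => F (i, j)) (s j)) -> hsum s S.
Proof.
move=> hF hs; apply: (@hsum_pair _ _ (fun p => F (p.2, p.1))) hs.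
by apply: (@hsum_reindex _ _ (fun p : J * I => (p.2, p.1)) (fun p => (p.2, p.1))) hF; case.
Qed.

Lemma abs_bdd_pair (I J : choiceType) (F : I * J -> R[i]) (T : I -> R) T0 :
  (forall i, abs_bdd (fun j => F (i, j)) (T i)) ->
  (forall A : {fset I}, \sum_(i <- A) T i <= T0) -> abs_bdd F T0.
Proof.
move=> FT TT A.
apply: (@le_trans _ _ (\sum_(p <- ([fset p.1 | p in A] `*` [fset p.2 | p in A])%fset) cmod (F p))).
  apply: (@fsum_mono _ (fun p => cmod (F p))) => [p|]; first exact: cmod_ge0.
  apply/fsubsetP => p pA; rewrite in_fsetM; apply/andP; split; apply/imfsetP; by exists p.
rewrite (@big_fsetM R _ _ _ _ (fun p => cmod (F p))).
by apply: le_trans (TT [fset p.1 | p in A]%fset); rewrite ler_sum // => i _; exact: FT.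
Qed.

Section Products.
Variables (n : nat) (J : choiceType) (F : 'I_n -> J -> R[i]) (s : 'I_n -> R[i]) (T : 'I_n -> R).
Hypothesis F_abs : forall i, abs_bdd (F i) (T i).

(** These cubes are cofinal among the finite sets of functions, and on them a sum of products
    factors. *)
Definition ffbox (D : {fset J}) : {fset {ffun 'I_n -> J}} :=
  [fset ([ffun i => fsval (phi i)] : {ffun 'I_n -> J}) | phi : {ffun 'I_n -> D} in {: {ffun 'I_n -> D}}]%fset.

Lemma big_ffbox (V : comNzRingType) D (G : 'I_n -> J -> V) :
  \sum_(m <- ffbox D) \prod_i G i (m i) = \prod_i \sum_(j <- D) G i j.
Proof.
rewrite /ffbox big_imfset /=; last first.
  move=> phi psi _ _ /ffunP h; apply/ffunP => i; apply: val_inj.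
  by have := h i; rewrite !ffunE.
under eq_bigr do under eq_bigr do rewrite ffunE.
under [RHS]eq_bigr do rewrite big_seq_fsetE /=.
rewrite [RHS](@bigA_distr_bigA _ _ _ _ _ _ _ (fun i (j : D) => G i (fsval j))) /=.
by rewrite -[RHS]big_enum.
Qed.

Lemma sub_ffbox (A : {fset {ffun 'I_n -> J}}) : exists D0, forall D,
  (D0 `<=` D)%fset -> (A `<=` ffbox D)%fset.
Proof.
exists (\bigcup_(m <- A) [fset m i | i in 'I_n])%fset => D HD; apply/fsubsetP => m mA.
have md i : m i \in D.
  apply: (fsubsetP HD); apply/bigfcupP; exists m; rewrite ?mA //.
  by apply/imfsetP; exists i.
apply/imfsetP; exists [ffun i => [` md i]%fset] => //.
by apply/ffunP => i; rewrite !ffunE.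
Qed.

Lemma abs_bdd_prod : abs_bdd (fun m : {ffun 'I_n -> J} => \prod_i F i (m i)) (\prod_i T i).
Proof.
move=> A; have [D HD] := sub_ffbox A; have {}HD := HD D (fsubset_refl _).
apply: (@le_trans _ _ (\sum_(m <- ffbox D) cmod (\prod_i F i (m i)))).
  by apply: fsum_mono => // m; exact: cmod_ge0.
rewrite (eq_bigr (fun m : {ffun 'I_n -> J} => \prod_i cmod (F i (m i)))); last first.
  by move=> m _; rewrite cmod_prod.
rewrite (@big_ffbox R D (fun i j => cmod (F i j))); apply: ler_prod => i _.
by rewrite F_abs andbT sumr_ge0 // => j _; exact: cmod_ge0.
Qed.

Lemma prod_approx (r : seq 'I_n) (e : R) : (forall i, hsum (F i) (s i)) -> 0 < e ->
  exists D0, forall D, (D0 `<=` D)%fset ->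
  cmod (\prod_(i <- r) \sum_(j <- D) F i j - \prod_(i <- r) s i) < e.
Proof.
move=> hs; elim: r e => [|i r IH] e e0.
  by exists fset0 => D _; rewrite !big_nil subrr cmod0.
have T0 : 0 <= T i by have := F_abs i fset0; rewrite big_seq_fset0.
pose P := \prod_(i <- r) s i; pose K := T i + cmod P + 1.
have K0 : 0 < K by rewrite ltr_wpDl // addr_ge0 ?cmod_ge0.
have e1 : 0 < e / K by rewrite divr_gt0.
have [D1 H1] := IH _ e1; have [D2 H2] := hs i _ e1.
exists (D1 `|` D2)%fset => D HD.
have {}H1 := H1 D (fsubset_trans (fsubsetUl _ _) HD).
have {}H2 := H2 D (fsubset_trans (fsubsetUr _ _) HD).
rewrite !big_cons -/P; rewrite -/P in H1.
set a := \sum_(j <- D) F i j in H2 *; set b := \prod_(j <- r) _ in H1 *.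
have -> : a * b - s i * P = a * (b - P) + (a - s i) * P by ring.
rewrite (le_lt_trans (cmodD _ _)) // !cmodM.
have aT : cmod a <= T i by rewrite (le_trans (cmod_sum _ _ _)) //; exact: F_abs.
apply: (@le_lt_trans _ _ (e / K * (T i + cmod P))).
  rewrite mulrDr lerD //.
    by rewrite mulrC ler_pM ?cmod_ge0 // ltW.
  by rewrite ler_wpM2r ?cmod_ge0 // ltW.
by rewrite mulrAC ltr_pdivrMr // ltr_pM2l // /K ltrDl ltr01.
Qed.

(** The absolute bound provides some sum [S]; testing on the cubes [ffbox] identifies it with the
    product. *)
Lemma hsum_prod : (forall i, hsum (F i) (s i)) ->
  hsum (fun m : {ffun 'I_n -> J} => \prod_i F i (m i)) (\prod_i s i).
Proof.
move=> hs; have [S hS] := abs_bdd_hsum abs_bdd_prod.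
suff -> : \prod_i s i = S by [].
apply/eqP; rewrite -subr_eq0; apply/eqP/cmod_eq0/eqP.
rewrite eq_le cmod_ge0 andbT; apply/ler_addgt0Pr => e e0; rewrite add0r.
have e2 : 0 < e / 2 by rewrite divr_gt0.
have [A HA] := hS _ e2; have [D1 H1] := prod_approx (index_enum 'I_n) hs e2.
have [D2 H2] := sub_ffbox A.
have {}H1 := H1 _ (fsubsetUl D1 D2); have {}H2 := HA _ (H2 _ (fsubsetUr D1 D2)).
rewrite big_ffbox in H2.
set x := \prod_i \sum_(j <- _) _ in H1 H2.
have -> : \prod_i s i - S = (x - S) - (x - \prod_i s i) by ring.
by rewrite (le_trans (cmodB _ _)) //; lra.
Qed.

End Products.

End UnconditionalSums.

(** * Geometric sums and rules for derivatives *)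

Section Estimates.
Variable R : realType.
Local Open Scope complex_scope.

Lemma geom_eventually (q C e : R) : 0 <= q < 1 -> 0 <= C -> 0 < e ->
  exists m0, forall m, (m0 <= m)%N -> C * q ^+ m <= e.
Proof.
move=> /andP[q0 q1] C0 e0.
have : (fun m => C * q ^+ m) @ \oo --> (C * 0 : R).
  by apply: cvgMr; apply: cvg_expr; rewrite ger0_norm.
rewrite mulr0 => /cvgrPdist_le/(_ e e0)[m0 _ H]; exists m0 => m /H.
by rewrite sub0r normrN; apply: le_trans (ler_norm _).
Qed.

Lemma geom_uniq_sum (q : R) (s : seq nat) : 0 <= q < 1 -> uniq s ->
  \sum_(i <- s) q ^+ i <= (1 - q)^-1.
Proof.
move=> /andP[q0 q1] us; have q1' : 0 < 1 - q by rewrite subr_gt0.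
pose M := (\max_(i <- s) i).+1.
have sM i : i \in s -> (i < M)%N.
  by move=> i_s; rewrite ltnS (big_rem i) //= leq_maxl.
have ps : perm_eq s [seq i <- iota 0 M | i \in s].
  apply: uniq_perm; rewrite ?filter_uniq ?iota_uniq // => i.
  by rewrite mem_filter mem_iota /=; case E: (i \in s); rewrite // sM.
rewrite (perm_big _ ps) big_filter.
apply: (@le_trans _ _ (\sum_(i <- iota 0 M) q ^+ i)).
  by rewrite big_mkcond ler_sum //= => i _; case: ifP => // _; rewrite exprn_ge0.
have -> : \sum_(i <- iota 0 M) q ^+ i = \sum_(i < M) q ^+ i.
  by rewrite -(big_mkord xpredT (fun i => q ^+ i)) /index_iota subn0.
rewrite -[leRHS]mul1r ler_pdivlMr //.
have := subrX1 q M; rewrite -opprB -[q - 1]opprB mulNr => /oppr_inj E.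
by rewrite mulrC -E lerBlDr lerDl exprn_ge0.
Qed.

Lemma geom_int_sum (q : R) (A : {fset int}) : 0 <= q < 1 ->
  \sum_(k <- A) q ^+ `|k|%N <= 2 / (1 - q).
Proof.
move=> q01; rewrite (bigID (fun k : int => 0 <= k)) /=.
have half (P : pred int) : {in P &, injective absz} ->
    \sum_(k <- A | P k) q ^+ `|k|%N <= (1 - q)^-1.
  move=> Pi; rewrite -big_filter -(big_map absz xpredT (fun i => q ^+ i)).
  apply: geom_uniq_sum => //; rewrite map_inj_in_uniq ?filter_uniq ?fset_uniq //.
  by move=> x y; rewrite !mem_filter => /andP[Px _] /andP[Py _]; exact: Pi.
rewrite mulrDl !mul1r lerD // half // => x y; rewrite -!topredE /= => x0 y0 xy; lia.
Qed.

Lemma has_cderiv_cst (c z : R[i]) : has_cderiv (fun=> c) z 0.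
Proof.
move=> e e0; exists 1 => // h _; rewrite subrr sub0r mul0r oppr0 cmod0.
by rewrite mulr_ge0 ?cmod_ge0 // ltW.
Qed.

Lemma cdiffZ c (f : R[i] -> R[i]) z : cdiff f z -> cdiff (fun t => c * f t) z.
Proof. by move=> [a fa]; eexists; apply: has_cderivM (has_cderiv_cst c z) fa. Qed.

Lemma cdiffD (f g : R[i] -> R[i]) z : cdiff f z -> cdiff g z -> cdiff (fun t => f t + g t) z.
Proof.
move=> [a fa] [b gb]; exists (a + b) => e e0; have e2 : 0 < e / 2 by rewrite divr_gt0.
have [d1 d10 H1] := fa _ e2; have [d2 d20 H2] := gb _ e2.
exists (Num.min d1 d2); rewrite ?lt_min ?d10 // => h; rewrite lt_min => /andP[/H1 h1 /H2 h2].
have -> : f (z + h) + g (z + h) - (f z + g z) - (a + b) * h =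
  (f (z + h) - f z - a * h) + (g (z + h) - g z - b * h) by ring.
by rewrite (le_trans (cmodD _ _)) // (splitr e) mulrDl lerD.
Qed.

Lemma cdiff_sum (I : Type) (r : seq I) (F : I -> R[i] -> R[i]) z :
  (forall i, cdiff (F i) z) -> cdiff (fun t => \sum_(i <- r) F i t) z.
Proof.
move=> dF; elim: r => [|i r IH].
  exists 0 => e e0; have [d d0 H] := @has_cderiv_cst 0 z e e0.
  by exists d => // h /H; rewrite !big_nil.
have [a Ha] := cdiffD (dF i) IH; exists a => e e0; have [d d0 H] := Ha e e0.
by exists d => // h /H; rewrite !big_cons.
Qed.

End Estimates.

(** * Fourier series in several variables through a finite transform *)

Section MultipleFourier.
Variables (R : realType) (n : nat).
Local Open Scope complex_scope.
Implicit Types (z w : 'rV[R[i]]_n) (k : {ffun 'I_n -> int}) (y : 'I_n -> R) (m : nat) (j : 'I_n).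
Local Notation unitv j := (delta_mx 0 j : 'rV[R[i]]_n).

Definition dotz k z : R[i] := \sum_j z 0 j *~ k j.

Lemma dotzD k z w : dotz k (z + w) = dotz k z + dotz k w.
Proof. by rewrite /dotz -big_split; apply: eq_bigr => j _; rewrite mxE mulrzDl. Qed.

Lemma dotz_unit k j t : dotz k (t *: unitv j) = t *~ k j.
Proof.
rewrite /dotz (bigD1 j) //= big1 => [|i ij]; first by rewrite !mxE !eqxx mulr1 addr0.
by rewrite !mxE (negPf ij) andbF mulr0 mul0rz.
Qed.

Definition strip y (e : R) z := forall j, `|Im (z 0 j) - y j| <= e.

Definition gridv m (phi : {ffun 'I_n -> 'I_m.*2.+1}) : 'rV[R[i]]_n :=
  \row_j ((phi j)%:R / m.*2.+1%:R).

(** The discrete Fourier coefficient on the grid translated to [z]. With [2 m + 1] points per axis,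
    the frequencies from [- m] to [m] represent every residue exactly once. *)
Definition dft (F : 'rV[R[i]]_n -> R[i]) k m z : R[i] :=
  (m.*2.+1%:R ^+ n)^-1 *
  \sum_(phi : {ffun 'I_n -> 'I_m.*2.+1}) F (z + gridv phi) * ce (- dotz k (gridv phi)).

Let Nn0 m : m.*2.+1%:R != 0 :> R[i].
Proof. by rewrite pnatr_eq0. Qed.

Let gridI m (phi : {ffun 'I_n -> 'I_m.*2.+1}) j : Im (gridv phi 0 j) = 0.
Proof. by rewrite mxE -!(RC_nat R) -fmorph_div. Qed.

Lemma strip_real y e z w : (forall j, Im (w 0 j) = 0) -> strip y e z -> strip y e (z + w).
Proof. by move=> w0 h j; rewrite mxE ImD w0 addr0. Qed.

Lemma dft_le F k m z (B : R) : (forall phi : {ffun 'I_n -> 'I_m.*2.+1}, cmod (F (z + gridv phi)) <= B) ->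
  cmod (dft F k m z) <= B.
Proof.
move=> FB; rewrite /dft cmodM cmodV cmodX cmod_nat mulrC ler_pdivrMr ?exprn_gt0 ?ltr0n //.
rewrite (le_trans (cmod_sum _ _ _)) //.
apply: (@le_trans _ _ (\sum_(phi : {ffun 'I_n -> 'I_m.*2.+1}) B)).
  apply: ler_sum => phi _; rewrite cmodM cmod_ce ImN /dotz Im_sum big1 => [|j _].
    by rewrite oppr0 mulr0 oppr0 expR0 mulr1.
  by rewrite ImMz gridI mulr0.
by rewrite sumr_const card_ffun !card_ord -(mulr_natr B) natrX.
Qed.

Section Center.
Variables (F : 'rV[R[i]]_n -> R[i]) (y : 'I_n -> R) (e B : R).
Hypothesis e0 : 0 < e.
Hypothesis F_diff : forall z, strip y e z -> forall j, cdiff (fun t => F (z + t *: unitv j)) 0.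
Hypothesis F_per : forall z, strip y e z -> forall j, F (z + unitv j) = F z.
Hypothesis F_bnd : forall z, strip y e z -> cmod (F z) <= B.

Let q : R := expR (- (pi * e)).

Let q01 : 0 < q < 1.
Proof. by rewrite expR_gt0 -expR0 ltr_expR oppr_lt0 mulr_gt0 // pi_gt0. Qed.

Let B0 : 0 <= B.
Proof.
have s0 : strip y e (\row_j ('i * (y j)%:C)).
  by move=> j; rewrite mxE /= !(mul0r, mul1r, mulr0, add0r, addr0) subrr normr0 ltW.
exact: le_trans (cmod_ge0 _) (F_bnd s0).
Qed.

(** A translation by one grid step permutes the grid cyclically, up to a period of [F]. *)
Lemma dft_step k m z j : strip y e z ->
  dft F k m (z + m.*2.+1%:R^-1 *: unitv j) = ce (m.*2.+1%:R^-1 *~ k j) * dft F k m z.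
Proof.
move=> sz; set N := m.*2.+1; pose v := N%:R^-1 *: unitv j.
pose s (phi : {ffun 'I_n -> 'I_N}) : {ffun 'I_n -> 'I_N} :=
  [ffun i => if i == j then ordS (phi i) else phi i].
pose s' (phi : {ffun 'I_n -> 'I_N}) : {ffun 'I_n -> 'I_N} :=
  [ffun i => if i == j then ord_pred (phi i) else phi i].
have sb : bijective s.
  by exists s' => phi; apply/ffunP => i; rewrite !ffunE; case: eqP => // _; rewrite ?ordSK ?ord_predK.
have v0 i : Im (v 0 i) = 0 by rewrite /v !mxE -!(RC_nat R) -RC_inv -rmorphM.
(* [c] records the wrap-around: it is 1 at the last grid point of the axis and 0 elsewhere. *)
have sE phi : exists2 c : int, gridv (s phi) + c%:~R *: unitv j = v + gridv phi & c = 0 \/ c = 1.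
  have [pN|pN] := eqVneq (phi j).+1 N.
    exists 1; last by right.
    apply/rowP => i; rewrite !mxE !ffunE eqxx /=; case: eqP => [->|_]; last first.
      by rewrite !mulr0 addr0 add0r.
    have -> : nat_of_ord (ordS (phi j)) = 0%N by rewrite /= pN modnn.
    rewrite mul0r add0r !mulr1 -[X in _ = X + _]mul1r -mulrDl [1 + _]addrC natr1.
    by rewrite pN divff // Nn0.
  exists 0; last by left.
  apply/rowP => i; rewrite !mxE !ffunE eqxx /= mul0r addr0; case: eqP => [->|_]; last first.
    by rewrite !mulr0 add0r.
  have -> : nat_of_ord (ordS (phi j)) = (phi j).+1.
    by rewrite /= modn_small // ltn_neqAle pN ltn_ord.
  by rewrite mulr1 -natr1 mulrDl mul1r addrC.
rewrite /dft [in RHS](reindex s) /=; last exact: onW_bij.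
rewrite mulrCA; congr (_ * _); rewrite mulr_sumr; apply: eq_bigr => phi _.
have [c cE c01] := sE phi.
have sg : strip y e (z + gridv (s phi)) by apply: strip_real => // i; exact: gridI.
have FE : F (z + v + gridv phi) = F (z + gridv (s phi)).
  rewrite -addrA -cE addrA; case: c01 => ->; first by rewrite scale0r addr0.
  by rewrite scale1r F_per.
have := congr1 (dotz k) cE; rewrite !dotzD !dotz_unit => dE.
rewrite -/v FE [RHS]mulrCA; congr (_ * _).
have -> : dotz k (gridv phi) = dotz k (gridv (s phi)) + c%:~R *~ k j - N%:R^-1 *~ k j.
  by rewrite dE; ring.
have -> : - (dotz k (gridv (s phi)) + c%:~R *~ k j - N%:R^-1 *~ k j) =
  N%:R^-1 *~ k j + - dotz k (gridv (s phi)) + (- (c * k j))%:~R.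
  by rewrite mulrNz mulrzA; ring.
by rewrite ceDint ceD.
Qed.

Lemma dft_steps k m z j (p : nat) : strip y e z ->
  dft F k m (z + (p%:R / m.*2.+1%:R) *: unitv j) =
  ce ((p%:R / m.*2.+1%:R) *~ k j) * dft F k m z.
Proof.
move=> sz; elim: p => [|p IH].
  by rewrite mul0r scale0r addr0 mul0rz ce0 mul1r.
rewrite -natr1 !mulrDl !mul1r scalerDl mulrzDl ceD addrA dft_step; last first.
  apply: strip_real => // i; rewrite !mxE -!(RC_nat R) -fmorph_div -rmorphM.
  by [].
by rewrite IH; ring.
Qed.

Let cdiff_dft k m z j t0 : strip y e (z + t0 *: unitv j) ->
  cdiff (fun t => dft F k m (z + t *: unitv j)) t0.
Proof.
move=> sz; apply: cdiffZ; apply: cdiff_sum => phi.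
have [|a fa] := @cdiffZ R (ce (- dotz k (gridv phi))) _ _
   (@F_diff (z + t0 *: unitv j + gridv phi) _ j).
  by apply: strip_real => // i; exact: gridI.
exists a => d d0; have [d' d'0 H] := fa d d0; exists d' => // h /H.
rewrite add0r scale0r addr0 [X in cmod (X - _ - _)]mulrC [X in cmod (_ - X - _)]mulrC.
rewrite scalerDl; congr (cmod (F _ * _ - F _ * _ - _) <= _).
  by rewrite addrAC addrA.
Qed.

Let per_dft k m z j : strip y e z -> dft F k m (z + unitv j) = dft F k m z.
Proof.
move=> sz; congr (_ * _); apply: eq_bigr => phi _.
by rewrite addrAC F_per //; apply: strip_real => // i; exact: gridI.
Qed.

Let stripU z j t : strip y e z -> Im (z 0 j) = y j -> `|Im t| <= e ->
  strip y e (z + t *: unitv j).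
Proof.
move=> sz zj te i; rewrite !mxE /=; have [->|ij] := eqVneq i j.
  by rewrite mulr1 ImD zj addrC addKr.
by rewrite mulr0 addr0.
Qed.

(** Under grid translations the transform behaves like its own character, so averaging against the
    inverse character reproduces it. It is thus itself a one-variable average, to which the
    estimates on the strip apply. *)
Let avg_dft k m z j t : strip y e (z + t *: unitv j) ->
  avg m.*2.+1 (fun x => dft F k m (z + (t + x) *: unitv j) * ce (x *~ (- k j))) =
  dft F k m (z + t *: unitv j).
Proof.
move=> sz; rewrite /avg (eq_bigr (fun=> dft F k m (z + t *: unitv j))) => [|p _].
  rewrite sumr_const card_ord -(mulr_natl (dft _ _ _ _)) mulrA mulVf ?mul1r //.
rewrite scalerDl addrA dft_steps // mulrNz ceN mulrAC mulfV ?mul1r //.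
exact: ce_neq0.
Qed.

(** One coordinate at a time: the bound obtained for the coordinates in [r] serves as the sup bound
    for the function of the next one. *)
Lemma dft_decay k m (r : seq 'I_n) z : (forall j, `|k j| <= m)%N -> uniq r ->
  strip y e z -> (forall j, j \in r -> Im (z 0 j) = y j) ->
  cmod (dft F k m z) <= B * \prod_(j <- r) (6 / (1 - q) * q ^+ `|k j|%N).
Proof.
move=> km; elim: r z => [|j r IH] z ur sz zr.
  by rewrite big_nil mulr1 dft_le // => phi; apply: F_bnd; apply: strip_real => // i; exact: gridI.
have /andP[jr ur'] : (j \notin r) && uniq r by [].
have zj : Im (z 0 j) = y j by rewrite zr // mem_head.
have sU t : `|Im t| <= e -> strip y e (z + t *: unitv j) by exact: stripU.
pose H t := dft F k m (z + t *: unitv j).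
have := @avg_fourier_le R e H (B * \prod_(j <- r) (6 / (1 - q) * q ^+ `|k j|%N)) (k j) m e0.
have -> : avg m.*2.+1 (fun x => H x * ce (x *~ - k j)) = dft F k m z.
  have := @avg_dft k m z j 0; rewrite scale0r addr0 => /(_ sz) <-.
  by congr avg; apply/funext => x; rewrite add0r.
rewrite big_cons -/q => h; rewrite (le_trans (h _ _ _ (km j))) {h} //.
- by move=> t te; apply: cdiff_dft; exact: sU.
- by move=> t te; rewrite /H scalerDl scale1r addrA per_dft //; exact: sU.
- move=> t te; apply: IH => //; first exact: sU.
  move=> i ir; rewrite !mxE (_ : (i == j) = false) ?andbF ?mulr0 ?addr0.
    by rewrite zr // in_cons ir orbT.
  by apply: contraNF jr => /eqP <-.
- by rewrite le_eqVlt; apply/orP; left; apply/eqP; ring.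
Qed.

Lemma dft_translate k m z j t : (forall j, `|k j| <= m)%N -> strip y e z ->
  Im (z 0 j) = y j -> `|Im t| <= e / 2 ->
  cmod (dft F k m (z + t *: unitv j) - ce (t *~ k j) * dft F k m z) <=
    (1 + cmod (ce (t *~ k j))) * (4 * B / (1 - q)) * q ^+ m.
Proof.
move=> km sz zj te; have te1 : `|Im t| <= e by rewrite (le_trans te) // ler_pdivrMr // ler_pMr // ler1n.
have sU u : `|Im u| <= e -> strip y e (z + u *: unitv j) by exact: stripU.
pose H t := dft F k m (z + t *: unitv j).
have := @avg_translate_le R e H B (k j) m t e0.
have -> : avg m.*2.+1 (fun x => H x * ce (x *~ - k j)) = dft F k m z.
  have := @avg_dft k m z j 0; rewrite scale0r addr0 => /(_ sz) <-.
  by congr avg; apply/funext => x; rewrite add0r.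
rewrite (@avg_dft k m z j t (sU t te1)) -/q => h; rewrite (le_trans (h _ _ _ (km j) te)) {h} //.
- by move=> u ue; apply: cdiff_dft; exact: sU.
- by move=> u ue; rewrite /H scalerDl scale1r addrA per_dft //; exact: sU.
- move=> u ue; apply: dft_le => phi; apply: F_bnd.
  by apply: strip_real; [move=> i; exact: gridI|exact: sU].
- by rewrite le_eqVlt; apply/orP; left; apply/eqP; ring.
Qed.

Definition boxk m (psi : {ffun 'I_n -> 'I_m.*2.+1}) : {ffun 'I_n -> int} :=
  [ffun j => (psi j)%:Z - m%:Z].

(** Fourier inversion on the finite group of residues modulo [2 m + 1]; it is exact for each [m]. *)
Lemma dft_inversion m z : F z = \sum_(psi : {ffun 'I_n -> 'I_m.*2.+1}) dft F (boxk psi) m z.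
Proof.
set N := m.*2.+1; have N0 : (N%:R ^+ n : R[i]) != 0 by rewrite expf_neq0 // Nn0.
have orth (phi : {ffun 'I_n -> 'I_N}) :
    \sum_(psi : {ffun 'I_n -> 'I_N}) ce (- dotz (boxk psi) (gridv phi)) =
    (phi == [ffun=> ord0])%:R * N%:R ^+ n.
  pose xi j : R[i] := (phi j)%:R / N%:R.
  transitivity (\prod_(j < n) \sum_(i < N) ce (- xi j *~ (i%:Z - m%:Z))).
    rewrite bigA_distr_bigA /=; apply: eq_bigr => psi _.
    rewrite /dotz -sumrN ce_sum; apply: eq_bigr => j _.
    by rewrite !mxE ffunE mulNrz.
  have one j : \sum_(i < N) ce (- xi j *~ (i%:Z - m%:Z)) =
      (phi j == ord0)%:R * N%:R :> R[i].
    have -> : \sum_(i < N) ce (- xi j *~ (i%:Z - m%:Z)) =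
       ce (xi j *~ m%:Z) * (N%:R * avg N (fun x : R[i] => ce (x *~ (- (phi j)%:Z)))).
      rewrite /avg (mulrA N%:R) mulfV ?Nn0 // mul1r.
      rewrite mulr_sumr; apply: eq_bigr => i _; rewrite -ceD; congr ce.
      rewrite mulrzBr !mulNrz opprK addrC; congr (_ + _).
      rewrite mulrNz; congr (- _).
      by rewrite -(mulrzr (xi j)) -(mulrzr (i%:R / _)) -!pmulrn /xi; ring.
    rewrite avg_ce; last by rewrite abszN ltn_ord.
    rewrite oppr_eq0 eqz_nat -(inj_eq val_inj) /=.
    rewrite /xi; case: (eqVneq (phi j : nat) 0%N) => [->|_].
      by rewrite mul0r mul0rz ce0 mul1r mulrC.
    by rewrite !mulr0 mul0r.
  under eq_bigr do rewrite one.
  rewrite big_split /= prodr_const card_ord; congr (_ * _).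
  case: eqP => [->|ne]; first by rewrite big1 // => j _; rewrite ffunE eqxx.
  have [j jn] : exists j, phi j != ord0.
    apply: contrapT => nj; apply: ne; apply/ffunP => j; rewrite ffunE.
    by apply: contrapT => /eqP h; apply: nj; exists j.
  by rewrite (bigD1 j) //= (negPf jn) mul0r.
rewrite /dft -mulr_sumr exchange_big /=.
under eq_bigr do rewrite -mulr_sumr orth.
rewrite (bigD1 [ffun=> ord0]) //= eqxx mul1r big1 ?addr0 => [|phi /negPf ->]; last first.
  by rewrite mul0r mulr0.
rewrite [gridv _](_ : _ = 0) ?addr0; last by apply/rowP => j; rewrite !mxE ffunE mul0r.
by rewrite mulrCA mulVf ?mulr1.
Qed.

Definition fcoef k z := glim (fun m => dft F k m z).

Lemma bdd_dft k z : strip y e z -> bdd_seq (fun m => dft F k m z).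
Proof.
by move=> sz; exists B => m; apply: dft_le => phi; apply: F_bnd; apply: strip_real => // i; exact: gridI.
Qed.

Lemma fcoef_le k z : strip y e z -> cmod (fcoef k z) <= 2 * B.
Proof.
move=> sz; apply: (@glim_le _ _ _ 0%N (bdd_dft k sz)) => m _.
by apply: dft_le => phi; apply: F_bnd; apply: strip_real => // i; exact: gridI.
Qed.

Let km_ex k : exists m0, forall m, (m0 <= m)%N -> forall j, (`|k j| <= m)%N.
Proof.
exists (\max_j `|k j|)%N => m hm j; apply: leq_trans hm.
exact: (@leq_bigmax _ (fun j => `|k j|%N)).
Qed.

Lemma fcoef_translate k z j t : strip y e z -> Im (z 0 j) = y j -> `|Im t| <= e / 2 ->
  fcoef k (z + t *: unitv j) = ce (t *~ k j) * fcoef k z.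
Proof.
move=> sz zj te; have te1 : `|Im t| <= e by rewrite (le_trans te) // ler_pdivrMr // ler_pMr // ler1n.
case/andP: (q01) => q0 q1.
have sz' : strip y e (z + t *: unitv j) by exact: stripU.
rewrite /fcoef -glimZ; last exact: bdd_dft.
apply: glim_eq; [exact: bdd_dft|apply: bdd_seqZ; exact: bdd_dft|].
move=> d d0; have C0 : 0 <= (1 + cmod (ce (t *~ k j))) * (4 * B / (1 - q)).
  by rewrite mulr_ge0 ?addr_ge0 ?cmod_ge0 // divr_ge0 ?mulr_ge0 // subr_ge0 ltW.
have q01' : 0 <= q < 1 by rewrite ltW.
have [m0 H0] := geom_eventually q01' C0 d0; have [m1 H1] := km_ex k.
exists (maxn m0 m1) => m; rewrite geq_max => /andP[/H0 h0 /H1 h1].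
by rewrite (le_trans (dft_translate h1 sz zj te)).
Qed.

Let w k : R[i] := \prod_j (6 / (1 - q) * q ^+ `|k j|%N)%:C.

Let w_abs : abs_bdd w (\prod_(j < n) (6 / (1 - q) * (2 / (1 - q)))).
Proof.
case/andP: (q01) => q0 q1; have q1' : 0 <= 1 - q by rewrite subr_ge0 ltW.
apply: (@abs_bdd_prod R n int (fun (_ : 'I_n) (k : int) => (6 / (1 - q) * q ^+ `|k|%N)%:C)
  (fun=> 6 / (1 - q) * (2 / (1 - q)))) => j A.
rewrite (eq_bigr (fun k : int => 6 / (1 - q) * q ^+ `|k|%N)) => [|k _].
  by rewrite -mulr_sumr ler_wpM2l ?divr_ge0 // geom_int_sum // ltW.
by rewrite cmodR ger0_norm // mulr_ge0 ?divr_ge0 ?exprn_ge0 // ltW.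
Qed.

Let dft_w k m z : strip y 0 z -> (forall j, `|k j| <= m)%N ->
  cmod (dft F k m z) <= B * cmod (w k).
Proof.
move=> sz km; case/andP: (q01) => q0 q1; have q1' : 0 <= 1 - q by rewrite subr_ge0 ltW.
have -> : cmod (w k) = \prod_(j <- index_enum 'I_n) (6 / (1 - q) * q ^+ `|k j|%N).
  rewrite cmod_prod; apply: eq_bigr => j _.
  by rewrite cmodR ger0_norm // mulr_ge0 ?divr_ge0 ?exprn_ge0 // ltW.
apply: dft_decay => //; first exact: index_enum_uniq.
  by move=> j; rewrite (le_trans (sz j)) // ltW.
by move=> j _; apply/eqP; rewrite -subr_eq0 -normr_le0.
Qed.

(** Dominated convergence for the generalized limit: the inversion formula is exact at each level,
    and its terms outside a finite set are dominated by the summable family [w]. *)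
Lemma hsum_fcoef z : strip y 0 z -> hsum (fun k => fcoef k z) (F z).
Proof.
move=> sz; have sz' : strip y e z by move=> j; rewrite (le_trans (sz j)) // ltW.
have [W hW] := @has_sum_ge0 R _ (fun k => cmod (w k)) _ (fun k => cmod_ge0 _) w_abs.
(* A tail of [w] is at most [2 * d1], being the difference of two sums within [d1] of [W], and
   [glim_le] doubles once more; the total is below [d / 2]. *)
move=> d d0; pose d1 := d / (8 * (B + 1)).
have B1 : 0 < B + 1 by rewrite ltr_wpDl.
have d10 : 0 < d1 by rewrite divr_gt0 // mulr_gt0.
have [A HA] := hW _ d10; exists A => D AD.
have tail (E : {fset {ffun 'I_n -> int}}) : (D `<=` E)%fset ->
    \sum_(k <- (E `\` D)%fset) cmod (w k) <= 2 * d1.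
  move=> DE; have h1 := HA D AD; have h2 := HA E (fsubset_trans AD DE).
  have : \sum_(k <- E) cmod (w k) = \sum_(k <- D) cmod (w k) + \sum_(k <- (E `\` D)%fset) cmod (w k).
    rewrite (big_fsetID _ (mem D) E) /=; congr (_ + _); apply: eq_fbigl => k; rewrite !inE //=.
      by case kD: (k \in D); rewrite ?andbF ?andbT //; apply: (fsubsetP DE).
    by rewrite andbC.
  move: h1 h2; rewrite !ltr_norml; lra.
have /choice[M HM] := km_ex.
pose m0 := (\max_(k <- D) M k)%N.
have bnd m : (m0 <= m)%N -> cmod (F z - \sum_(k <- D) dft F k m z) <= B * (2 * d1).
  move=> mm; pose E := [fset boxk psi | psi : {ffun 'I_n -> 'I_m.*2.+1} in {: {ffun 'I_n -> 'I_m.*2.+1}}]%fset.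
  have kE k : (forall j, `|k j| <= m)%N -> k \in E.
    move=> kj; apply/imfsetP; exists [ffun j => inord (absz (k j + m%:Z)%R)] => //=.
    apply/ffunP => j; rewrite !ffunE inordK; last by have := kj j; lia.
    by rewrite gez0_abs ?addrK //; have := kj j; lia.
  have DE : (D `<=` E)%fset.
    apply/fsubsetP => k kD; apply: kE; apply: HM; rewrite (leq_trans _ mm) //.
    by rewrite /m0 (big_rem k) //= leq_maxl.
  have FE : F z = \sum_(k <- E) dft F k m z.
    rewrite (dft_inversion m z) big_imfset /=; last first.
      move=> p1 p2 _ _ /ffunP h; apply/ffunP => j; apply: val_inj => /=.
      by have := h j; rewrite !ffunE; lia.
    by rewrite -[LHS]big_enum.
  have -> : F z - \sum_(k <- D) dft F k m z = \sum_(k <- (E `\` D)%fset) dft F k m z.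
    rewrite FE (big_fsetID _ (mem D) E) /= addrC; apply/eqP; rewrite subr_eq; apply/eqP.
    congr (_ + _); apply: eq_fbigl => k; rewrite !inE //=; first by rewrite andbC.
    by case kD: (k \in D); rewrite ?andbF ?andbT //; apply: (fsubsetP DE).
  rewrite (le_trans (cmod_sum _ _ _)) // (le_trans _ (ler_wpM2l B0 (tail _ DE))) //.
  rewrite mulr_sumr big_seq [leRHS]big_seq; apply: ler_sum => k.
  rewrite !inE => /andP[_ /imfsetP[psi _ ->]]; apply: dft_w => // j.
  by rewrite ffunE; case: (psi j) => p /= pm; lia.
have -> : \sum_(k <- D) fcoef k z = glim (fun m => \sum_(k <- D) dft F k m z).
  by rewrite glim_sum // => k; exact: bdd_dft.
rewrite cmodBC -[F z]glim_cst -glimB; last 2 first.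
- by exists (cmod (F z)).
- by apply: bdd_seq_sum => k; exact: bdd_dft.
apply: (@le_lt_trans _ _ (2 * (B * (2 * d1)))).
  apply: (@glim_le _ _ _ m0) bnd.
  have [C HC] := @bdd_seq_sum R _ D (fun k m => dft F k m z) (fun k => bdd_dft k sz').
  by exists (cmod (F z) + C) => m; rewrite (le_trans (cmodB _ _)) // lerD2l.
have -> : 2 * (B * (2 * d1)) = B / (B + 1) * (d / 2) by rewrite /d1; field; rewrite gt_eqF.
have : B / (B + 1) <= 1 by rewrite ler_pdivrMr // mul1r lerDl.
have : 0 <= B / (B + 1) by rewrite divr_ge0 // ltW.
by nra.
Qed.

End Center.

End MultipleFourier.

(** * Fourier coefficients on a tube over a convex open base *)

Section FourierTube.
Variables (R : realType) (n : nat).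
Local Open Scope complex_scope.
Implicit Types (z w : 'rV[R[i]]_n) (k : {ffun 'I_n -> int}) (y : 'rV[R]_n) (j : 'I_n).
Local Notation unitv j := (delta_mx 0 j : 'rV[R[i]]_n).
Local Notation imv z := (map_mx (@complex.Im R) z : 'rV[R]_n).

Variables (O : set 'rV[R]_n) (F : 'rV[R[i]]_n -> R[i]) (B : R).

Definition inbox y (e : R) := forall y', (forall j, `|y' 0 j - y 0 j| <= e) -> O y'.

Hypothesis O_open : forall y, O y -> exists2 e : R, 0 < e & inbox y e.
Hypothesis O_convex : forall y y' (s : R), 0 <= s <= 1 -> O y -> O y' ->
  O ((1 - s) *: y + s *: y').
Hypothesis F_diff : forall z, O (imv z) -> forall j, cdiff (fun t => F (z + t *: unitv j)) 0.
Hypothesis F_per : forall z, O (imv z) -> forall j, F (z + unitv j) = F z.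
Hypothesis F_bnd : forall z, O (imv z) -> cmod (F z) <= B.

(** Division by the character removes the dependence of the coefficient on [z]; the following lemmas
    establish this in one coordinate, nearby, and on the whole tube. *)
Let acoef k z := fcoef F k z * ce (- dotz k z).

Let strip_O z e w : inbox (imv z) e -> strip (fun j => Im (z 0 j)) e w -> O (imv w).
Proof. by move=> zb sw; apply: zb => j; rewrite !mxE; exact: sw. Qed.

Let strip_refl z (e : R) : 0 <= e -> strip (fun j => Im (z 0 j)) e z.
Proof. by move=> e0 j; rewrite subrr normr0. Qed.

Let acoef_coord k z j t e : 0 < e -> inbox (imv z) e -> `|Im t| <= e / 2 ->
  acoef k (z + t *: unitv j) = acoef k z.
Proof.
move=> e0 zb te; have sO := strip_O zb.
rewrite /acoef (@fcoef_translate R n F (fun j => Im (z 0 j)) e B e0) //; first last.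
- by apply: strip_refl; exact: ltW.
- by move=> w /sO; exact: F_bnd.
- by move=> w /sO; exact: F_per.
- by move=> w /sO; exact: F_diff.
rewrite dotzD dotz_unit opprD ceD [ce (- (t *~ _))]ceN.
by field; exact: ce_neq0.
Qed.

Let acoef_near k z w e : 0 < e -> inbox (imv z) e ->
  (forall j, `|Im (w 0 j)| <= e / 4) -> acoef k (z + w) = acoef k z.
Proof.
move=> e0 zb we.
have part (r : seq 'I_n) : uniq r -> acoef k (z + \sum_(j <- r) w 0 j *: unitv j) = acoef k z.
  elim: r => [|j r IH] ur; first by rewrite big_nil addr0.
  have /andP[jr ur'] : (j \notin r) && uniq r by [].
  rewrite big_cons (addrC (w 0 j *: _)) addrA -(IH ur').
  apply: (@acoef_coord _ _ _ _ (e / 2)); first by rewrite divr_gt0.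
    move=> y' hy; apply: zb => i; have := hy i; rewrite !mxE ImD.
    suff : `|Im ((\sum_(j0 <- r) w 0 j0 *: unitv j0) 0 i)| <= e / 4.
      by rewrite !ler_norml; lra.
    rewrite summxE (eq_bigr (fun i0 => if i0 == i then w 0 i else 0)) => [|i0 _]; last first.
      by rewrite !mxE eqxx /= eq_sym; case: eqP => [->|_]; rewrite ?mulr1 ?mulr0.
    rewrite -big_mkcond /=; case ir: (i \in r).
      by rewrite (big_rem i ir) /= eqxx big_seq_cond big1 ?addr0 // => i0 /andP[]; rewrite mem_rem_uniq // inE => /andP[/negPf ->].
    rewrite big_seq_cond big1 ?normr0 ?divr_ge0 ?(ltW e0) // => i0 /andP[i0r /eqP i0i].
    by rewrite i0i ir in i0r.
  by rewrite (le_trans (we j)) //; lra.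
by have := part (index_enum 'I_n) (index_enum_uniq _); rewrite -row_sum_delta.
Qed.

(** By convexity a box of the same size [e] fits around every point of the segment, which can then
    be covered in finitely many equal small steps. *)
Let acoef_eq k z z' e : 0 < e -> inbox (imv z) e -> inbox (imv z') e ->
  acoef k z' = acoef k z.
Proof.
move=> e0 zb zb'.
have seg (s : R) : 0 <= s <= 1 -> inbox (imv (z + s%:C *: (z' - z))) e.
  move=> s01 y' hy; pose d : 'rV[R]_n := y' - imv (z + s%:C *: (z' - z)).
  have -> : y' = (1 - s) *: (imv z + d) + s *: (imv z' + d).
    by apply/rowP => j; rewrite !mxE ImD ImRM ImD ImN; ring.
  have dj (u : 'rV[R]_n) j : `|(u + d) 0 j - u 0 j| <= e.
    have -> : (u + d) 0 j - u 0 j = d 0 j by rewrite mxE; ring.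
    by rewrite mxE [X in _ + X]mxE.
  by apply: O_convex => //; [apply: zb|apply: zb'] => j; exact: dj.
pose M := \sum_j `|Im ((z' - z) 0 j)|; have M0 : 0 <= M by rewrite sumr_ge0.
(* With [N] steps no coordinate moves by more than [e / 4] in its imaginary part. *)
pose N := (Num.bound (4 * M / e)).+1.
have N0 : 0 < N%:R :> R by rewrite ltr0n.
have NM : M / N%:R <= e / 4.
  have h0 : 0 <= 4 * M / e by apply: divr_ge0; [apply: mulr_ge0|exact: ltW].
  have h1 : 4 * M / e <= N%:R.
    by rewrite (le_trans (ltW (archi_boundP h0))) // ler_nat.
  by move: h1; rewrite !ler_pdivrMr //; lra.
clearbody N.
have step p : (p <= N)%N -> acoef k (z + (p%:R / N%:R : R)%:C *: (z' - z)) = acoef k z.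
  elim: p => [|p IH] pN; first by rewrite mul0r scale0r addr0.
  have -> : (p.+1%:R / N%:R : R)%:C = (p%:R / N%:R)%:C + (N%:R^-1)%:C.
    by rewrite -rmorphD -natr1 mulrDl mul1r.
  rewrite scalerDl addrA -(IH (ltnW pN)).
  apply: (@acoef_near _ _ _ e) => //.
    apply: seg; rewrite divr_ge0 ?ler0n //= ler_pdivrMr // mul1r ler_nat ltnW //.
  move=> j; rewrite mxE ImRM normrM ger0_norm ?invr_ge0 ?ler0n // mulrC.
  rewrite (le_trans _ NM) // ler_pM2r ?invr_gt0 //.
  by rewrite /M (bigD1 j) //= lerDl sumr_ge0.
have := step N (leqnn _); rewrite divff ?gt_eqF // scale1r addrC subrK.
by [].
Qed.

(** The coefficients are fixed before [z], whereas their bound may be evaluated at any point of the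
    tube; vanishing and decay of coefficients are drawn from this freedom. *)
Lemma fourier_tube y0 : O y0 -> exists C : {ffun 'I_n -> int} -> R[i],
  forall z, O (imv z) -> hsum (fun k => C k * ce (dotz k z)) (F z) /\
    forall k, cmod (C k) <= 2 * B * expR (2 * pi * \sum_j (k j)%:~R * Im (z 0 j)).
Proof.
move=> Oy0; pose z0 : 'rV[R[i]]_n := \row_j ('i * (y0 0 j)%:C).
have z0E : imv z0 = y0 by apply/rowP => j; rewrite !mxE /=; ring.
exists (fun k => acoef k z0) => z Oz.
have [e1 e10 b1] := O_open Oz; have [e2 e20 b2] := O_open Oy0.
pose e := Num.min e1 e2; have e0 : 0 < e by rewrite lt_min e10.
have ib : inbox (imv z) e.
  by move=> y' hy; apply: b1 => j; rewrite (le_trans (hy j)) // ge_min lexx.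
have ib0 : inbox (imv z0) e.
  by move=> y' hy; apply: b2 => j; rewrite -z0E (le_trans (hy j)) // ge_min lexx orbT.
have CE k : acoef k z0 = fcoef F k z * ce (- dotz k z) := acoef_eq k e0 ib ib0.
have sO := strip_O ib.
have Fd w : strip (fun j => Im (z 0 j)) e w -> forall j, cdiff (fun t => F (w + t *: unitv j)) 0.
  by move=> /sO; exact: F_diff.
have Fp w : strip (fun j => Im (z 0 j)) e w -> forall j, F (w + unitv j) = F w.
  by move=> /sO; exact: F_per.
have Fb w : strip (fun j => Im (z 0 j)) e w -> cmod (F w) <= B by move=> /sO; exact: F_bnd.
split=> [|k].
  have := @hsum_fcoef R n F _ e B e0 Fd Fp Fb z (@strip_refl z 0 (lexx _)).
  apply: eq_hsum => k; rewrite CE -mulrA -ceD addNr ce0 mulr1 //.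
rewrite CE cmodM cmod_ce ImN mulrN opprK /dotz Im_sum.
rewrite (eq_bigr (fun j => (k j)%:~R * Im (z 0 j))) => [|j _]; last by rewrite ImMz.
rewrite ler_wpM2r ?expR_ge0 //; apply: (@fcoef_le R n F (fun j => Im (z 0 j)) e) => //.
by apply: strip_refl; exact: ltW.
Qed.

End FourierTube.

(** * Linear inequalities and Dickson's lemma *)

Section Polyhedra.
Variable R : realType.

(** Linearity as a predicate on bare functions, so that forms can be composed with a projection in
    an induction. *)
Definition functional (V : lmodType R) (f : V -> R) :=
  forall (a : R) x y, f (a *: x + y) = a * f x + f y.

Section Functional.
Variables (V : lmodType R) (f : V -> R).
Hypothesis f_lin : functional f.

Lemma functional0 : f 0 = 0.
Proof. by have := f_lin (-1) 0 0; rewrite scaler0 addr0 mulN1r addNr. Qed.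

Lemma functionalD x y : f (x + y) = f x + f y.
Proof. by rewrite -[x in LHS]scale1r f_lin mul1r. Qed.

Lemma functionalZ a x : f (a *: x) = a * f x.
Proof. by rewrite -[a *: x]addr0 f_lin functional0 addr0. Qed.

Lemma functionalN x : f (- x) = - f x.
Proof. by rewrite -scaleN1r functionalZ mulN1r. Qed.

End Functional.

(* Bartl's induction: if the first [m] inequalities do not suffice, project
   along a violating vector onto the hyperplane where the last one vanishes. *)
Lemma farkas (V : lmodType R) m (a : nat -> V -> R) (g : V -> R) :
  (forall i, (i < m)%N -> functional (a i)) -> functional g ->
  (forall x, (forall i, (i < m)%N -> 0 <= a i x) -> 0 <= g x) ->
  exists2 l : nat -> R, (forall i, 0 <= l i) &
    forall x, g x = \sum_(i < m) l i * a i x.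
Proof.
elim: m a g => [|m IH] a g al gl H.
  exists (fun=> 0) => // x; rewrite big_ord0; apply/eqP.
  have h1 : 0 <= g x by exact: H.
  have h2 : 0 <= g (- x) by exact: H.
  by rewrite functionalN // oppr_ge0 in h2; rewrite eq_le h2.
have al' i : (i < m)%N -> functional (a i) by move=> im; apply: al; exact: ltnW.
have aml : functional (a m) by exact: al.
have [suf|] := pselect (forall x, (forall i, (i < m)%N -> 0 <= a i x) -> 0 <= g x).
  have [l l0 lE] := IH a g al' gl suf.
  exists (fun i => if (i < m)%N then l i else 0); first by move=> i; case: ifP.
  move=> x; rewrite big_ord_recr /= ltnn mul0r addr0 lE.
  by apply: eq_bigr => i _; rewrite ltn_ord.
move=> /existsNP[x0] /not_implyP[ax0 /negP]; rewrite -ltNge => gx0.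
have amx0 : a m x0 < 0.
  rewrite ltNge; apply/negP => am0; move: gx0; rewrite ltNge => /negP; apply; apply: H => i.
  by rewrite ltnS leq_eqVlt => /orP[/eqP ->|/ax0].
pose x1 := (- a m x0)^-1 *: x0.
have sp : 0 < (- a m x0)^-1 by rewrite invr_gt0 oppr_gt0.
have am1 : a m x1 = -1.
  by rewrite /x1 functionalZ // invrN mulNr mulVf // lt_eqF.
have ax1 i : (i < m)%N -> 0 <= a i x1.
  by move=> im; rewrite /x1 functionalZ; [rewrite mulr_ge0 ?(ltW sp) // ax0|exact: al'].
have gx1 : g x1 <= 0 by rewrite /x1 functionalZ // pmulr_rle0 // ltW.
pose p x := x + a m x *: x1.
have pl c x y : p (c *: x + y) = c *: p x + p y.
  rewrite /p aml scalerDr scalerDl -!addrA; congr (_ + _).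
  by rewrite addrCA -[(c * _) *: _]scalerA.
have [|||l l0 lE] := IH (fun i x => a i (p x)) (fun x => g (p x)).
- by move=> i im c x y; rewrite pl; apply: al'.
- by move=> c x y; rewrite pl gl.
- move=> x ax; apply: H => i; rewrite ltnS leq_eqVlt => /orP[/eqP ->|/ax //].
  by rewrite /p functionalD // functionalZ // am1 mulrN1 subrr.
(* The new multiplier compensates the projection; it is nonnegative because [a i x1 >= 0] and
   [g x1 <= 0]. *)
exists (fun i => if (i < m)%N then l i else \sum_(i < m) l i * a i x1 - g x1).
  move=> i; case: ifP => // _; rewrite addr_ge0 ?oppr_ge0 // sumr_ge0 // => j _.
  by rewrite mulr_ge0 // ax1.
move=> x; have := lE x; rewrite /p functionalD // functionalZ // => /eqP.
rewrite eq_sym -subr_eq => /eqP <-.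
rewrite big_ord_recr /= ltnn.
have -> : \sum_(i < m) (if (i < m)%N then l i else \sum_(i0 < m) l i0 * a i0 x1 - g x1) * a i x =
   \sum_(i < m) l i * a i x by apply: eq_bigr => i _; rewrite ltn_ord.
have -> : \sum_(i < m) l i * a i (x + a m x *: x1) = \sum_(i < m) l i * a i x +
    a m x * \sum_(i < m) l i * a i x1.
  rewrite mulr_sumr -big_split /=; apply: eq_bigr => i _.
  rewrite functionalD; last exact: al'.
  by rewrite functionalZ; [ring|exact: al'].
by ring.
Qed.

(** Homogenization: on pairs [(x, t)] the inequalities together with [t >= 0] and [c * t - f x >= 0]
    force [t <= 0]. Farkas' multipliers, read at [t = 1], give [1 <= l * (f x - c)] with [l] the
    last one, so its inverse is the gap. A point of the polyhedron excludes [l = 0]. *)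
Lemma strict_bound (V : lmodType R) m (a : nat -> V -> R) (b : nat -> R) (f : V -> R) (c : R) x0 :
  (forall i, (i < m)%N -> functional (a i)) -> functional f ->
  (forall i, (i < m)%N -> b i <= a i x0) ->
  (forall x, (forall i, (i < m)%N -> b i <= a i x) -> c < f x) ->
  exists2 d : R, 0 < d & forall x, (forall i, (i < m)%N -> b i <= a i x) -> c + d <= f x.
Proof.
move=> al fl Px0 H.
pose W := (V * R^o)%type.
pose a' (i : nat) (p : W) : R := if (i < m)%N then a i p.1 - b i * p.2 else
  if i == m then p.2 else c * p.2 - f p.1.
have [||| l l0 lE] := @farkas W m.+2 a' (fun p => - p.2).
- move=> i _ s [x t] [x' t']; rewrite /a' /= -[s *: t + t']/((s * t + t')%R : R).
  move: (t : R) (t' : R) => {}t {}t'.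
  case: ifP => [im|_]; first by rewrite al //; ring.
  by case: eqP => _ //; rewrite fl; ring.
- move=> s [x t] [x' t'] /=; rewrite -[s *: t + t']/((s * t + t')%R : R).
  by move: (t : R) (t' : R) => {}t {}t'; ring.
- move=> [x t] /= h; rewrite oppr_ge0 leNgt; apply/negP => t0.
  have := h m.+1 (ltnSn _); rewrite /a' ltnNge leqW //= eqn_leq ltnn /= => hf.
  have : c < f (t^-1 *: x).
    apply: H => i im; rewrite functionalZ; last exact: al.
    have := h i (leqW (leqW im)); rewrite /a' im /= subr_ge0 mulrC => ha.
    by rewrite mulrC ler_pdivlMr // mulrC.
  by rewrite functionalZ // mulrC ltr_pdivlMr // ltNge -subr_ge0 hf.
have key x : (forall i, (i < m)%N -> b i <= a i x) -> 1 <= l m.+1 * (f x - c).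
  move=> Px; have := lE (x, 1); rewrite !big_ord_recr /= /a' ltnn eqxx ltnNge leqW //= eqn_leq ltnn /=.
  have : 0 <= \sum_(i < m) l i * (if (i < m)%N then a i x - b i * 1 else
     if i == m :> nat then 1 else c * 1 - f x).
    apply: sumr_ge0 => i _; rewrite ltn_ord mulr1 mulr_ge0 // subr_ge0; exact: Px.
  set S := \sum_(i < m) _; have := l0 m; rewrite !mulr1.
  lra.
have lp : 0 < l m.+1.
  rewrite lt_neqAle l0 andbT eq_sym; apply/eqP => l00.
  by have := key _ Px0; rewrite l00 mul0r ler10.
exists (l m.+1)^-1; rewrite ?invr_gt0 // => x Px.
by have := key x Px; rewrite mulrC -ler_pdivrMr // mul1r; lra.
Qed.

(** [L0] settles all points whose last coordinate is at least [M], the maximum of that coordinate on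
    [L0]; each of the finitely many smaller values gives a slice with one coordinate less. *)
Lemma dickson (T : eqType) m (f : nat -> T -> nat) (S : set T) :
  exists2 L : seq T, (forall x, x \in L -> S x) &
    forall x, S x -> exists2 y, y \in L & forall i, (i < m)%N -> (f i y <= f i x)%N.
Proof.
elim: m S => [|m IH] S.
  have [[x Sx]|nS] := pselect (exists x, S x).
    by exists [:: x] => y; [rewrite inE => /eqP ->|move=> _; exists x; rewrite ?inE].
  by exists [::] => // x Sx; case: nS; exists x.
have [L0 L0S HL0] := IH S.
pose M := (\max_(y <- L0) f m y)%N.
have /choice[L HL] : forall j, exists L : seq T, (forall x, x \in L -> S x /\ f m x = j) /\
    forall x, S x -> f m x = j -> exists2 y, y \in L & forall i, (i < m)%N -> (f i y <= f i x)%N.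
  move=> j; have [L LS HL] := IH (S `&` [set x | f m x = j]).
  by exists L; split=> [x /LS[] //|x Sx xj]; apply: HL.
exists (L0 ++ flatten [seq L j | j <- iota 0 M]) => x.
  rewrite mem_cat => /orP[/L0S //|/flatten_mapP[j _ xj]].
  by have [/(_ _ xj)[]] := HL j.
move=> Sx; have [Mx|xM] := leqP M (f m x).
  have [y yL yx] := HL0 x Sx; exists y; rewrite ?mem_cat ?yL // => i.
  rewrite ltnS leq_eqVlt => /orP[/eqP ->|/yx //]; apply: leq_trans Mx.
  by rewrite /M (big_rem y) //= leq_maxl.
have [HS /(_ _ Sx erefl)[y yL yx]] := HL (f m x).
exists y.
  rewrite mem_cat; apply/orP; right; apply/flatten_mapP; exists (f m x) => //.
  by rewrite mem_iota.
move=> i; rewrite ltnS leq_eqVlt => /orP[/eqP ->|/yx //].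
by have [_ ->] := HS _ yL.
Qed.

End Polyhedra.

(** * Integral generators of the dual cone *)

Section Gordan.
Variables (R : realType) (n : nat).
Implicit Types (x y h : 'rV[R]_n).

Definition dotv h y : R := \sum_j h 0 j * y 0 j.

Lemma dotv_functional h : functional (dotv h).
Proof.
move=> a x y; rewrite /dotv mulr_sumr -big_split /=; apply: eq_bigr => j _.
by rewrite !mxE; ring.
Qed.

Lemma dotvC h y : dotv h y = dotv y h.
Proof. by apply: eq_bigr => j _; rewrite mulrC. Qed.

Lemma dotvDl h h' y : dotv (h + h') y = dotv h y + dotv h' y.
Proof. by rewrite !(dotvC _ y) (functionalD (dotv_functional y)). Qed.

Lemma dotvZl a h y : dotv (a *: h) y = a * dotv h y.
Proof. by rewrite !(dotvC _ y) (functionalZ (dotv_functional y)). Qed.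

Lemma dotv_delta h j : dotv h (delta_mx 0 j) = h 0 j.
Proof.
rewrite /dotv (bigD1 j) //= mxE !eqxx mulr1 big1 ?addr0 // => i ij.
by rewrite mxE (negPf ij) andbF mulr0.
Qed.

Lemma dotv_suml (I : Type) (r : seq I) (G : I -> 'rV[R]_n) y :
  dotv (\sum_(i <- r) G i) y = \sum_(i <- r) dotv (G i) y.
Proof.
elim: r => [|i r IH]; last by rewrite !big_cons dotvDl IH.
by rewrite !big_nil dotvC (functional0 (dotv_functional y)).
Qed.

Variables (m : nat) (A : 'M[int]_(m, n)).

Definition rowA i : 'rV[R]_n := row i (map_mx intr A).

Lemma rowAE i x : (map_mx intr A *m x^T) i 0 = dotv (rowA i) x.
Proof. by rewrite mxE; apply: eq_bigr => j _; rewrite !mxE. Qed.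

Local Notation C := (halfspaces (map_mx intr A : 'M[R]_(m, n))).

Definition dualC h := forall x, C x -> 0 <= dotv h x.

Lemma rowA_dual i : dualC (rowA i).
Proof. by move=> x /(_ i); rewrite rowAE. Qed.

(** Farkas writes [k] as a nonnegative real combination of the rows. Truncating the multipliers
    leaves a remainder [rho] that is integral, lies in the dual cone and has bounded entries: one of
    finitely many vectors, which are added to the generators. *)
Lemma gordan : exists s : seq 'rV[R]_n, [/\ uniq s,
  forall h, h \in s -> h != 0 /\ dualC h &
  forall k : {ffun 'I_n -> int}, dualC (\row_j (k j)%:~R) ->
    exists al : 'rV[R]_n -> nat, \row_j (k j)%:~R = \sum_(h <- s) h *+ al h].
Proof.
(* Bounds every entry of a combination of the rows with multipliers between 0 and 1. *)
pose Bd := (\sum_i \sum_j `|A i j|)%N.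
pose ibox := [seq (\row_j ((phi j)%:Z - Bd%:Z)%:~R : 'rV[R]_n) |
   phi : {ffun 'I_n -> 'I_Bd.*2.+1}].
pose good h := `[< h != 0 /\ dualC h >].
pose s := undup [seq h <- [seq rowA i | i : 'I_m] ++ ibox | good h].
have sP h : h \in s = good h && ((h \in [seq rowA i | i : 'I_m]) || (h \in ibox)).
  by rewrite mem_undup mem_filter mem_cat.
pose nspan x := exists al : 'rV[R]_n -> nat, x = \sum_(h <- s) h *+ al h.
have nspan0 : nspan 0 by exists (fun=> 0%N); rewrite big1.
have nspanD x y : nspan x -> nspan y -> nspan (x + y).
  move=> [al ->] [be ->]; exists (fun h => (al h + be h)%N).
  by rewrite -big_split; apply: eq_bigr => h _; rewrite mulrnDr.
have nspanM x p : nspan x -> nspan (x *+ p).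
  by move=> hx; elim: p => [|p IH]; rewrite ?mulr0n // mulrS; apply: nspanD.
have nspan_in x : x \in s -> nspan x.
  move=> xs; exists (fun h => (h == x) : nat).
  rewrite (bigD1_seq x) ?undup_uniq //= eqxx mulr1n big1 ?addr0 // => h /negPf ->.
  by rewrite mulr0n.
exists s; split; first exact: undup_uniq.
  by move=> h; rewrite sP => /andP[/asboolP].
move=> k kC; set kv := \row_j _.
pose a (i : nat) x := if insub i is Some i' then dotv (rowA i') x else 0.
have [|||l l0 lE] := @farkas R _ m a (dotv kv).
- move=> i im; rewrite /a; case: insubP => [i' _ _|]; last by rewrite im.
  exact: dotv_functional.
- exact: dotv_functional.
- move=> x ax; apply: kC => i; rewrite rowAE.
  by have := ax i (ltn_ord i); rewrite /a valK.
have kE : kv = \sum_(i < m) l i *: rowA i.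
  apply/rowP => j; rewrite -!dotv_delta lE dotv_suml; apply: eq_bigr => i _.
  by rewrite /a valK dotvZl.
pose t (i : 'I_m) := Num.truncn (l i).
have tP (i : 'I_m) : 0 <= l i - (t i)%:R <= 1.
  by have := truncn_itv (l0 i); rewrite -/(t i) -natr1; lra.
pose rho := \sum_(i < m) (l i - (t i)%:R) *: rowA i.
have kr : kv = (\sum_(i < m) rowA i *+ t i) + rho.
  rewrite kE -big_split /=; apply: eq_bigr => i _.
  by rewrite scalerBl scaler_nat addrC subrK.
have rho_dual : dualC rho.
  move=> x Cx; rewrite /rho dotv_suml sumr_ge0 // => i _; rewrite dotvZl mulr_ge0 //.
    by case/andP: (tP i).
  exact: rowA_dual.
pose z j := k j - \sum_(i < m) A i j *+ t i.
have rz j : rho 0 j = (z j)%:~R.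
  have := congr1 (fun u : 'rV[R]_n => u 0 j) kr; rewrite mxE [in RHS]mxE addrC => /eqP.
  rewrite -subr_eq => /eqP <-; rewrite /z rmorphB rmorph_sum summxE /=; congr (_ - _).
  by apply: eq_bigr => i _; rewrite rmorphMn /= mulmxnE !mxE.
have zB j : (`|z j| <= Bd)%N.
  rewrite -lez_nat abszE -(ler_int R) intr_norm -rz.
  have -> : rho 0 j = \sum_(i < m) (l i - (t i)%:R) * (A i j)%:~R.
    by rewrite /rho summxE; apply: eq_bigr => i _; rewrite !mxE.
  apply: (@le_trans _ _ (\sum_(i < m) `|(A i j)%:~R|)).
    rewrite (le_trans (ler_norm_sum _ _ _)) // ler_sum // => i _.
    by case/andP: (tP i) => p0 p1; rewrite normrM ger0_norm // ler_piMl.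
  rewrite -pmulrn /Bd natr_sum ler_sum // => i _; rewrite natr_sum (bigD1 j) //=.
  by rewrite -intr_norm -abszE -pmulrn lerDl sumr_ge0.
rewrite -/(nspan kv) kr; apply: (nspanD _ _ _ _).
  apply: (big_ind nspan nspan0 nspanD) => i _; apply: nspanM.
  have [->//|r0] := eqVneq (rowA i) 0; apply: nspan_in; rewrite sP; apply/andP; split.
    by apply/asboolP; split=> //; exact: rowA_dual.
  by apply/orP; left; apply/mapP; exists i; rewrite ?mem_enum.
have [->//|r0] := eqVneq rho 0; apply: nspan_in; rewrite sP; apply/andP; split.
  by apply/asboolP.
apply/orP; right; apply/mapP; exists [ffun j => inord (absz (z j + Bd%:Z)%R)]; rewrite ?mem_enum //.
apply/rowP => j; rewrite mxE rz ffunE inordK; last by have := zB j; lia.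
by rewrite gez0_abs ?addrK //; have := zB j; lia.
Qed.

(** A small step from [y] against [h] stays in [S] and lowers the value by [t * dotv h h > 0]. *)
Lemma interior_dotv_gt (S : set 'rV[R]_n) h (c : R) y : h != 0 ->
  (forall x, S x -> c <= dotv h x) -> S^° y -> c < dotv h y.
Proof.
move=> h0 Sc; rewrite /interior => /nbhs_ballP[e /= e0 He].
have hh : 0 < dotv h h.
  have : 0 <= dotv h h by rewrite sumr_ge0 // => j _; rewrite -expr2 sqr_ge0.
  rewrite le_eqVlt => /orP[/eqP/esym hE|//]; case/eqP: h0; apply/rowP => j; rewrite mxE.
  have : h 0 j ^+ 2 <= dotv h h.
    by rewrite /dotv (bigD1 j) //= lerDl sumr_ge0 // => i _; rewrite -expr2 sqr_ge0.
  by rewrite hE => hj; apply/eqP; rewrite -sqrf_eq0 eq_le hj sqr_ge0.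
pose N := \sum_j `|h 0 j| + 1; have N0 : 0 < N by rewrite ltr_wpDl // sumr_ge0.
pose t := e / 2 / N; have t0 : 0 < t by rewrite !divr_gt0.
have : c <= dotv h (y - t *: h).
  apply: Sc; apply: He; split=> // i j; rewrite (ord1 i) /ball /= !mxE opprB addrC subrK.
  rewrite normrM (gtr0_norm t0) /t -mulrA -[ltRHS]mulr1 ltr_pM ?divr_ge0 ?mulr_ge0 ?invr_ge0 ?(ltW e0) ?(ltW N0) //.
    by rewrite ltr_pdivrMr // ltr_pMr // ltr1n.
  rewrite mulrC ltr_pdivrMr // mul1r /N (bigD1 j) //= -addrA ltrDl.
  by rewrite ltr_wpDl // sumr_ge0.
rewrite (functionalD (dotv_functional h)) (functionalN (dotv_functional h)) (functionalZ (dotv_functional h)).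
by move=> /le_lt_trans; apply; rewrite ltrBlDr ltrDl mulr_gt0.
Qed.

End Gordan.

(** * Expansion of products into real power series *)

Section Analyticity.
Variable R : realType.
Local Open Scope complex_scope.

(** The double family over [I] and over exponents is absolutely summable at radius [rho], so it may
    be summed over [I] first; this makes [gam] independent of [h]. *)
Lemma product_expansion (n : nat) (I : choiceType) (c : I -> R[i]) (rho : R)
    (b : I -> 'I_n -> nat -> R[i]) (T : I -> 'I_n -> R) (T0 : R) : 0 < rho ->
  (forall k i, abs_bdd (fun m => b k i m * rho%:C ^+ m) (T k i)) ->
  (forall A : {fset I}, \sum_(k <- A) cmod (c k) * \prod_i T k i <= T0) ->
  exists gam : {ffun 'I_n -> nat} -> R[i],
  forall (h : 'I_n -> R) (phi : I -> 'I_n -> R[i]) S, (forall i, `|h i| <= rho) ->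
    (forall k i, hsum (fun m => b k i m * (h i)%:C ^+ m) (phi k i)) ->
    hsum (fun k => c k * \prod_i phi k i) S ->
    hsum (fun m => gam m * (\prod_i h i ^+ m i)%:C) S.
Proof.
move=> rho0 bT cT.
have bm k i m : cmod (b k i m) * rho ^+ m <= T k i.
  have := bT k i [fset m]%fset; rewrite big_seq_fset1 cmodM cmodX cmodR ger0_norm //.
  exact: ltW.
have T_ge0 k i : 0 <= T k i.
  by rewrite (le_trans _ (bm k i 0%N)) // mulr_ge0 ?cmod_ge0 // expr0.
have gex (m : {ffun 'I_n -> nat}) : exists s, hsum (fun k => c k * \prod_i b k i (m i)) s.
  apply: (@abs_bdd_hsum _ _ _ (T0 / \prod_i rho ^+ m i)) => A.
  have P0 : 0 < \prod_i rho ^+ m i :> R by rewrite prodr_gt0 // => i _; rewrite exprn_gt0.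
  rewrite ler_pdivlMr // mulr_suml (le_trans _ (cT A)) // ler_sum // => k _.
  rewrite cmodM -mulrA ler_wpM2l ?cmod_ge0 // cmod_prod -big_split /=.
  by apply: ler_prod => i _; rewrite bm mulr_ge0 ?cmod_ge0 ?exprn_ge0 ?(ltW rho0).
have /choice[gam gamP] := gex; exists gam => h phi S hrho hphi hS.
pose F (p : I * {ffun 'I_n -> nat}) := c p.1 * \prod_i (b p.1 i (p.2 i) * (h i)%:C ^+ p.2 i).
have hT k i : abs_bdd (fun m => b k i m * (h i)%:C ^+ m) (T k i).
  apply: abs_bdd_sub (bT k i) => m; rewrite !cmodM !cmodX !cmodR ler_wpM2l ?cmod_ge0 //.
  by rewrite (ger0_norm (ltW rho0)) lerXn2r ?nnegrE ?(ltW rho0).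
have Fabs : abs_bdd F T0.
  apply: (@abs_bdd_pair R I _ F (fun k => cmod (c k) * \prod_i T k i)) cT => k A /=.
  rewrite /F /= (eq_bigr (fun m : {ffun 'I_n -> nat} => cmod (c k) *
    cmod (\prod_i (b k i (m i) * (h i)%:C ^+ m i)))) => [|m _]; last by rewrite cmodM.
  rewrite -mulr_sumr ler_wpM2l ?cmod_ge0 //.
  exact: (abs_bdd_prod (F := fun i m => b k i m * (h i)%:C ^+ m) (hT k)).
have [S' hS'] := abs_bdd_hsum Fabs.
have SS' : S' = S.
  apply: hsum_uniq hS; apply: (hsum_pair hS') => k; rewrite /F /=; apply: hsumZ.
  exact: (hsum_prod (F := fun i m => b k i m * (h i)%:C ^+ m) (hT k)).
rewrite -SS'; apply: (hsum_pair2 hS') => m.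
have := hsumZ ((\prod_i h i ^+ m i)%:C) (gamP m); rewrite mulrC.
apply: eq_hsum => k; rewrite /F /= big_split /= rmorph_prod /=.
by rewrite (eq_bigr (fun i => (h i)%:C ^+ m i)) => [|i _]; [ring|rewrite rmorphXn].
Qed.

Lemma fsum_nat_le (G : nat -> R) M (A : {fset nat}) : (forall m, 0 <= G m) ->
  (forall m, (M <= m)%N -> G m = 0) -> \sum_(m <- A) G m <= \sum_(m < M) G m.
Proof.
move=> G0 GM; pose D := [fset (val i) | i in 'I_M]%fset.
have -> : \sum_(m < M) G m = \sum_(m <- D) G m.
  by rewrite /D big_imfset /= ?big_enum // => i j _ _; exact: val_inj.
rewrite (big_fsetID _ (mem D) A) /= [X in _ + X]big_seq [X in _ + X]big1 ?addr0.
  by apply: fsum_mono => //; apply/fsubsetP => m; rewrite !inE /= => /andP[].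
move=> m; rewrite !inE /= => /andP[_ mD]; apply: GM; rewrite leqNgt; apply: contra mD => mM.
by apply/imfsetP; exists (Ordinal mM).
Qed.

Lemma hsum_nat_fin (F : nat -> R[i]) M : (forall m, (M <= m)%N -> F m = 0) ->
  hsum F (\sum_(m < M) F m).
Proof.
move=> FM e e0; pose D := [fset (val i) | i in 'I_M]%fset; exists D => B DB.
have -> : \sum_(m < M) F m = \sum_(m <- D) F m.
  by rewrite /D big_imfset /= ?big_enum // => i j _ _; exact: val_inj.
rewrite (big_fset_incl _ DB) ?subrr ?cmod0 // => m mB mD; apply: FM; rewrite leqNgt.
by apply: contra mD => mM; apply/imfsetP; exists (Ordinal mM).
Qed.

Lemma power_expansion (a rho : R) (al : nat) : 0 < rho ->
  exists b : nat -> R[i],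
    abs_bdd (fun m => b m * rho%:C ^+ m) ((`|a| + rho) ^+ al) /\
    forall h : R, hsum (fun m => b m * h%:C ^+ m) ((a + h)%:C ^+ al).
Proof.
move=> rho0; exists (fun m => (a ^+ (al - m) *+ 'C(al, m))%:C); split=> [A|h].
  apply: (@le_trans _ _ (\sum_(m < al.+1) (`|a| ^+ (al - m) * rho ^+ m *+ 'C(al, m)))); last first.
    by rewrite exprDn.
  apply: (le_trans (@fsum_nat_le _ al.+1 A _ _)).
  - by move=> m; exact: cmod_ge0.
  - by move=> m am; rewrite bin_small // mulr0n mul0r cmod0.
  - apply: ler_sum => m _; rewrite cmodM cmodX !cmodR normrMn normrX (ger0_norm (ltW rho0)).
    by rewrite -mulrnAl.
have -> : (a + h)%:C ^+ al = \sum_(m < al.+1) (a ^+ (al - m) *+ 'C(al, m))%:C * h%:C ^+ m.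
  rewrite rmorphD /= exprDn; apply: eq_bigr => m _.
  by rewrite rmorphMn rmorphXn /= mulrnAl.
by apply: hsum_nat_fin => m am; rewrite bin_small // mulr0n mul0r.
Qed.

Lemma has_sum_series (G : nat -> R) (s l : R) : has_sum G s ->
  series G @ \oo --> l -> s = l.
Proof.
move=> hG cG; apply/eqP; rewrite -subr_eq0 -normr_le0; apply/ler_addgt0Pr => e e0.
have e2 : 0 < e / 2 by rewrite divr_gt0.
have [A HA] := hG _ e2; move/cvgrPdist_lt: cG => /(_ _ e2)[M _ HM].
pose N := maxn M (\max_(m <- A) m).+1.
pose D := [fset (val i) | i in 'I_N]%fset.
have AD : (A `<=` D)%fset.
  apply/fsubsetP => m mA; have mN : (m < N)%N.
    by rewrite /N leq_max ltnS (big_rem m) //= leq_maxl orbT.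
  by apply/imfsetP; exists (Ordinal mN).
have := HA _ AD; rewrite big_imfset /=; last by move=> i j _ _; exact: val_inj.
have := HM N (leq_maxl _ _); rewrite /series /= big_mkord big_enum /= => h1 h2.
set x := \sum_(i < N) G i in h1 h2.
by move: h1 h2; rewrite add0r ltr_norml ltr_norml ler_norml; lra.
Qed.

Lemma expi_coeff (y : R) m : (m`!%:R)^-1%:C * ('i * y%:C) ^+ m =
  cos_coeff y m +i* sin_coeff y m.
Proof.
have im : 'i ^+ m = ((~~ odd m)%:R * (-1) ^+ m./2) +i* ((odd m)%:R * (-1) ^+ m.-1./2) :> R[i].
  have i2 p : 'i ^+ p.*2 = ((-1) ^+ p)%:C :> R[i].
    by rewrite -mul2n exprM sqr_i rmorphXn rmorphN1.
  have := odd_double_half m; case: (odd m) => /= <-; set p := m./2.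
    by rewrite add1n exprS i2 /= doubleK; simpc.
  by rewrite add0n i2 doubleK; simpc.
rewrite exprMn im -rmorphXn /cos_coeff /sin_coeff /= -[_ ^+ m]/(y ^+ m).
by simpc; congr (_ +i* _); rewrite -?exprnP; ring.
Qed.

Lemma expR_partial (y : R) M : 0 <= y -> \sum_(m < M) y ^+ m / m`!%:R <= expR y.
Proof.
move=> y0; rewrite /expR -(big_mkord xpredT (fun m => y ^+ m / m`!%:R)).
apply: (@nondecreasing_cvgn_le _ (series (exp_coeff y)) _ (is_cvg_series_exp_coeff y) M).
by apply: nondecreasing_series => m _ _; exact: exp_coeff_ge0.
Qed.

(** The exponential series in [h] times [ce (a k)], which has modulus 1; hence the majorant does not
    depend on [a]. The sum is identified through the series of [cos] and [sin]. *)
Lemma ce_expansion (a rho : R) (k : int) : 0 < rho ->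
  exists b : nat -> R[i],
    abs_bdd (fun m => b m * rho%:C ^+ m) (expR (2 * pi * rho * `|k|%:~R)) /\
    forall h : R, hsum (fun m => b m * h%:C ^+ m) (ce ((a + h)%:C *~ k)).
Proof.
move=> rho0; have p0 := @pi_gt0 R; pose t : R := 2 * pi * k%:~R.
have tn : `|t| = 2 * pi * `|k|%:~R.
  by rewrite /t !normrM normr_nat (ger0_norm (ltW p0)) intr_norm.
pose d m : R[i] := (m`!%:R)^-1%:C * ('i * t%:C) ^+ m.
have dE m (h : R) : d m * h%:C ^+ m = (m`!%:R)^-1%:C * ('i * (t * h)%:C) ^+ m.
  have -> : 'i * (t * h)%:C = ('i * t%:C) * h%:C :> R[i] by rewrite rmorphM mulrA.
  by rewrite [in RHS]exprMn mulrA.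
have dabs (h : R) : abs_bdd (fun m => d m * h%:C ^+ m) (expR (`|t| * `|h|)).
  move=> A; have nn m : 0 <= cmod (d m * h%:C ^+ m) by exact: cmod_ge0.
  pose M := (\max_(m <- A) m).+1.
  pose G m := if (m < M)%N then cmod (d m * h%:C ^+ m) else 0.
  rewrite big_seq (eq_bigr G) => [|m mA]; last first.
    by rewrite /G /M ltnS (big_rem m) //= leq_maxl.
  rewrite -big_seq (le_trans (fsum_nat_le (M := M) A _ _)) //.
  - by move=> m; rewrite /G; case: ifP.
  - by move=> m mM; rewrite /G ltnNge mM.
  - rewrite (le_trans _ (expR_partial M _)) ?mulr_ge0 // ler_sum // => m _.
    rewrite /G ltn_ord dE cmodM cmodX cmodM cmodi mul1r !cmodR normfV normr_nat normrM.
    by rewrite mulrC.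
exists (fun m => ce (a%:C *~ k) * d m); split=> [A|h].
  have ca : cmod (ce (a%:C *~ k)) = 1 by rewrite -rmorphMz /= cmod_ceR.
  have := dabs rho A; rewrite (ger0_norm (ltW rho0)) tn mulrAC.
  apply: le_trans; rewrite ler_sum // => m _.
  by rewrite -mulrA cmodM ca mul1r.
have -> : ce ((a + h)%:C *~ k) = ce (a%:C *~ k) * ce (h%:C *~ k).
  by rewrite rmorphD mulrzDl ceD.
suff : hsum (fun m => d m * h%:C ^+ m) (ce (h%:C *~ k)).
  by move=> /(hsumZ (ce (a%:C *~ k))); apply: eq_hsum => m; rewrite mulrA.
have [s hs] := abs_bdd_hsum (dabs h).
suff <- : s = ce (h%:C *~ k) by [].
have cE : ce (h%:C *~ k) = cos (t * h) +i* sin (t * h).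
  rewrite -rmorphMz /= /ce /= mulr0 oppr0 expR0 mul1r -mulrzr.
  by congr (cos _ +i* sin _); rewrite /t; ring.
rewrite cE; apply/eqP; rewrite eq_complex; apply/andP; split; apply/eqP.
  apply: (has_sum_series (hsum_Re hs)).
  rewrite (_ : (fun i => Re _) = cos_coeff (t * h)); last by apply/funext => m; rewrite dE expi_coeff.
  by rewrite /= cos.unlock; exact: is_cvg_series_cos_coeff.
apply: (has_sum_series (hsum_Im hs)).
rewrite (_ : (fun i => Im _) = sin_coeff (t * h)); last by apply/funext => m; rewrite dE expi_coeff.
by rewrite /= sin.unlock; exact: is_cvg_series_sin_coeff.
Qed.

End Analyticity.

(** The inverse of one plus the sum of the inverses also works over an empty type, where a minimum
    would not exist. *)
Lemma exists_pos_lb (R : realType) (I : finType) (f : I -> R) : (forall i, 0 < f i) ->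
  exists2 e : R, 0 < e & forall i, e <= f i.
Proof.
move=> f0; have S0 : 0 <= \sum_i (f i)^-1 by rewrite sumr_ge0 // => i _; rewrite invr_ge0 ltW.
exists (\sum_i (f i)^-1 + 1)^-1 => [|i]; first by rewrite invr_gt0 ltr_wpDl.
rewrite -[leRHS]invrK lef_pV2 ?posrE ?invr_gt0 ?ltr_wpDl // (bigD1 i) //= -addrA lerDl.
by rewrite addr_ge0 // sumr_ge0 // => j _; rewrite invr_ge0 ltW.
Qed.

(** * Series that are powers in the moduli and Fourier in the angles *)

Section PowerFourierSeries.
Variables (R : realType) (N n : nat).
Local Open Scope complex_scope.
Implicit Types (k : {ffun 'I_n -> int}) (v : 'rV[R]_(N + n)).
Variables (C : {ffun 'I_n -> int} -> R[i]) (al : {ffun 'I_n -> int} -> 'I_N -> nat).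
Variables (rr : 'I_N -> R) (eps T0 : R).
Hypothesis rr_gt0 : forall j, 0 < rr j.
Hypothesis eps_gt0 : 0 < eps.
Hypothesis C_sum : forall A : {fset {ffun 'I_n -> int}},
  \sum_(k <- A) cmod (C k) * (\prod_j rr j ^+ al k j * expR (eps * \sum_i `|k i|%:~R)) <= T0.

Let factor k (i : 'I_(N + n)) (x : R) : R[i] :=
  match fintype.split i with inl j => x%:C ^+ al k j | inr j => ce (x%:C *~ k j) end.

Let split_lsh (j : 'I_N)  : fintype.split (lshift n j) = inl j := unsplitK (inl j).
Let split_rsh (j : 'I_n) : fintype.split (rshift N j) = inr j := unsplitK (inr j).

Definition pf_term v k : R[i] :=
  C k * (\prod_j (v 0 (lshift n j))%:C ^+ al k j * \prod_i ce ((v 0 (rshift N i))%:C *~ k i)).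

Let pf_termE v k : pf_term v k = C k * \prod_i factor k i (v 0 i).
Proof.
rewrite /pf_term big_split_ord /=; congr (_ * (_ * _)); apply: eq_bigr => i _.
  by rewrite /factor split_lsh.
by rewrite /factor split_rsh.
Qed.

(** Where the series has no sum, [xget] returns the default 0. *)
Definition pf_fun v : R[i] := xget 0 [set s | hsum (pf_term v) s].

Definition pf_dom : set 'rV[R]_(N + n) := [set v | forall j, `|v 0 (lshift n j)| < rr j].

Lemma pf_sum v : pf_dom v -> hsum (pf_term v) (pf_fun v).
Proof.
move=> vW; have [s hs] : exists s, hsum (pf_term v) s.
  apply: (@abs_bdd_hsum _ _ _ T0) => A; apply: le_trans (C_sum A); rewrite ler_sum // => k _.
  rewrite !cmodM ler_wpM2l ?cmod_ge0 // !cmod_prod.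
  rewrite [X in _ * X](eq_bigr (fun=> 1)) => [|i _]; last by rewrite -rmorphMz /= cmod_ceR.
  rewrite [X in _ * X]big1 //; apply: ler_pM => //.
  - by apply: prodr_ge0 => j _; exact: cmod_ge0.
  - apply: ler_prod => j _; rewrite cmod_ge0 cmodX cmodR.
    by rewrite lerXn2r ?nnegrE ?(ltW (rr_gt0 _)) // ltW // vW.
  - by rewrite -expR0 ler_expR mulr_ge0 ?(ltW eps_gt0) // sumr_ge0.
by rewrite /pf_fun; case: xgetP => [t _ //|/(_ s)/(_ hs)].
Qed.

Let pf_expansion v : pf_dom v -> exists gam : {ffun 'I_(N + n) -> nat} -> R[i],
  nbhs v (fun x : 'rV[R]_(N + n) =>
    hsum (fun m => gam m * (\prod_i (x 0 i - v 0 i) ^+ m i)%:C) (pf_fun x)).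
Proof.
move=> vW; have p0 := @pi_gt0 R.
have gap j : 0 < rr j - `|v 0 (lshift n j)| by rewrite subr_gt0; exact: vW.
have [e1 e10 e1W] := exists_pos_lb gap.
(* The first bound keeps the enlarged moduli below [rr]; the second keeps the majorants of the
   angular factors below the factor with [eps] in [C_sum]. *)
pose rho := Num.min (e1 / 2) (eps / (2 * pi)).
have rho0 : 0 < rho by rewrite lt_min !divr_gt0 // mulr_gt0.
have rho1 j : `|v 0 (lshift n j)| + rho < rr j.
  rewrite addrC -ltrBrDr (lt_le_trans _ (e1W j)) // (le_lt_trans (_ : rho <= e1 / 2)) //.
    by rewrite ge_min lexx.
  by rewrite ltr_pdivrMr // ltr_pMr // ltr1n.
have rho2 : 2 * pi * rho <= eps.
  by rewrite mulrC -ler_pdivlMr ?mulr_gt0 // ge_min lexx orbT.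
pose T k (i : 'I_(N + n)) : R := match fintype.split i with
  inl j => (`|v 0 i| + rho) ^+ al k j | inr j => expR (2 * pi * rho * `|k j|%:~R) end.
have /choice[b bP] : forall ki : {ffun 'I_n -> int} * 'I_(N + n), exists b : nat -> R[i],
    abs_bdd (fun m => b m * rho%:C ^+ m) (T ki.1 ki.2) /\
    forall h : R, hsum (fun m => b m * h%:C ^+ m) (factor ki.1 ki.2 (v 0 ki.2 + h)).
  move=> [k i] /=; rewrite /T /factor; case: (fintype.split i) => j.
    exact: power_expansion.
  exact: ce_expansion.
have [||gam gamP] := @product_expansion R (N + n) _ C rho (fun k i => b (k, i)) T T0 rho0.
- by move=> k i; have [] := bP (k, i).
- move=> A; apply: le_trans (C_sum A); rewrite ler_sum // => k _.
  rewrite ler_wpM2l ?cmod_ge0 // big_split_ord /= ler_pM //.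
  + by apply: prodr_ge0 => j _; rewrite /T split_lsh exprn_ge0 // addr_ge0 // ltW.
  + by apply: prodr_ge0 => j _; rewrite /T split_rsh expR_ge0.
  + apply: ler_prod => j _; rewrite /T split_lsh exprn_ge0 ?addr_ge0 ?(ltW rho0) //=.
    by rewrite lerXn2r ?nnegrE ?(ltW (rr_gt0 _)) ?addr_ge0 ?(ltW rho0) // ltW.
  + rewrite (eq_bigr (fun j => expR (2 * pi * rho * `|k j|%:~R))) => [|j _]; last by rewrite /T split_rsh.
    by rewrite -expR_sum ler_expR -mulr_sumr ler_wpM2r // sumr_ge0.
exists gam; apply/nbhs_ballP; exists rho => //= x [_ xv].
have xvn i : `|x 0 i - v 0 i| < rho by have := xv 0 i; rewrite /ball /= distrC.
have xW : pf_dom x.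
  move=> j; rewrite (le_lt_trans _ (rho1 j)) // -[x 0 _](subrK (v 0 (lshift n j))).
  by rewrite (le_trans (ler_normD _ _)) // addrC lerD2l ltW.
apply: (gamP (fun i => x 0 i - v 0 i) (fun k i => factor k i (x 0 i))).
- by move=> i; exact: ltW.
- by move=> k i; have [_ /(_ (x 0 i - v 0 i))] := bP (k, i); rewrite /= (addrC (v 0 i)) subrK.
- by apply: eq_hsum (pf_sum xW) => k; rewrite pf_termE.
Qed.

Lemma pf_Re_analytic : real_analytic_on pf_dom (fun v => Re (pf_fun v)).
Proof.
move=> v vW; have [gam H] := pf_expansion vW; exists (fun m => Re (gam m)).
apply: filterS H => x /hsum_Re; congr has_sum; apply/funext => m.
by rewrite mulrC ReRM mulrC.
Qed.

Lemma pf_Im_analytic : real_analytic_on pf_dom (fun v => Im (pf_fun v)).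
Proof.
move=> v vW; have [gam H] := pf_expansion vW; exists (fun m => Im (gam m)).
apply: filterS H => x /hsum_Im; congr has_sum; apply/funext => m.
by rewrite mulrC ImRM mulrC.
Qed.

Lemma pf_dom_open : open pf_dom.
Proof.
rewrite openE => v vW.
have gap j : 0 < rr j - `|v 0 (lshift n j)| by rewrite subr_gt0; exact: vW.
have [e e0 eW] := exists_pos_lb gap.
apply/nbhs_ballP; exists e => //= x [_ xv] j.
have xvn : `|x 0 (lshift n j) - v 0 (lshift n j)| < e by have := xv 0 (lshift n j); rewrite /ball /= distrC.
rewrite -[x 0 _](subrK (v 0 (lshift n j))) (le_lt_trans (ler_normD _ _)) //.
by rewrite -ltrBrDr (lt_le_trans xvn).
Qed.

(** The box contains the value 0 of the moduli, their limit when imaginary parts tend to infinity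
    inside the cone; the power series is analytic there as well. *)
Lemma pf_restricted (hi : 'I_N -> R) (r : R) : (forall j, hi j < rr j) ->
  exists gre gim : restricted_analytic R (N + n), forall v,
    (forall j, 0 <= v 0 (lshift n j) <= hi j) -> (forall i, `|v 0 (rshift N i)| <= r) ->
    ra_val gre v +i* ra_val gim v = pf_fun v.
Proof.
move=> hr.
pose lo : 'rV[R]_(N + n) := \row_i match fintype.split i with inl j => 0 | inr j => - r end.
pose up : 'rV[R]_(N + n) := \row_i match fintype.split i with inl j => hi j | inr j => r end.
have sub : box lo up `<=` pf_dom.
  move=> v bv j; have := bv (lshift n j); rewrite !mxE split_lsh => /andP[v0 v1].
  by rewrite ger0_norm // (le_lt_trans v1).
exists (RestrictedAnalytic pf_dom_open sub pf_Re_analytic).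
exists (RestrictedAnalytic pf_dom_open sub pf_Im_analytic) => v vl vr.
have bv : box lo up v.
  move=> i; rewrite !mxE -(splitK i); case: (fintype.split i) => j /=.
    by rewrite split_lsh.
  by rewrite split_rsh -ler_norml.
by rewrite /ra_val /= asboolT //; case: (pf_fun v).
Qed.

End PowerFourierSeries.

(** * Closure properties of definable functions and predicates *)

Section Definability.
Variable R : realType.
Local Open Scope complex_scope.

Lemma has_sum_unit (c : R) : has_sum (fun m : {ffun 'I_0 -> nat} => c * 1) c.
Proof.
move=> e e0; pose m0 : {ffun 'I_0 -> nat} := [ffun=> 0%N]; exists [fset m0]%fset => B AB.
have -> : B = [fset m0]%fset.
  apply/eqP; rewrite eqEfsubset AB andbT; apply/fsubsetP => m _.
  by rewrite inE; apply/eqP/ffunP => -[].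
by rewrite big_seq_fset1 mulr1 subrr normr0.
Qed.

Lemma constant_analytic (c : R) : real_analytic_on setT (fun _ : 'rV[R]_0 => c).
Proof.
move=> a _; exists (fun=> c); apply: filterE => x.
have -> : (fun m : {ffun 'I_0 -> nat} => c * \prod_(i < 0) (x 0 i - a 0 i) ^+ m i) = (fun=> c * 1).
  by apply/funext => m; rewrite big_ord0.
exact: has_sum_unit.
Qed.

(** A function of no variables on the one-point box: this is how real parameters enter the
    language. *)
Definition constant_ra (c : R) : restricted_analytic R 0 :=
  @RestrictedAnalytic R 0 0 0 _ _ openT (@subsetT _ _) (constant_analytic c).

Section Context.
Variable N : nat.
Implicit Types (f g : ('I_N -> R) -> R) (P Q : ('I_N -> R) -> Prop).

(** Definability of functions and predicates on valuations, up to extensional equality; formulas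
    need not be written out. *)
Definition dterm f := exists t : term R N, forall v, Defs.eval v t = f v.
Definition dpred P := exists p : formula R N, forall v, sat p v <-> P v.

Lemma dterm_var i : dterm (fun v => v i).
Proof. by exists (TVar R i). Qed.

Lemma dterm_const c : dterm (fun=> c).
Proof.
exists (TRan (constant_ra c) (fun i => TZero R N)) => v /=.
by rewrite /ra_val asboolT // => -[].
Qed.

Lemma dtermD f g : dterm f -> dterm g -> dterm (fun v => f v + g v).
Proof. by move=> [s hs] [t ht]; exists (TAdd s t) => v /=; rewrite hs ht. Qed.

Lemma dtermM f g : dterm f -> dterm g -> dterm (fun v => f v * g v).
Proof. by move=> [s hs] [t ht]; exists (TMul s t) => v /=; rewrite hs ht. Qed.

Lemma dterm_exp f : dterm f -> dterm (fun v => expR (f v)).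
Proof. by move=> [s hs]; exists (TExp s) => v /=; rewrite hs. Qed.

Lemma dterm_sum (I : Type) (r : seq I) (F : I -> ('I_N -> R) -> R) :
  (forall i, dterm (F i)) -> dterm (fun v => \sum_(i <- r) F i v).
Proof.
move=> dF; elim: r => [|i r IH].
  by have [t ht] := dterm_const 0; exists t => v; rewrite ht big_nil.
by have [t ht] := dtermD (dF i) IH; exists t => v; rewrite ht big_cons.
Qed.

Lemma dterm_ran k (g : restricted_analytic R k) (F : 'I_k -> ('I_N -> R) -> R) :
  (forall i, dterm (F i)) -> dterm (fun v => ra_val g (\row_i F i v)).
Proof.
move=> /choice[t ht]; exists (TRan g t) => v /=; congr ra_val.
by apply/rowP => i; rewrite !mxE ht.
Qed.

Lemma dpred_ext P Q : (forall v, P v <-> Q v) -> dpred P -> dpred Q.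
Proof. by move=> PQ [p hp]; exists p => v; rewrite hp. Qed.

Lemma dpred_eq f g : dterm f -> dterm g -> dpred (fun v => f v = g v).
Proof. by move=> [s hs] [t ht]; exists (FEq s t) => v /=; rewrite hs ht. Qed.

Lemma dpred_lt f g : dterm f -> dterm g -> dpred (fun v => f v < g v).
Proof. by move=> [s hs] [t ht]; exists (FLt s t) => v /=; rewrite hs ht. Qed.

Lemma dpred_not P : dpred P -> dpred (fun v => ~ P v).
Proof. by move=> [p hp]; exists (FNot p) => v /=; rewrite hp. Qed.

Lemma dpred_and P Q : dpred P -> dpred Q -> dpred (fun v => P v /\ Q v).
Proof. by move=> [p hp] [q hq]; exists (FAnd p q) => v /=; rewrite hp hq. Qed.

Lemma dpred_le f g : dterm f -> dterm g -> dpred (fun v => f v <= g v).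
Proof.
move=> df dg; apply: dpred_ext (dpred_not (dpred_lt dg df)) => v.
by rewrite leNgt; split=> /negP.
Qed.

Lemma dpred_const (b : Prop) : dpred (fun=> b).
Proof.
have d0 := dterm_const 0; have [tb|nb] := pselect b.
  by apply: dpred_ext (dpred_eq d0 d0) => v; split.
by apply: dpred_ext (dpred_lt d0 d0) => v; rewrite ltxx; split.
Qed.

Lemma dpred_or P Q : dpred P -> dpred Q -> dpred (fun v => P v \/ Q v).
Proof.
move=> dP dQ; apply: dpred_ext (dpred_not (dpred_and (dpred_not dP) (dpred_not dQ))) => v.
split=> [H|[p|q] [] //].
by apply: contrapT => nH; apply: H; split=> h; apply: nH; [left|right].
Qed.

Lemma dpred_exists_seq (I : eqType) (r : seq I) (P : I -> ('I_N -> R) -> Prop) :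
  (forall i, dpred (P i)) -> dpred (fun v => exists2 i, i \in r & P i v).
Proof.
move=> dP; elim: r => [|i r IH].
  by apply: dpred_ext (dpred_const False) => v; split=> // -[].
apply: dpred_ext (dpred_or (dP i) IH) => v; split=> [[h|[j jr h]]|[j]].
- by exists i; rewrite ?mem_head.
- by exists j; rewrite // in_cons jr orbT.
- by rewrite in_cons => /orP[/eqP ->|jr] h; [left|right; exists j].
Qed.

Lemma dpred_forall (I : finType) (P : I -> ('I_N -> R) -> Prop) :
  (forall i, dpred (P i)) -> dpred (fun v => forall i, P i v).
Proof.
move=> dP; apply: dpred_ext (dpred_not (dpred_exists_seq (enum I) (fun i => dpred_not (dP i)))) => v.
split=> [H i|H [i _]]; last exact.
by apply: contrapT => h; apply: H; exists i; rewrite ?mem_enum.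
Qed.

End Context.

Definition recon N n (re im : 'I_n -> 'I_N) (v : 'I_N -> R) : 'rV[R[i]^o]_n :=
  \row_j (v (re j) +i* v (im j)).

Lemma definableC_dpred n (S : set 'rV[R[i]^o]_n) :
  dpred (fun v => S (recon (@lshift n n) (@rshift n n) v)) -> definableC S.
Proof.
move=> [p hp]; exists p; apply/seteqP; split=> x /=.
  move=> [w Sw <-]; apply/hp; congr S: Sw; apply/rowP => j.
  by rewrite mxE /realify row_mxEl row_mxEr !mxE; case: (w 0 j).
move=> /hp Sx; exists (recon (@lshift n n) (@rshift n n) (x 0)) => //.
apply/rowP => i; rewrite /realify -(splitK i); case: (fintype.split i) => j /=.
  by rewrite row_mxEl !mxE.
by rewrite row_mxEr !mxE.
Qed.

(** [realify] lists all real parts before all imaginary parts, so each half ends with one coordinate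
    of the function value. *)
Definition graph_re n (j : 'I_n) : 'I_((n + 1) + (n + 1)) := lshift (n + 1) (lshift 1 j).
Definition graph_im n (j : 'I_n) : 'I_((n + 1) + (n + 1)) := rshift (n + 1) (lshift 1 j).
Definition graph_vre n : 'I_((n + 1) + (n + 1)) := lshift (n + 1) (rshift n 0).
Definition graph_vim n : 'I_((n + 1) + (n + 1)) := rshift (n + 1) (rshift n 0).

Lemma definable_restriction_dpred n (f : 'rV[R[i]^o]_n -> R[i]^o) (S : set 'rV[R[i]^o]_n) :
  dpred (fun v => S (recon (@graph_re n) (@graph_im n) v) /\
    v (graph_vre n) +i* v (graph_vim n) = f (recon (@graph_re n) (@graph_im n) v)) ->
  definable_restriction f S.
Proof.
move=> [p hp]; exists p; apply/seteqP; split=> x /=.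
  move=> [_ [w Sw <-] <-]; apply/hp.
  set v := (realify _ 0 : _ -> R).
  have -> : recon (@graph_re n) (@graph_im n) v = w.
    apply/rowP => j; rewrite mxE /v /graph_re /graph_im /realify row_mxEl row_mxEr !mxE.
    by rewrite (unsplitK (inl j : 'I_n + 'I_1)); case: (w 0 j).
  split=> //; rewrite /v /graph_vre /graph_vim /realify row_mxEl row_mxEr !mxE.
  by rewrite (unsplitK (inr 0 : 'I_n + 'I_1)) !mxE; case: (f w).
move=> /hp[Sx fx]; set w := recon _ _ _ in Sx fx.
exists (row_mx w (const_mx (f w))); first by exists w.
apply/rowP => i; rewrite /realify -(splitK i); case: (fintype.split i) => j /=.
  rewrite row_mxEl mxE -(splitK j); case: (fintype.split j) => j' /=.
    by rewrite row_mxEl mxE.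
  by rewrite row_mxEr mxE -fx /= (ord1 j').
rewrite row_mxEr mxE -(splitK j); case: (fintype.split j) => j' /=.
  by rewrite row_mxEl mxE.
by rewrite row_mxEr mxE -fx /= (ord1 j').
Qed.

End Definability.

(** * Strict inequalities on boxes; passage to the real-valued modulus *)

Section LocalFacts.
Variables (R : realType) (n : nat).
Local Open Scope complex_scope.

Lemma strict_box (I : finType) (h : I -> 'rV[R]_n) (c : I -> R) y :
  (forall i, c i < dotv (h i) y) -> exists2 e : R, 0 < e &
    forall y' : 'rV[R]_n, (forall j, `|y' 0 j - y 0 j| <= e) -> forall i, c i < dotv (h i) y'.
Proof.
move=> cy; pose M i := \sum_j `|h i 0 j| + 1.
have M0 i : 0 < M i by rewrite ltr_wpDl // sumr_ge0.
have gap i : 0 < (dotv (h i) y - c i) / (2 * M i).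
  by rewrite divr_gt0 ?subr_gt0 ?mulr_gt0.
have [e e0 eP] := exists_pos_lb gap; exists e => // y' yy' i.
have le1 : `|dotv (h i) (y' - y)| <= e * M i.
  rewrite /M mulrDr mulr_sumr mulr1 ler_wpDr ?(ltW e0) //.
  rewrite (le_trans (ler_norm_sum _ _ _)) // ler_sum // => j _.
  by rewrite !mxE normrM mulrC ler_wpM2r.
have := eP i; rewrite ler_pdivlMr ?mulr_gt0 // => le2.
have -> : dotv (h i) y' = dotv (h i) y + dotv (h i) (y' - y).
  by rewrite -(functionalD (dotv_functional (h i))) addrC subrK.
have := cy i; move: le1; rewrite ler_norml; have : 0 < e * M i by rewrite mulr_gt0.
lra.
Qed.

Lemma differentiable_cdiff (f : 'rV[R[i]^o]_n -> R[i]^o) (w : 'rV[R[i]^o]_n) (u : 'rV[R[i]^o]_n) :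
  differentiable f w -> cdiff (fun t => f (w + t *: u)) 0.
Proof.
move=> df; have /cvg_ex[/= a fa] := @diff_derivable _ _ _ f w u df; exists a => e e0.
have eC : (0 : R[i]) < e%:C by rewrite ltcR.
move/cvgrPdist_le: fa => /(_ _ eC)/nbhs_ballP[d /= d0 H].
(* The radius is a positive element of [R[i]], which forces its imaginary part to vanish. *)
have dE : d = (Re d)%:C.
  by move: d0; rewrite ltcE => /andP[/eqP i0 _]; case: (d) i0 => x y /= ->.
have rd0 : 0 < Re d by move: d0; rewrite ltcE => /andP[].
exists (Re d) => // h hd; rewrite scale0r addr0 add0r.
have [->|h0] := eqVneq h 0.
  by rewrite scale0r addr0 subrr sub0r mulr0 oppr0 cmod0 mulr0.
have := H h; rewrite /ball /= sub0r normrN => /(_ _ h0).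
have -> : `|h : R[i]| < d by rewrite dE normrE ltcR.
move=> /(_ isT); rewrite distrC [X in X <= _]normrE lecR => H'.
have -> : f (w + h *: u) - f w - a * h = h * (h^-1 *: (f (h *: u + w) - f w) - a).
  by rewrite /GRing.scale /= [h *: u + w]addrC mulrBr mulVKf // (mulrC a).
by rewrite cmodM mulrC ler_wpM2r ?cmod_ge0.
Qed.

Lemma bounded_cmod (T : Type) (f : T -> R[i]^o) (A : set T) :
  [bounded f x | x in A] -> exists B : R, forall x, A x -> cmod (f x) <= B.
Proof.
move=> [M [Mr HM]]; have M1 : M < M + 1 by rewrite ltrDl ltr01.
exists (Re (M + 1)) => x Ax; have := HM _ M1 x Ax; rewrite /= normrE lecE /=.
by move=> /andP[].
Qed.

Lemma ce_polar (z : R[i]) : ce z = (expR (- (2 * pi * Im z)))%:C * ce (Re z)%:C.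
Proof. by rewrite /ce /= mulr0 oppr0 expR0 mul1r. Qed.

End LocalFacts.

(** * Fourier expansion over a shifted cone and its analytic pieces *)

Section ConeFourier.
Variables (R : realType) (n m : nat) (A : 'M[int]_(m, n)).
Local Open Scope complex_scope.
Local Notation C := (halfspaces (map_mx intr A : 'M[R]_(m, n))).
Local Notation a i := (rowA R A i).
Local Notation imv w := (map_mx (@complex.Im R) w).

Lemma coneP x : C x <-> forall i, 0 <= dotv (a i) x.
Proof. by split=> h i; have := h i; rewrite rowAE. Qed.

Variables (l : {linear 'rV[R]_n -> R^o}) (d0 : R) (v : 'rV[R]_n).
Hypothesis l_pos : forall x : 'rV[R]_n, C^° x -> 0 < (l x : R).
Hypothesis v_int : C^° v.

Definition linear_row : 'rV[R]_n := \row_j (l (delta_mx 0 j) : R).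
Local Notation lv := linear_row.

Lemma linear_dotv x : (l x : R) = dotv lv x.
Proof.
rewrite [in LHS](row_sum_delta x) linear_sum /=; apply: eq_bigr => j _.
by rewrite linearZ mxE mulrC.
Qed.

Lemma row_v_gt0 i : a i != 0 -> 0 < dotv (a i) v.
Proof. by move=> ai; apply: interior_dotv_gt v_int => // x /coneP. Qed.

Lemma cone_interior x : (forall i, a i != 0 -> 0 < dotv (a i) x) -> C^° x.
Proof.
(* A zero row imposes no condition; the bound [-1] makes its strict inequality hold. *)
move=> hx; pose c i : R := if a i == 0 then -1 else 0.
have [i|e e0 He] := @strict_box R n _ (fun i => a i) c x.
  rewrite /c; case: eqP => [->|/eqP/hx //].
  by rewrite dotvC (functional0 (dotv_functional x)) ltrN10.
rewrite /interior; apply/nbhs_ballP; exists e => //= y [_ yx]; apply/coneP => i.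
have xy j : `|y 0 j - x 0 j| <= e by have := yx 0 j; rewrite /ball /= distrC => /ltW.
have [a0|a0] := eqVneq (a i) 0.
  by rewrite a0 dotvC (functional0 (dotv_functional y)).
by have := He y xy i; rewrite /c (negPf a0) => /ltW.
Qed.

(** Adding a small positive multiple of [v] moves a point of the cone into its interior, where [l]
    is positive. *)
Lemma linear_cone_ge0 x : C x -> 0 <= dotv lv x.
Proof.
move=> /coneP Cx; have lv0 : 0 < dotv lv v by rewrite -linear_dotv; exact: l_pos.
apply/ler_addgt0Pr => e e0.
have : 0 < (l (x + (e / dotv lv v) *: v) : R).
  apply/l_pos/cone_interior => i ai.
  rewrite (functionalD (dotv_functional _)) (functionalZ (dotv_functional _)).
  by rewrite ltr_wpDl // mulr_gt0 ?divr_gt0 // row_v_gt0.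
rewrite linear_dotv (functionalD (dotv_functional _)) (functionalZ (dotv_functional _)).
by rewrite divfK ?gt_eqF // => /ltW.
Qed.

(** The interior of [shift_gt C v l d0], described by strict inequalities; zero rows must be left
    out as they never hold strictly. *)
Definition open_base : set 'rV[R]_n :=
  [set y | (forall i, a i != 0 -> 0 < dotv (a i) (y + v)) /\ d0 < dotv lv y].
Local Notation O := open_base.

Lemma open_base_shift_gt y : O y -> shift_gt C v l d0 y.
Proof.
move=> [h1 h2]; split; last by rewrite linear_dotv.
apply/coneP => i; have [->|ai] := eqVneq (a i) 0.
  by rewrite dotvC (functional0 (dotv_functional _)).
exact/ltW/h1.
Qed.

Lemma interior_open_base y : (shift_gt C v l d0)^° y -> O y.
Proof.
move=> Qy; split=> [i ai|]; last first.
  by have [_] := interior_subset Qy; rewrite linear_dotv.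
have : - dotv (a i) v < dotv (a i) y.
  apply: interior_dotv_gt Qy => // x [/coneP/(_ i)].
  by rewrite (functionalD (dotv_functional _)); lra.
by rewrite (functionalD (dotv_functional _)); lra.
Qed.

Lemma open_base_box y : O y -> exists2 e : R, 0 < e & inbox O y e.
Proof.
move=> [h1 h2].
pose h (o : option 'I_m) := if o is Some i then a i else lv.
pose c (o : option 'I_m) : R :=
  if o is Some i then (if a i == 0 then -1 else - dotv (a i) v) else d0.
have [[i|]|e e0 He] := @strict_box R n _ h c y => //.
  rewrite /h /c; case: eqP => [->|/eqP/h1].
    by rewrite dotvC (functional0 (dotv_functional y)) ltrN10.
  by rewrite (functionalD (dotv_functional _)); lra.
exists e => // y' yy'; have := He y' yy' => H; split=> [i ai|]; last exact: (H None).
by have := H (Some i); rewrite /h /c (negPf ai) (functionalD (dotv_functional _)); lra.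
Qed.

Lemma open_base_conv y y' (s : R) : 0 <= s <= 1 -> O y -> O y' -> O ((1 - s) *: y + s *: y').
Proof.
move=> /andP[s0 s1] [h1 h2] [h1' h2'].
have mix (p p' : R) : 0 < p -> 0 < p' -> 0 < (1 - s) * p + s * p'.
  move=> p0 p0'; have [->|sp] := eqVneq s 0; first by rewrite subr0 mul1r mul0r addr0.
  by rewrite ltr_wpDl ?mulr_ge0 ?mulr_gt0 ?subr_ge0 ?(ltW p0) // lt_neqAle eq_sym sp.
split=> [i ai|].
  have -> : (1 - s) *: y + s *: y' + v = (1 - s) *: (y + v) + s *: (y' + v).
    by apply/rowP => j; rewrite !mxE; ring.
  rewrite (functionalD (dotv_functional _)) !(functionalZ (dotv_functional _)).
  by apply: mix; [exact: h1|exact: h1'].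
rewrite (functionalD (dotv_functional _)) !(functionalZ (dotv_functional _)).
by have := @mix (dotv lv y - d0) (dotv lv y' - d0); rewrite !subr_gt0 => /(_ h2 h2'); lra.
Qed.

Lemma open_base_cone y x : O y -> C x -> O (y + x).
Proof.
move=> [h1 h2] Cx; split=> [i ai|].
  rewrite addrAC (functionalD (dotv_functional _)) ltr_wpDr ?h1 //.
  by move/coneP: Cx; exact.
by rewrite (functionalD (dotv_functional _)) ltr_wpDr // linear_cone_ge0.
Qed.

Variables (U : set 'rV[R[i]^o]_n) (theta : 'rV[R[i]^o]_n -> R[i]^o).
Hypothesis U_tube : tube (shift_gt C v l d0) `<=` U.
Hypothesis theta_hol : holomorphic_on U theta.
Hypothesis theta_per : periodic_on U theta.
Hypothesis theta_bnd : [bounded theta w | w in tube (shift_gt C v l d0)].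

Lemma cone_fourier y0 : O y0 -> exists (Cf : {ffun 'I_n -> int} -> R[i]) (B : R), 0 <= B /\
  forall w : 'rV[R[i]]_n, O (imv w) -> hsum (fun k => Cf k * ce (dotz k w)) (theta w) /\
    forall k, cmod (Cf k) <= B * expR (2 * pi * dotv (\row_j (k j)%:~R) (imv w)).
Proof.
move=> Oy0; have [B HB] := bounded_cmod theta_bnd.
have tU (w : 'rV[R[i]]_n) : O (imv w) -> tube (shift_gt C v l d0) w by move=> /open_base_shift_gt.
have Fd (w : 'rV[R[i]]_n) : O (imv w) -> forall j,
    cdiff (fun t => theta (w + t *: (delta_mx 0 j : 'rV[R[i]]_n))) 0.
  by move=> /tU/U_tube/theta_hol dw j; exact: differentiable_cdiff dw.
have Fp (w : 'rV[R[i]]_n) : O (imv w) -> forall j, theta (w + (delta_mx 0 j : 'rV[R[i]]_n)) = theta w.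
  move=> Ow j; have dE : (delta_mx 0 j : 'rV[R[i]]_n) = map_mx intr (delta_mx 0 j : 'rV[int]_n).
    by apply/rowP => i; rewrite !mxE; case: (_ && _).
  rewrite dE; apply: theta_per; first exact/U_tube/tU.
  apply/U_tube/tU; congr O: Ow; apply/rowP => i.
  by rewrite [LHS]mxE [RHS]mxE [in RHS]mxE -dE ImD mxE; case: (_ && _); rewrite /= addr0.
have Fb (w : 'rV[R[i]]_n) : O (imv w) -> cmod (theta w) <= B by move=> /tU /HB.
have [Cf HCf] := @fourier_tube R n O theta B open_base_box open_base_conv Fd Fp Fb y0 Oy0.
have B0 : 0 <= B.
  pose w0 : 'rV[R[i]]_n := \row_j ('i * (y0 0 j)%:C).
  have w0E : imv w0 = y0 by apply/rowP => j; rewrite !mxE /=; ring.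
  by apply: le_trans (cmod_ge0 _) (Fb w0 _); rewrite w0E.
exists Cf, (2 * B); split; first by rewrite mulr_ge0.
move=> w Ow; have [h1 h2] := HCf w Ow; split=> // k; apply: le_trans (h2 k) _.
by rewrite /dotv (eq_bigr (fun j => (\row_j (k j)%:~R : 'rV[R]_n) 0 j * imv w 0 j)) // => j _; rewrite !mxE.
Qed.

Section Represent.
Variables (Cf : {ffun 'I_n -> int} -> R[i]) (B : R) (y0 : 'rV[R]_n).
Hypothesis B0 : 0 <= B.
Hypothesis Oy0 : O y0.
Hypothesis Cf_sum : forall w : 'rV[R[i]]_n, O (imv w) ->
  hsum (fun k => Cf k * ce (dotz k w)) (theta w).
Hypothesis Cf_le : forall w : 'rV[R[i]]_n, O (imv w) ->
  forall k, cmod (Cf k) <= B * expR (2 * pi * dotv (\row_j (k j)%:~R) (imv w)).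

Let Cf_ley y k : O y -> cmod (Cf k) <= B * expR (2 * pi * dotv (\row_j (k j)%:~R) y).
Proof.
move=> Oy; pose w : 'rV[R[i]]_n := \row_j ('i * (y 0 j)%:C).
have wE : imv w = y by apply/rowP => j; rewrite !mxE /=; ring.
by have := @Cf_le w; rewrite wE => /(_ Oy).
Qed.

(** If [k] were negative on some [x] of the cone, the coefficient bound at [y0 + t *: x] would tend
    to 0 as [t] grows. *)
Lemma Cf_support k : Cf k != 0 -> dualC A (\row_j (k j)%:~R : 'rV[R]_n).
Proof.
move=> Ck x Cx; rewrite leNgt; apply/negP => neg; set kv := \row_j _ in neg *.
pose b := - (2 * pi * dotv kv x).
have b0 : 0 < b by rewrite oppr_gt0 pmulr_rlt0 // mulr_gt0 // pi_gt0.
pose K := B * expR (2 * pi * dotv kv y0); have K0 : 0 <= K by rewrite mulr_ge0 ?expR_ge0.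
pose c := cmod (Cf k); have c0 : 0 < c by exact: cmod_gt0.
(* For this [t] the bound reads [c <= K / expR (K / c)], and [expR s >= 1 + s] turns it into
   [c + K <= K]. *)
pose t := K / c / b; have t0 : 0 <= t by rewrite !divr_ge0 // ltW.
have Otx : O (y0 + t *: x).
  apply: open_base_cone => //; apply/coneP => i; rewrite (functionalZ (dotv_functional _)) mulr_ge0 //.
  by move/coneP: Cx; exact.
have := Cf_ley k Otx; rewrite -/c -/kv (functionalD (dotv_functional _)) (functionalZ (dotv_functional _)).
have -> : 2 * pi * (dotv kv y0 + t * dotv kv x) = 2 * pi * dotv kv y0 - t * b by rewrite /b; ring.
rewrite expRD mulrA -/K expRN; have tb : t * b = K / c by rewrite /t divfK ?gt_eqF.
rewrite tb => H; have Kc0 : 0 <= K / c by rewrite divr_ge0 // ltW.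
have e1 := expR_ge1Dx (K / c).
have ep : 0 < expR (K / c) by exact: expR_gt0.
move: H; rewrite ler_pdivlMr // => H.
have : c * (1 + K / c) <= K by rewrite (le_trans _ H) // ler_pM2l.
by rewrite mulrDr mulr1 mulrCA mulfV ?gt_eqF // mulr1; lra.
Qed.

Variables (s : seq 'rV[R]_n).
Hypothesis s_dual : forall h, h \in s -> h != 0 /\ dualC A h.
Hypothesis s_gen : forall k : {ffun 'I_n -> int}, dualC A (\row_j (k j)%:~R : 'rV[R]_n) ->
  exists al : 'rV[R]_n -> nat, \row_j (k j)%:~R = \sum_(h <- s) h *+ al h.

Local Notation N := (size s).
Let hv (j : 'I_N) := nth 0 s j.

Definition polar_arg (w : 'rV[R[i]]_n) (i : 'I_(N + n)) : R :=
  match fintype.split i with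
  | inl j => expR (- (2 * pi * dotv (nth 0 s j) (imv w)))
  | inr j => Re (w 0 j)
  end.

Lemma exponents : exists al : {ffun 'I_n -> int} -> 'I_N -> nat, forall k, Cf k != 0 ->
  forall y, dotv (\row_j (k j)%:~R) y = \sum_j (al k j)%:R * dotv (hv j) y.
Proof.
have /choice[al alP] : forall k, exists al : 'I_N -> nat, Cf k != 0 ->
    forall y, dotv (\row_j (k j)%:~R) y = \sum_j (al j)%:R * dotv (hv j) y.
  move=> k; have [C0|Ck] := eqVneq (Cf k) 0; first by exists (fun=> 0%N).
  have [al E] := s_gen (Cf_support Ck); exists (fun j => al (hv j)) => _ y.
  rewrite E dotv_suml (big_nth 0) big_mkord; apply: eq_bigr => j _.
  by rewrite -scaler_nat dotvZl.
by exists al.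
Qed.

(** Coefficients are estimated around [p - tau *: v], whereas the piece lies over the cone with apex
    [p]. Every generator [h] is nonzero and dual, hence positive on the interior point [v]: the
    radii [rr] strictly exceed the sides [hi]. *)
Lemma restricted_analytic_piece (p : 'rV[R]_n) (tau r : R) : 0 < tau -> O (p - tau *: v) ->
  exists gre gim : restricted_analytic R (N + n),
  forall w : 'rV[R[i]]_n, C (imv w - p) -> (forall j, `|Re (w 0 j)| <= r) ->
    theta w = ra_val gre (\row_i polar_arg w i) +i* ra_val gim (\row_i polar_arg w i).
Proof.
move=> tau0 Op; have p0 := @pi_gt0 R; have [al alP] := exponents.
have [del del0 ib] := open_base_box Op; set p2 := p - tau *: v in Op ib.
pose rr (j : 'I_N) := expR (- (2 * pi * dotv (hv j) p2)).
pose hi (j : 'I_N) := expR (- (2 * pi * dotv (hv j) p)).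
have hvs j : hv j \in s by rewrite mem_nth.
have hhi j : hi j < rr j.
  rewrite ltr_expR ltrN2 ltr_pM2l ?mulr_gt0 // /p2 (functionalD (dotv_functional _)).
  rewrite (functionalN (dotv_functional _)) (functionalZ (dotv_functional _)) gtrBl mulr_gt0 //.
  have [h0 hd] := s_dual (hvs j).
  by apply: interior_dotv_gt v_int.
pose q := expR (- (pi * del)).
have q01 : 0 < q < 1 by rewrite expR_gt0 -expR0 ltr_expR oppr_lt0 mulr_gt0.
pose nk (k : {ffun 'I_n -> int}) : R := \sum_i `|k i|%:~R.
have rrE k y : Cf k != 0 -> \prod_j expR (- (2 * pi * dotv (hv j) y)) ^+ al k j =
    expR (- (2 * pi * dotv (\row_j (k j)%:~R) y)).
  move=> Ck; rewrite alP // mulr_sumr -sumrN expR_sum; apply: eq_bigr => j _.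
  by rewrite -expRM_natl; congr expR; ring.
have Ck_le k : cmod (Cf k) * (\prod_j rr j ^+ al k j * expR (pi * del * nk k)) <=
    B * \prod_i q ^+ `|k i|%N.
  have [C0|Ck] := eqVneq (Cf k) 0.
    by rewrite C0 cmod0 mul0r mulr_ge0 // prodr_ge0 // => i _; rewrite exprn_ge0 ?expR_ge0.
  have -> : \prod_i q ^+ `|k i|%N = expR (- (pi * del * nk k)).
    rewrite /nk mulr_sumr -sumrN expR_sum; apply: eq_bigr => i _.
    by rewrite -expRM_natl -abszE -pmulrn; congr expR; ring.
  (* The corner of the box around [p2] where [k] is smallest. It gains
     [expR (- (2 * pi * del * nk k))]; half of the exponent pays for the angular margin, the other
     half makes the sum converge. *)
  pose y : 'rV[R]_n := \row_j (p2 0 j - del * Num.sg (k j)%:~R).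
  have Oy : O y.
    apply: ib => j; rewrite mxE [X in X - _]addrC addrK normrN normrM (gtr0_norm del0).
    by rewrite ler_piMr ?(ltW del0) // normr_sg; case: (_ != 0).
  have dy : dotv (\row_j (k j)%:~R) y = dotv (\row_j (k j)%:~R) p2 - del * nk k.
    rewrite /dotv /nk mulr_sumr -sumrB; apply: eq_bigr => j _; rewrite !mxE.
    by rewrite intr_norm normrEsg; ring.
  have := Cf_ley k Oy; rewrite dy => H.
  rewrite rrE // -expRD (le_trans (ler_wpM2r (expR_ge0 _) H)) // -[X in X <= _]mulrA -expRD.
  by rewrite ler_wpM2l // ler_expR; lra.
have Csum (D : {fset {ffun 'I_n -> int}}) :
    \sum_(k <- D) cmod (Cf k) * (\prod_j rr j ^+ al k j * expR (pi * del * nk k)) <=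
    B * \prod_(i < n) (2 / (1 - q)).
  case/andP: (q01) => q0 q1.
  apply: (@le_trans _ _ (B * \sum_(k <- D) \prod_i q ^+ `|k i|%N)).
    by rewrite mulr_sumr ler_sum // => k _; exact: Ck_le.
  rewrite ler_wpM2l //.
  have := @abs_bdd_prod R n int (fun (_ : 'I_n) (k : int) => (q ^+ `|k|%N)%:C) (fun=> 2 / (1 - q)).
  have qc (i : nat) : cmod (q ^+ i)%:C = q ^+ i by rewrite cmodR ger0_norm // exprn_ge0 // ltW.
  move=> /(_ _ D); rewrite (eq_bigr (fun k : {ffun 'I_n -> int} => \prod_i q ^+ `|k i|%N)).
    apply=> i E; rewrite (eq_bigr (fun k : int => q ^+ `|k|%N)) => [|k _]; last by rewrite qc.
    by apply: geom_int_sum; rewrite ltW.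
  by move=> k _; rewrite cmod_prod; apply: eq_bigr => i _; rewrite qc.
have rr0 j : 0 < rr j by exact: expR_gt0.
have e0 : 0 < pi * del by rewrite mulr_gt0.
have [gre [gim G]] := pf_restricted rr0 e0 Csum r hhi.
exists gre, gim => w Cw wr; set x := \row_i polar_arg w i.
have xl j : x 0 (lshift n j) = expR (- (2 * pi * dotv (hv j) (imv w))).
  by rewrite mxE /polar_arg (unsplitK (inl j : 'I_N + 'I_n)).
have xr j : x 0 (rshift N j) = Re (w 0 j).
  by rewrite mxE /polar_arg (unsplitK (inr j : 'I_N + 'I_n)).
have xhi j : 0 <= x 0 (lshift n j) <= hi j.
  rewrite xl expR_ge0 ler_expR lerN2 ler_pM2l ?mulr_gt0 //= -subr_ge0.
  have [_ hd] := s_dual (hvs j); have := hd _ Cw.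
  by rewrite (functionalD (dotv_functional _)) (functionalN (dotv_functional _)).
rewrite G //; last by move=> j; rewrite xr.
have xW : pf_dom rr x.
  by move=> j; case/andP: (xhi j) => x0 x1; rewrite ger0_norm // (le_lt_trans x1).
have Ow : O (imv w).
  have -> : imv w = p2 + (tau *: v + (imv w - p)).
    by apply/rowP => j; rewrite /p2 !mxE; ring.
  apply: open_base_cone => //; apply/coneP => i.
  rewrite (functionalD (dotv_functional _)) (functionalZ (dotv_functional _)) addr_ge0 //.
    by rewrite mulr_ge0 ?(ltW tau0) //; move/coneP: (interior_subset v_int); exact.
  by move/coneP: Cw; exact.
apply: hsum_uniq (Cf_sum Ow) _.
have := pf_sum rr0 e0 Csum xW; apply: eq_hsum => k; rewrite /pf_term.
have [->|Ck] := eqVneq (Cf k) 0; first by rewrite !mul0r.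
congr (_ * _); rewrite /dotz ce_sum.
rewrite [RHS](eq_bigr (fun j => (expR (- (2 * pi * ((k j)%:~R * Im (w 0 j)))))%:C *
    ce ((Re (w 0 j))%:C *~ k j))) => [|j _]; last first.
  by rewrite ce_polar ImMz ReMz -rmorphMz /= -(mulrzl (Re (w 0 j))).
rewrite [RHS]big_split /=.
congr (_ * _); last by apply: eq_bigr => j _; rewrite xr.
rewrite (eq_bigr (fun j => (expR (- (2 * pi * dotv (hv j) (imv w))) ^+ al k j)%:C)) => [|j _]; last first.
  by rewrite xl rmorphXn.
rewrite -!rmorph_prod rrE //; congr (_%:C).
rewrite /dotv mulr_sumr -sumrN expR_sum; apply: eq_bigr => j _.
by rewrite !mxE.
Qed.

End Represent.

End ConeFourier.

(** * Finitely many cones covering the closed polyhedron *)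

Section ConeCover.
Variables (R : realType) (n m : nat) (A : 'M[int]_(m, n)).
Local Notation C := (halfspaces (map_mx intr A : 'M[R]_(m, n))).
Local Notation a i := (rowA R A i).
Variables (l : {linear 'rV[R]_n -> R^o}) (d0 d : R) (u v : 'rV[R]_n).
Hypothesis v_int : C^° v.
Hypothesis d0d : d0 < d.
Hypothesis shift_sub : shift_ge C u l d `<=` (shift_gt C v l d0)^°.
Local Notation lv := (linear_row l).
Local Notation P := (shift_ge C u l d).
Local Notation O := (open_base A l d0 v).

(** [P] lies in the interior, so each slack with respect to [v] is strictly positive on it;
    [strict_bound] makes this uniform although [P] is unbounded. *)
Lemma uniform_gap y0 : P y0 -> exists2 e : R, 0 < e &
  forall y i, P y -> a i != 0 -> e <= dotv (a i) (y + v).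
Proof.
move=> Py0.
(* At the index [m] the function [insub] fails; this slot holds the inequality for [l]. *)
pose f (k : nat) : 'rV[R]_n -> R := if insub k is Some i then dotv (a i) else dotv lv.
pose b (k : nat) : R := if insub k is Some i then - dotv (a i) u else d.
have PE y : P y <-> forall k, (k < m.+1)%N -> b k <= f k y.
  split=> [[/coneP h1 h2] k _|h].
    rewrite /b /f; case: insubP => [i _ _|_]; last by rewrite -linear_dotv.
    by have := h1 i; rewrite (functionalD (dotv_functional _)); lra.
  split; last by have := h m (ltnSn m); rewrite /b /f insubF ?ltnn // linear_dotv.
  apply/coneP => i; have := h i (leqW (ltn_ord i)); rewrite /b /f valK.
  by rewrite (functionalD (dotv_functional _)); lra.
have fl k : functional (f k).
  by rewrite /f; case: insubP => *; exact: dotv_functional.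
have gap i : exists2 e : R, 0 < e & forall y, P y -> a i != 0 -> e <= dotv (a i) (y + v).
  have [->|ai] := eqVneq (a i) 0; first by exists 1.
  have [|y /PE/shift_sub/interior_open_base[h _]|e e0 He] := @strict_bound R _ m.+1 f b
      (dotv (a i)) (- dotv (a i) v) y0 (fun k _ => fl k) (dotv_functional _).
  - by apply/PE.
  - by have := h i ai; rewrite (functionalD (dotv_functional _)); lra.
  - exists e => // y /PE Py _; have := He y Py.
    by rewrite (functionalD (dotv_functional _)); lra.
have /choice[e He] : forall i, exists e : R, 0 < e /\
    forall y, P y -> a i != 0 -> e <= dotv (a i) (y + v).
  by move=> i; have [e e0 He] := gap i; exists e.
have [e' e0 e'P] := exists_pos_lb (fun i => (He i).1); exists e' => // y i Py ai.
exact: le_trans (e'P i) ((He i).2 y Py ai).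
Qed.

(* By Dickson's lemma, finitely many points [yc] of [P] suffice so that every
   [y] of [P] has slacks no smaller than those of some [yc], up to [eta]. *)
Lemma finite_cover y0 : P y0 -> exists (tau : R) (Lp : seq 'rV[R]_n), [/\ 0 < tau,
  forall p, p \in Lp -> O (p - tau *: v) &
  forall y, P y -> exists2 p, p \in Lp & forall i, a i != 0 -> 0 < dotv (a i) (y - p)].
Proof.
move=> Py0; have [eps eps0 epsP] := uniform_gap Py0.
pose h (o : option 'I_m) := `|dotv (if o is Some i then a i else lv) v| + 1.
have h0 o : 0 < h o by rewrite ltr_wpDl.
(* Chosen so that receding by [2 * tau] along [v] costs less than the gap in every row and less than
   [d - d0] in [l]: once for placing the apex, once for the margin behind it. *)
pose g (o : option 'I_m) : R := (if o is Some i then eps else d - d0) / (4 * h o).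
have g0 o : 0 < g o.
  by rewrite divr_gt0 ?mulr_gt0 //; case: o => [i|] //; rewrite subr_gt0.
have [tau tau0 tauP] := exists_pos_lb g0.
have small o : 2 * (tau * dotv (if o is Some i then a i else lv) v) <
    if o is Some i then eps else d - d0.
  have := tauP o; rewrite ler_pdivlMr ?mulr_gt0 //; apply: lt_le_trans.
  rewrite (_ : tau * (4 * h o) = 2 * (tau * (2 * h o))); last by ring.
  rewrite ltr_pM2l // ltr_pM2l // /h.
  by have := ler_norm (dotv (if o is Some i then a i else lv) v);
     have := normr_ge0 (dotv (if o is Some i then a i else lv) v); lra.
(* The rounding unit is at most the slack that one shift by [tau *: v] produces in any nonzero
   row. *)
have [eta eta0 etaP] : exists2 eta : R, 0 < eta & forall i, a i != 0 -> eta <= tau * dotv (a i) v.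
  have [i|eta eta0 etaP] := @exists_pos_lb R _ (fun i => if a i == 0 then 1 else tau * dotv (a i) v).
    by case: eqP => // /eqP ai; rewrite mulr_gt0 // row_v_gt0.
  by exists eta => // i ai; have := etaP i; rewrite (negPf ai).
(* Slacks counted in units of [eta]. Truncation loses less than one unit, which the shift of the
   apex to [yc - tau *: v] makes up. *)
pose sl (k : nat) y : nat := if insub k is Some i then Num.truncn (dotv (a i) (y + u) / eta) else 0%N.
have [L LP LD] := @dickson _ m sl P.
exists tau, [seq yc - tau *: v | yc <- L]; split=> // [_ /mapP[yc /LP Pc ->]|y Py].
  split=> [i ai|].
    have := epsP yc i Pc ai; have := small (Some i).
    rewrite !(functionalD (dotv_functional _)) !(functionalN (dotv_functional _)).
    by rewrite !(functionalZ (dotv_functional _)); lra.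
  have [_] := Pc; rewrite linear_dotv; have := small None.
  rewrite !(functionalD (dotv_functional _)) !(functionalN (dotv_functional _)).
  by rewrite !(functionalZ (dotv_functional _)); lra.
have [yc ycL ycy] := LD y Py; exists (yc - tau *: v); first exact: map_f.
move=> i ai; have := ycy i (ltn_ord i); rewrite /sl valK => le1.
have Pc := LP _ ycL; have [/coneP/(_ i) c0 _] := Pc; have [/coneP/(_ i) y0' _] := Py.
have t1 : dotv (a i) (yc + u) / eta < (Num.truncn (dotv (a i) (yc + u) / eta)).+1%:R.
  by have /andP[] := Num.Theory.truncn_itv (divr_ge0 c0 (ltW eta0)).
have t2 : (Num.truncn (dotv (a i) (y + u) / eta))%:R <= dotv (a i) (y + u) / eta.
  by have /andP[] := Num.Theory.truncn_itv (divr_ge0 y0' (ltW eta0)).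
have : dotv (a i) (yc + u) / eta < dotv (a i) (y + u) / eta + 1.
  apply: lt_le_trans t1 _; rewrite -natr1 lerD2r (le_trans _ t2) // ler_nat.
  exact: le1.
rewrite ltr_pdivrMr // mulrDl divfK ?gt_eqF // mul1r.
have := etaP i ai.
rewrite !(functionalD (dotv_functional _)) !(functionalN (dotv_functional _)).
rewrite !(functionalD (dotv_functional _)) !(functionalN (dotv_functional _)).
by rewrite !(functionalZ (dotv_functional _)); lra.
Qed.

End ConeCover.

(** * Definability of cones, tubes and piecewise given functions *)

Section TubeDefinability.
Variables (R : realType) (n : nat).
Local Open Scope complex_scope.
Local Notation imv w := (map_mx (@complex.Im R) w).

Section Context.
Variables (N : nat) (re im : 'I_n -> 'I_N).

Lemma dterm_dotv_im (h p : 'rV[R]_n) : dterm (fun x => dotv h (imv (recon re im x) - p)).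
Proof.
have [t ht] := dterm_sum (index_enum 'I_n) (fun j => dtermM (dterm_const N (h 0 j))
  (dtermD (dterm_var R (im j)) (dterm_const N (- p 0 j)))).
by exists t => x; rewrite ht; apply: eq_bigr => j _; rewrite !mxE.
Qed.

Lemma dterm_polar_arg (s : seq 'rV[R]_n) i : dterm (fun x => polar_arg (s := s) (recon re im x) i).
Proof.
rewrite /polar_arg; case: (fintype.split i) => j.
  have [t ht] := dterm_exp (dtermM (dterm_const N (- (2 * pi))) (dterm_dotv_im (nth 0 s j) 0)).
  by exists t => x; rewrite ht subr0 mulNr.
by have [t ht] := dterm_var R (re j); exists t => x; rewrite ht mxE.
Qed.

Lemma dpred_Re_lt (r : R) : dpred (fun x => forall j, `|Re (recon re im x 0 j)| < r).
Proof.
apply: dpred_ext (dpred_forall (fun j => dpred_and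
  (dpred_lt (dterm_const N (- r)) (dterm_var R (re j)))
  (dpred_lt (dterm_var R (re j)) (dterm_const N r)))) => x.
by split=> h j; have := h j; rewrite mxE ltr_norml => /andP.
Qed.

Lemma dpred_Re_le (r : R) : dpred (fun x => forall j, `|Re (recon re im x 0 j)| <= r).
Proof.
apply: dpred_ext (dpred_forall (fun j => dpred_and
  (dpred_le (dterm_const N (- r)) (dterm_var R (re j)))
  (dpred_le (dterm_var R (re j)) (dterm_const N r)))) => x.
by split=> h j; have := h j; rewrite mxE ler_norml => /andP.
Qed.

Lemma dpred_cone m (A : 'M[int]_(m, n)) (p : 'rV[R]_n) :
  dpred (fun x => halfspaces (map_mx intr A) (imv (recon re im x) - p)).
Proof.
apply: dpred_ext (dpred_forall (fun i => dpred_le (dterm_const N 0) (dterm_dotv_im (rowA R A i) p))) => x.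
by rewrite coneP.
Qed.

Lemma dpred_shift_ge m (A : 'M[int]_(m, n)) (u : 'rV[R]_n) (l : {linear 'rV[R]_n -> R^o}) (d : R) :
  dpred (fun x => shift_ge (halfspaces (map_mx intr A)) u l d (imv (recon re im x))).
Proof.
apply: dpred_ext (dpred_and (dpred_cone A (- u))
  (dpred_le (dterm_const N d) (dterm_dotv_im (linear_row l) 0))) => x.
by rewrite opprK subr0 -linear_dotv.
Qed.

Lemma dpred_open_cone m (A : 'M[int]_(m, n)) (p : 'rV[R]_n) :
  dpred (fun x => forall i, rowA R A i != 0 -> 0 < dotv (rowA R A i) (imv (recon re im x) - p)).
Proof.
apply: dpred_forall => i; have [a0|a0] := eqVneq (rowA R A i) 0.
  by apply: dpred_ext (dpred_const R N True) => x; split.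
apply: dpred_ext (dpred_lt (dterm_const N 0) (dterm_dotv_im (rowA R A i) p)) => x.
by split=> [h _|]; [|exact].
Qed.

End Context.

(** The graph over [S] is a finite union of graphs over cones. The cones may overlap: each piece
    agrees with [theta] on all of its cone, so no selection of a piece is needed. *)
Lemma definable_pieces m (A : 'M[int]_(m, n)) (theta : 'rV[R[i]^o]_n -> R[i]^o) (r : R)
    (s Lp : seq 'rV[R]_n) (gre gim : 'rV[R]_n -> restricted_analytic R (size s + n))
    (S : set 'rV[R[i]^o]_n) :
  (forall p w, p \in Lp -> halfspaces (map_mx intr A) (imv w - p) ->
     (forall j, `|Re (w 0 j)| <= r) ->
     theta w = ra_val (gre p) (\row_i polar_arg w i) +i* ra_val (gim p) (\row_i polar_arg w i)) ->
  (forall w, S w -> (forall j, `|Re (w 0 j)| <= r) /\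
     exists2 p, p \in Lp & halfspaces (map_mx intr A) (imv w - p)) ->
  (forall N (re im : 'I_n -> 'I_N), dpred (fun x => S (recon re im x))) ->
  definable_restriction theta S.
Proof.
move=> thE SL dS; apply: definable_restriction_dpred.
set re := @graph_re n; set im := @graph_im n.
have dE p := dpred_and (dpred_cone re im A p) (dpred_and
  (dpred_eq (dterm_var R (graph_vre n)) (dterm_ran (gre p) (@dterm_polar_arg _ re im s)))
  (dpred_eq (dterm_var R (graph_vim n)) (dterm_ran (gim p) (@dterm_polar_arg _ re im s)))).
apply: dpred_ext (dpred_and (dS _ re im) (dpred_exists_seq Lp dE)) => x /=.
split=> [[Sx [p pL [Cp [-> ->]]]]|[Sx E]]; split=> //.
  by rewrite [RHS](thE p) //; have [] := SL _ Sx.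
have [Rx [p pL Cp]] := SL _ Sx; exists p => //; split=> //.
by move: E; rewrite (thE p) // => -[].
Qed.

Lemma open_tube_cones m (A : 'M[int]_(m, n)) (r : R) (Lp : seq 'rV[R]_n) :
  open [set w : 'rV[R[i]^o]_n | (forall j, `|Re (w 0 j)| < r) /\ exists2 p, p \in Lp &
    forall i, rowA R A i != 0 -> 0 < dotv (rowA R A i) (imv w - p)].
Proof.
rewrite openE => w [wr [p pL wp]].
have [j|e1 e10 e1P] := @exists_pos_lb R _ (fun j : 'I_n => r - `|Re (w 0 j)|).
  by rewrite subr_gt0.
pose c i : R := if rowA R A i == 0 then -1 else dotv (rowA R A i) p.
have [i|e2 e20 e2P] := @strict_box R n _ (rowA R A) c (imv w).
  rewrite /c; case: eqP => [->|/eqP/wp].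
    by rewrite dotvC (functional0 (dotv_functional _)) ltrN10.
  by rewrite (functionalD (dotv_functional _)) (functionalN (dotv_functional _)) subr_gt0.
pose e := Num.min e1 e2; have e0 : 0 < e by rewrite lt_min e10.
apply/nbhs_ballP; exists e%:C => /=; first by rewrite ltcR.
move=> w' [_ ww']; have near_ j : cmod (w 0 j - w' 0 j) < e.
  by have := ww' 0 j; rewrite /ball /= normrE ltcR.
split=> [j|].
  have h2 := e1P j.
  have : `|Re (w 0 j - w' 0 j)| < e1.
    by rewrite (le_lt_trans (Re_le_cmod _)) // (lt_le_trans (near_ j)) // ge_min lexx.
  rewrite ReD ReN distrC => h1.
  have := ler_normD (Re (w' 0 j) - Re (w 0 j)) (Re (w 0 j)); rewrite subrK => h3; lra.
exists p => // i ai; rewrite (functionalD (dotv_functional _)) (functionalN (dotv_functional _)).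
rewrite subr_gt0; have := e2P (imv w') _ i; rewrite /c (negPf ai); apply=> j.
rewrite !mxE distrC -ImN -ImD (le_trans (Im_le_cmod _)) //.
by rewrite ltW // (lt_le_trans (near_ j)) // ge_min lexx orbT.
Qed.

End TubeDefinability.

Theorem theorem5p8 (R : realType) (n : nat) (C : set 'rV[R]_n)
    (l : {linear 'rV[R]_n -> R^o}) (d0 : R) (v : 'rV[R]_n)
    (U : set 'rV[R[i]^o]_n) (theta : 'rV[R[i]^o]_n -> R[i]^o)
    (C_cone : integral_polyhedral_cone C)
    (C_dim : span_dim C n)
    (l_integral : integral_linear l)
    (l_pos : forall x : 'rV[R]_n, C^° x -> 0 < (l x : R))
    (d0_pos : 0 < d0)
    (v_int : C^° v)
    (U_open : open U)
    (U_tube : tube (shift_gt C v l d0) `<=` U)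
    (theta_hol : holomorphic_on U theta)
    (theta_per : periodic_on U theta)
    (theta_bnd : [bounded theta w | w in tube (shift_gt C v l d0)]) :
  forall (d : R) (u : 'rV[R]_n) (r : R),
    d0 < d -> C u -> vlt u v -> 0 < r ->
    (* domain condition: theta is only given on U; it follows from
       v - u being interior to C, hence from u < v if C contains the
       nonnegative orthant *)
    shift_ge C u l d `<=` (shift_gt C v l d0)^° ->
    definable_restriction theta (tube_le r (shift_ge C u l d)) /\
    exists V : set 'rV[R[i]^o]_n,
      [/\ open V, definableC V, tube_le r (shift_ge C u l d) `<=` V,
          V `<=` U & definable_restriction theta V].
Proof.
move=> d u r d0d _ _ r0; case: C_cone => m [A CE]; subst C => sub.
(* The Fourier expansion and the cover both start from a point of the polyhedron; without one the
   tube is empty. *)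
have [[y0 Py0]|nP] := pselect (exists y, shift_ge (halfspaces (map_mx intr A)) u l d y); last first.
  have -> : tube_le r (shift_ge (halfspaces (map_mx intr A)) u l d) = set0.
    by apply/seteqP; split=> w // [Pw _]; apply: nP; exists (map_mx (@complex.Im R) w).
  have d0' : definable_restriction theta set0.
    by apply: definable_restriction_dpred; apply: dpred_ext (dpred_const R _ False) => x; split=> // -[].
  split=> //; exists set0; split=> //.
  by apply: definableC_dpred; exact: dpred_const.
have Oy0 := interior_open_base (sub _ Py0).
have [Cf [B [B0 HCf]]] := cone_fourier U_tube theta_hol theta_per theta_bnd Oy0.
have [s [_ s_dual s_gen]] := gordan R A.
have [tau [Lp [tau0 LpO LpP]]] := finite_cover v_int d0d sub Py0.
have rep := restricted_analytic_piece l_pos v_int B0 Oy0 (fun w Ow => (HCf w Ow).1) (fun w Ow => (HCf w Ow).2) s_dual s_gen.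
(* Room for an open condition on real parts that contains the closed one. *)
pose r1 := r + 1.
have /choice[g gP] : forall p : 'rV[R]_n, exists g : restricted_analytic R (size s + n) * restricted_analytic R (size s + n),
    p \in Lp -> forall w : 'rV[R[i]]_n, halfspaces (map_mx intr A) (map_mx (@complex.Im R) w - p) ->
    (forall j, `|Re (w 0 j)| <= r1) ->
    theta w = (ra_val g.1 (\row_i polar_arg w i) +i* ra_val g.2 (\row_i polar_arg w i))%C.
  move=> p; have [pL|pL] := boolP (p \in Lp).
    by have [gre [gim G]] := rep p tau r1 tau0 (LpO p pL); exists (gre, gim).
  (* The choice function is total, so outside [Lp] some value is needed; any listed apex supplies
     one. *)
  have [yc ycL _] := LpP _ Py0.
  by have [gre [gim _]] := rep yc tau r1 tau0 (LpO yc ycL); exists (gre, gim).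
(* The cover by open cones makes [V] open; the pieces, valid on the closed cones with real parts up
   to [r1], represent [theta] on [V] too. *)
pose V := [set w : 'rV[R[i]^o]_n | (forall j, `|Re (w 0 j)| < r1) /\ exists2 p, p \in Lp &
  forall i, rowA R A i != 0 -> 0 < dotv (rowA R A i) (map_mx (@complex.Im R) w - p)].
have coneV (x : 'rV[R]_n) : (forall i, rowA R A i != 0 -> 0 < dotv (rowA R A i) x) ->
    halfspaces (map_mx intr A) x.
  by move=> h; exact: interior_subset (cone_interior h).
have tV : tube_le r (shift_ge (halfspaces (map_mx intr A)) u l d) `<=` V.
  move=> w [Pw wr]; split; last exact: LpP.
  by move=> j; rewrite (le_lt_trans (wr j)) // ltrDl.
have dV N (re im : 'I_n -> 'I_N) : dpred (fun x => V (recon re im x)).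
  exact: dpred_and (dpred_Re_lt re im r1)
    (dpred_exists_seq Lp (fun p => dpred_open_cone re im A p)).
have VL w : V w -> (forall j, `|Re (w 0 j)| <= r1) /\ exists2 p, p \in Lp &
    halfspaces (map_mx intr A) (map_mx (@complex.Im R) w - p).
  by move=> [h [p pL hp]]; split=> [j|]; [exact: ltW|exists p; [|exact: coneV]].
have gP' p w (pL : p \in Lp) := gP p pL w.
split.
  apply: (definable_pieces gP') => [w /tV/VL //|N re im].
  exact: dpred_and (dpred_shift_ge re im A u l d) (dpred_Re_le re im r).
exists V; split=> //.
- exact: open_tube_cones.
- exact: definableC_dpred.
- move=> w /VL[_ [p pL Cp]]; apply/U_tube/open_base_shift_gt.
  (* The base point [p - tau *: v] lies in the open base, and the remaining summand lies in the
     cone. *)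
  rewrite (_ : map_mx _ w = p - tau *: v + (tau *: v + (map_mx (@complex.Im R) w - p))); last first.
    by apply/rowP => j; rewrite !mxE; ring.
  apply: open_base_cone => //; first exact: LpO.
  apply/coneP => i; rewrite (functionalD (dotv_functional _)) (functionalZ (dotv_functional _)) addr_ge0 //.
    by rewrite mulr_ge0 ?(ltW tau0) //; move/coneP: (interior_subset v_int); exact.
  by move/coneP: Cp; exact.
- by apply: (definable_pieces gP') => // w /VL.
Qed.
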